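(* Let $d$ be either the metric induced by the norm $\|(x_1,x_2,t)\|_{JM}=\sqrt{x_1^2+x_2^2}+|t|$ or the Euclidean metric, here regarded as a metric on $\mathbb{T}(s)\times[0,s]$ (see context). Let $C_d=\sup\{d(x,y):x,y\in[0,1]^3\}$. Let $0<p_1<p_2<1$ and $\varepsilon>0$ be given, and let $\delta=\delta(s)$ be any function with $0<\delta(s)\le s^{-\varepsilon}$. Then, for each $s$, one may construct in a common probability space Poisson processes $\mathcal{P}_1^+,\mathcal{P}_1^-,\mathcal{P}_2^+,\mathcal{P}_2^-$ on $\mathbb{T}(s)\times[0,s]$ of intensities $p_1$, $1-p_1$, $p_2$, $1-p_2$ respectively, with $\mathcal{P}_i^+$ and $\mathcal{P}_i^-$ independent for $i=1,2$, such that the following event $E_{gl}$ has probability $1-o(1)$ as $s\to\infty$: for every piecewise-linear path $P_1\subset\mathbb{T}(s)$ that is black with respect to $(\mathcal{P}_1^+,\mathcal{P}_1^-)$ there is a piecewise-linear path $P_2\subset\mathbb{T}(s)$ that is $(2C_d\delta)$-robustly black with respect to $(\mathcal{P}_2^+,\mathcal{P}_2^-)$, such that every point of $P_2$ is within distance $\log s$ of some point of $P_1$ and vice versa.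
   Context: $\mathbb{T}(s)$ denotes the $s$ by $s$ torus $\mathbb{R}^2/(s\mathbb{Z})^2$; the metric $d$ on $\mathbb{R}^2\times\mathbb{R}$ induces a metric on $\mathbb{T}(s)\times[0,s]$ in the natural way (no wrapping in the third coordinate), and $\mathbb{T}(s)$ is identified with $\mathbb{T}(s)\times\{0\}$. For a pair $(X^+,X^-)$ of discrete subsets of $\mathbb{T}(s)\times[0,s]$, a point $x\in\mathbb{T}(s)$ is black with respect to $(X^+,X^-)$ if $d(x,X^+)\le d(x,X^-)$ (i.e. some nearest point of $X^+\cup X^-$ to $x$ lies in $X^+$), and is $\eta$-robustly black if $d(x,X^+)\le d(x,X^-)-\eta$, i.e. the closest point of $X^+$ is at least $\eta$ closer to $x$ than the closest point of $X^-$. A path is black (resp. $\eta$-robustly black) if each of its points is. *)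

(* Defs.v *)
From HB Require Import structures.
From mathcomp Require Import all_boot all_order all_algebra.
From mathcomp Require Import all_classical all_reals all_analysis.
Set Implicit Arguments. Unset Strict Implicit. Unset Printing Implicit Defensive.
Import Order.TTheory GRing.Theory Num.Def Num.Theory.
Local Open Scope classical_set_scope.
Local Open Scope ring_scope.

Definition pt3 (R : realType) := ((R * R) * R)%type.

Inductive norm_kind := JM | Euclid.

Definition norm3 {R : realType} (k : norm_kind) (v : pt3 R) : R :=
  match k with
  | JM => Num.sqrt (v.1.1 ^+ 2 + v.1.2 ^+ 2) + `|v.2|
  | Euclid => Num.sqrt (v.1.1 ^+ 2 + v.1.2 ^+ 2 + v.2 ^+ 2)
  end.

Definition unit_cube {R : realType} : set (pt3 R) :=
  [set v | [/\ 0 <= v.1.1 <= 1, 0 <= v.1.2 <= 1 & 0 <= v.2 <= 1]].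

Definition C_d {R : realType} (k : norm_kind) : R :=
  sup [set r | exists x y, [/\ unit_cube x, unit_cube y &
        r = norm3 k (x.1.1 - y.1.1, x.1.2 - y.1.2, x.2 - y.2)]].

(* The metric induced on T(s) x [0,s] (wrapping in the first two coordinates
   only).  Points may be given by any lift to R^2 x R. *)
Definition tdist {R : realType} (k : norm_kind) (s : R) (x y : pt3 R) : R :=
  inf [set r | exists k1 k2 : int,
        r = norm3 k (x.1.1 - y.1.1 + k1%:~R * s, x.1.2 - y.1.2 + k2%:~R * s,
                     x.2 - y.2)].

(* A point of T(s) is identified with the point at height 0. *)
Definition lift0 {R : realType} (z : R * R) : pt3 R := (z, 0).

(* d(x, X) as an extended real (+oo for empty X). *)
Definition dist_set {R : realType} (k : norm_kind) (s : R) (z : R * R)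
  (X : set (pt3 R)) : \bar R :=
  ereal_inf [set (tdist k s (lift0 z) y)%:E | y in X].

Definition black {R : realType} (k : norm_kind) (s : R)
  (Xp Xm : set (pt3 R)) (z : R * R) : Prop :=
  (dist_set k s z Xp <= dist_set k s z Xm)%E.

Definition robustly_black {R : realType} (k : norm_kind) (s eta : R)
  (Xp Xm : set (pt3 R)) (z : R * R) : Prop :=
  (dist_set k s z Xp <= dist_set k s z Xm - eta%:E)%E.

(* A piecewise-linear path given by its vertex list v0 :: vs (lifted to the
   plane R^2, the universal cover of T(s)); its point set. *)
Definition pl_path {R : realType} (v0 : R * R) (vs : seq (R * R)) : set (R * R) :=
  [set z | z = v0 \/ exists i, (i < size vs)%N /\ exists l : R, 0 <= l <= 1 /\
     let a := nth v0 (v0 :: vs) i in let b := nth v0 (v0 :: vs) i.+1 in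
     z = ((1 - l) * a.1 + l * b.1, (1 - l) * a.2 + l * b.2)].

(* Fundamental domain of T(s) x [0,s]. *)
Definition window {R : realType} (s : R) : set (pt3 R) :=
  [set v | [/\ 0 <= v.1.1 < s, 0 <= v.1.2 < s & 0 <= v.2 <= s]].

Definition leb3 {R : realType} : set (pt3 R) -> \bar R :=
  ((@lebesgue_measure R \x @lebesgue_measure R) \x @lebesgue_measure R)%E.

(* Poisson pmf (with the convention 0^0 = 1, valid also for mean 0). *)
Definition pois (R : realType) (mu : R) (n : nat) : R :=
  mu ^+ n / n`!%:R * expR (- mu).

Definition count_eq {T : Type} {R : realType} (X : T -> set (pt3 R))
  (A : set (pt3 R)) (n : nat) : set T :=
  [set w | card_eq (X w `&` A) `I_n].

Definition poisson_process {d : measure_display} {T : measurableType d}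
  {R : realType} (P : probability T R) (s lam : R) (X : T -> set (pt3 R)) : Prop :=
  [/\ forall w, X w `<=` window s,
      forall (A : set (pt3 R)) n, measurable A -> measurable (count_eq X A n) &
      forall n (A : 'I_n -> set (pt3 R)) (m : 'I_n -> nat),
        (forall i, measurable (A i)) ->
        (forall i j, i != j -> A i `&` A j = set0) ->
        P (\bigcap_(i in [set: 'I_n]) count_eq X (A i) (m i)) =
        (\prod_(i < n) pois (lam * fine (leb3 (A i `&` window s))) (m i))%:E].

(* Independence of two point processes (of the sigma-algebras generated by
   their counting variables). *)
Definition indep_pp {d : measure_display} {T : measurableType d}
  {R : realType} (P : probability T R) (X Y : T -> set (pt3 R)) : Prop :=
  forall n1 (A : 'I_n1 -> set (pt3 R)) (m1 : 'I_n1 -> nat)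
         n2 (B : 'I_n2 -> set (pt3 R)) (m2 : 'I_n2 -> nat),
    (forall i, measurable (A i)) -> (forall j, measurable (B j)) ->
    let EA := \bigcap_(i in [set: 'I_n1]) count_eq X (A i) (m1 i) in
    let EB := \bigcap_(j in [set: 'I_n2]) count_eq Y (B j) (m2 j) in
    (P (EA `&` EB) = P EA * P EB)%E.

Unset Implicit Arguments.
Record coupling (R : realType) := Coupling {
  c_disp : measure_display;
  c_Omega : measurableType c_disp;
  c_P : probability c_Omega R;
  c_P1p : c_Omega -> set (pt3 R);
  c_P1m : c_Omega -> set (pt3 R);
  c_P2p : c_Omega -> set (pt3 R);
  c_P2m : c_Omega -> set (pt3 R) }.
Arguments c_disp {R}. Arguments c_Omega {R}. Arguments c_P {R}.
Arguments c_P1p {R}. Arguments c_P1m {R}. Arguments c_P2p {R}. Arguments c_P2m {R}.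
Set Implicit Arguments.

Definition valid_coupling (R : realType) (s p1 p2 : R) (C : coupling R) : Prop :=
  [/\ poisson_process (c_P C) s p1 (c_P1p C),
      poisson_process (c_P C) s (1 - p1) (c_P1m C),
      poisson_process (c_P C) s p2 (c_P2p C) &
      poisson_process (c_P C) s (1 - p2) (c_P2m C)] /\
  (indep_pp (c_P C) (c_P1p C) (c_P1m C) /\
   indep_pp (c_P C) (c_P2p C) (c_P2m C)).

Definition E_gl (R : realType) (k : norm_kind) (s delta : R) (C : coupling R)
  : set (c_Omega C) :=
  [set w | forall (u0 : R * R) (us : seq (R * R)),
     (forall z, pl_path u0 us z -> black k s (c_P1p C w) (c_P1m C w) z) ->
     exists (v0 : R * R) (vs : seq (R * R)),
       [/\ forall z, pl_path v0 vs z ->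
             robustly_black k s (2 * C_d k * delta) (c_P2p C w) (c_P2m C w) z,
           forall z, pl_path v0 vs z -> exists y, pl_path u0 us y /\
             tdist k s (lift0 z) (lift0 y) <= ln s &
           forall y, pl_path u0 us y -> exists z, pl_path v0 vs z /\
             tdist k s (lift0 y) (lift0 z) <= ln s]].
Arguments E_gl {R} k s delta C _.
Arguments valid_coupling {R} s p1 p2 C.

(* Main.v *)
Require Import Defs.
From HB Require Import structures.
From mathcomp Require Import all_boot all_order all_algebra.
From mathcomp Require Import finmap.
From mathcomp Require Import all_classical all_reals all_analysis.
From mathcomp Require Import measurable_realfun ring lra zify.
Import Order.TTheory GRing.Theory Num.Def Num.Theory.
Local Open Scope classical_set_scope.
Local Open Scope ring_scope.

Set Implicit Arguments.
Unset Strict Implicit.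
Unset Printing Implicit Defensive.

(** Black points of the first configuration are robustly black in the second
    one, so the path itself can be kept. The two configurations are coupled as
    follows. Rescaling the third coordinate by constants turns the intensities
    p1 and 1 - p1 into p2 / th^9 and (1 - p2) th^9: every positive point comes
    closer to the plane and every negative point moves away from it, and this
    gains more than 2 C_d delta as soon as the nearest positive or the nearest
    negative point has height at least tau. Only pairs of low points (height
    below tau) of opposite signs are left. The slab of low points is cut into
    boxes that are much wider than the typical distance to the nearest point
    and yet have small volume mu, so that a box is empty with probability close
    to one. The numbers of points are coupled along nine steps, one for each
    translation to a neighbouring box: in one step the pair (number of positive
    points of a box, number of negative points of its translate) passes from
    intensities (a, b) to (th a, b / th) in such a way that the first number
    never decreases, the second never increases, and the second vanishes
    afterwards whenever the first was nonzero before. This is possible because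
    one point has probability of order mu while two points have probability of
    order mu^2. In the end a low positive point of the first configuration and a
    low negative point of the second one are never in neighbouring boxes. *)

(** * Unordered sums over countable index types *)

(** The obstacle is a point of the plane that is black by a tiny margin. Lowering a point of height
    t shortens its Euclidean distance only by an amount of order t^2 divided by that distance, so
    heights are useless when both competing points lie almost in the plane; such contacts have to be
    excluded by the coupling itself. The exclusion relates positive points of the first
    configuration to negative points of the second only, since inside one configuration the two
    signs must stay independent. Each of the nine steps costs a factor th in both intensities, hence
    th^9 has to stay below p2 / p1 and (1 - p1) / (1 - p2). The scales follow: for boxes of side x,
    a small power of s, and of height x^-8, the volume is of order x^-6 and tends to 0, while the
    gain is of order x^-16 / x = x^-17, well above delta <= x^-24. Only the numbers of points per
    box need a clever coupling. Given them, points are placed uniformly and independently, and the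
    smaller family of each sign is part of the larger one; the sample space is thus a mixture of
    finite products over pairs of count configurations. *)

Lemma esumZl (R : realType) (T : choiceType) (D : set T) (c : R)
    (a : T -> \bar R) : 0 <= c -> (forall i, D i -> (0 <= a i)%E) ->
  (\esum_(i in D) (c%:E * a i) = c%:E * \esum_(i in D) a i)%E.
Proof.
have le_esumZ (e : R) (b : T -> \bar R) : 0 <= e ->
    (forall i, (0 <= b i)%E) ->
    (\esum_(i in setT) (e%:E * b i) <= e%:E * \esum_(i in setT) b i)%E.
  move=> e0 b0; apply: ge_ereal_sup => /= _ [X [finX XD] <-].
  rewrite -ge0_mule_fsumr//; apply: lee_wpmul2l; first by rewrite lee_fin.
  by apply: esum_ge; exists X.
rewrite le_eqVlt => /orP[/eqP <- _|c0 a0].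
  by rewrite mul0e esum1// => i _; rewrite mul0e.
rewrite esum_mkcond [in RHS]esum_mkcond.
set b := fun i => if i \in D then a i else 0%E.
have b0 i : (0 <= b i)%E by rewrite /b; case: ifPn => // /[!inE] /a0.
have -> : (fun i => if i \in D then c%:E * a i else 0)%E = (fun i => c%:E * b i)%E.
  by apply/funext => i; rewrite /b; case: ifP => // _; rewrite mule0.
(* The reverse inequality is [le_esumZ] again, for the factor [c^-1] and the family [c * b]. *)
apply/eqP; rewrite eq_le (le_esumZ _ _ (ltW c0) b0)/=.
rewrite muleC -lee_pdivlMr//.
have cb0 i : (0 <= c%:E * b i)%E by rewrite mule_ge0// lee_fin ltW.
rewrite muleC.
apply: le_trans (le_esumZ _ _ _ cb0); last by rewrite invr_ge0 ltW.
apply: le_esum => i _.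
by rewrite muleA -EFinM mulVf ?gt_eqF// mul1e.
Qed.

Lemma esum_pair (R : realType) (T1 T2 : choiceType) (a : T1 * T2 -> \bar R) :
  (forall k, (0 <= a k)%E) ->
  \esum_(k in setT) a k = \esum_(i in setT) \esum_(j in setT) a (i, j).
Proof.
move=> a0; rewrite (@esum_esum _ _ _ setT (fun=> setT) (fun i j => a (i, j)))//.
rewrite (_ : setT `*`` _ = setT); last by apply/seteqP; split.
by apply: eq_esum => -[].
Qed.

Lemma esum_exchange (R : realType) (T1 T2 : choiceType)
    (a : T1 -> T2 -> \bar R) : (forall i j, (0 <= a i j)%E) ->
  \esum_(i in setT) \esum_(j in setT) a i j =
  \esum_(j in setT) \esum_(i in setT) a i j.
Proof.
move=> a0; rewrite -(@esum_pair _ _ _ (fun k => a k.1 k.2))//.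
rewrite -(@esum_pair _ _ _ (fun k => a k.2 k.1))//.
rewrite (reindex_esum setT setT (fun k : T2 * T1 => (k.2, k.1)))//; split => //.
  by move=> [i1 i2] [j1 j2] /= _ _ [-> ->].
by move=> [i j] _ /=; exists (j, i).
Qed.

Lemma esum_single (R : realType) (T : choiceType) (i0 : T) (a : T -> \bar R) :
  (0 <= a i0)%E -> (forall i, i != i0 -> a i = 0%E) ->
  \esum_(i in setT) a i = a i0.
Proof.
move=> a0 ai; rewrite -[RHS](@esum_set1 _ _ i0 a)//.
rewrite [RHS]esum_mkcond; apply: eq_esum => i _.
case: ifPn => //; rewrite notin_setE/= => /eqP; exact: ai.
Qed.

Definition ffun_upd (I : finType) (T : Type) (k : {ffun I -> T}) (i : I) (t : T)
  : {ffun I -> T} := [ffun j => if j == i then t else k j].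

(** Makes induction over the coordinates possible: [{ffun I -> T}] is reached at [enum I], and a
    function supported on [i :: s] is a value at [i] together with a function supported on [s]. *)
Definition supported (I : finType) (T : Type) (t0 : T) (s : seq I)
  : set {ffun I -> T} := [set k | forall j, j \notin s -> k j = t0].

Lemma esum_supported_cons (R : realType) (I : finType) (T : choiceType)
    (t0 : T) (i : I) (s : seq I) (G : {ffun I -> T} -> \bar R) :
  i \notin s -> (forall k, (0 <= G k)%E) ->
  \esum_(k in supported t0 (i :: s)) G k =
  \esum_(t in setT) \esum_(k in supported t0 s) G (ffun_upd k i t).
Proof.
move=> iNs G0.
rewrite (@esum_esum _ _ _ setT (fun=> supported t0 s)
  (fun t k => G (ffun_upd k i t)))//.
rewrite (reindex_esum (setT `*`` fun=> supported t0 s) _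
  (fun k => ffun_upd k.2 i k.1))//; split.
- move=> [t k] /= [_ ks] j; rewrite inE negb_or => /andP[ji js].
  by rewrite ffunE (negbTE ji); exact: ks.
- move=> [t k] [t' k']; rewrite !inE/= => -[_ ks] [_ ks'] /ffunP e.
  have -> : t = t' by have := e i; rewrite !ffunE eqxx.
  congr pair; apply/ffunP => j; have := e j; rewrite !ffunE.
  by case: eqP => // ->; rewrite ks// ks'.
- move=> k /= ks; exists (k i, ffun_upd k i t0) => /=.
    split => // j js; rewrite ffunE; case: eqP => // /eqP ji.
    by apply: ks; rewrite inE negb_or ji.
  by apply/ffunP => j; rewrite !ffunE; case: eqP => [->|].
Qed.

Lemma supported_enum (I : finType) (T : Type) (t0 : T) :
  supported t0 (enum I) = setT.
Proof. by apply/seteqP; split => // k _ j; rewrite mem_enum. Qed.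

Lemma supported_nil (I : finType) (T : Type) (t0 : T) :
  @supported I T t0 [::] = [set [ffun=> t0]].
Proof.
apply/seteqP; split => k /=; last by move=> -> j _; rewrite ffunE.
by move=> k0; apply/ffunP => j; rewrite ffunE k0.
Qed.

Lemma esum_ffun_prod (R : realType) (I : finType) (T : pointedType)
    (a : I -> T -> R) (A : I -> R) : (forall i t, 0 <= a i t) ->
  (forall i, \esum_(t in setT) (a i t)%:E = (A i)%:E) ->
  \esum_(f in [set: {ffun I -> T}]) (\prod_i a i (f i))%:E = (\prod_i A i)%:E.
Proof.
move=> a0 aA.
have A0 i : 0 <= A i by rewrite -lee_fin -aA; apply: esum_ge0 => t _; rewrite lee_fin.
suff H s : uniq s -> \esum_(f in supported point s) (\prod_(i <- s) a i (f i))%:E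
    = (\prod_(i <- s) A i)%:E.
  have := H (enum I) (enum_uniq _); rewrite supported_enum.
  by rewrite -big_enum/= => <-; apply: eq_esum => f _; rewrite -big_enum.
have P0 (r : seq I) (f : {ffun I -> T}) : 0 <= \prod_(i <- r) a i (f i).
  by apply: prodr_ge0.
elim: s => [_|i s IH /= /andP[iNs us]].
  by rewrite supported_nil esum_set1 !big_nil// lee_fin.
rewrite esum_supported_cons//; last by move=> k; rewrite lee_fin.
transitivity (\esum_(t in setT) ((\prod_(i <- s) A i)%:E * (a i t)%:E)%E).
  apply: eq_esum => t _; rewrite -IH// muleC -esumZl//; last first.
    by move=> f _; rewrite lee_fin.
  apply: eq_esum => k _; rewrite big_cons ffunE eqxx -EFinM.
  congr (_ * _)%:E; apply: eq_big_seq => j js.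
  by rewrite ffunE; case: eqP => // ji; rewrite -ji js in iNs.
have PA0 : 0 <= \prod_(i <- s) A i by apply: prodr_ge0.
rewrite esumZl//; last by move=> t _; rewrite lee_fin.
by rewrite aA -EFinM big_cons mulrC.
Qed.

(** * Couplings of mass functions *)

(** Couplings of discrete laws given by their mass functions, so that existence can be shown by
    writing down [g]; the relation holds wherever [g] has mass. *)
Definition coupled (R : realType) (T1 T2 : choiceType) (p : T1 -> R)
    (q : T2 -> R) (Rel : T1 -> T2 -> Prop) : Prop :=
  exists g : T1 -> T2 -> R, [/\ forall x y, 0 <= g x y,
    forall x, \esum_(y in setT) (g x y)%:E = (p x)%:E,
    forall y, \esum_(x in setT) (g x y)%:E = (q y)%:E &
    forall x y, g x y != 0 -> Rel x y].

Lemma coupled_sub (R : realType) (T1 T2 : choiceType) (p : T1 -> R)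
    (q : T2 -> R) (Rel Rel' : T1 -> T2 -> Prop) :
  (forall x y, Rel x y -> Rel' x y) -> coupled p q Rel -> coupled p q Rel'.
Proof. by move=> h [g [g0 gp gq gR]]; exists g; split => // x y /gR /h. Qed.

Lemma coupled_refl (R : realType) (T : choiceType) (p : T -> R) :
  (forall x, 0 <= p x) -> coupled p p eq.
Proof.
move=> p0; exists (fun x y => if x == y then p x else 0); split.
- by move=> x y; case: ifP.
- move=> x; rewrite (@esum_single _ _ x) ?eqxx ?lee_fin// => y /negbTE yx.
  by rewrite eq_sym yx.
- move=> x; rewrite (@esum_single _ _ x) ?eqxx ?lee_fin// => y /negbTE yx.
  by rewrite yx.
- by move=> x y; have [//|_ /eqP] := eqVneq x y.
Qed.

Lemma esum_EFin_ge0 (R : realType) (T : choiceType) (D : set T) (a : T -> R) :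
  (forall x, 0 <= a x) -> (0 <= \esum_(x in D) (a x)%:E)%E.
Proof. by move=> a0; apply: esum_ge0 => x _; rewrite lee_fin. Qed.

Lemma le_term_esum (R : realType) (T : choiceType) (a : T -> \bar R) (x : T) :
  (forall x, 0 <= a x)%E -> (a x <= \esum_(x in setT) a x)%E.
Proof.
move=> a0; apply: esum_ge; exists [set x]; last by rewrite fsbig_set1.
by split => //.
Qed.

(** Gluing: given the middle value [y], the outer two are taken independent, with mass
    [g x y * h y z / q y]. Where [q y = 0] the quotient is 0 by convention, which is right because
    [g] and [h] vanish there. Summing over [y] gives the composite. *)
Lemma coupled_trans (R : realType) (T1 T2 T3 : choiceType) (p : T1 -> R)
    (q : T2 -> R) (r : T3 -> R) R12 R23 :
  coupled p q R12 -> coupled q r R23 ->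
  coupled p r (fun x z => exists2 y, R12 x y & R23 y z).
Proof.
move=> [g [g0 gp gq gR]] [h [h0 hq hr hR]].
have q0 y : 0 <= q y by rewrite -lee_fin -hq; exact: esum_EFin_ge0.
pose f x y z := g x y * h y z / q y.
have f0 x y z : 0 <= f x y z by rewrite /f !mulr_ge0 ?invr_ge0.
have gz x y : q y = 0 -> g x y = 0.
  move=> qy; apply/eqP; rewrite eq_le g0 andbT -lee_fin -qy -gq.
  by apply: (@le_term_esum _ _ (fun x => (g x y)%:E)) => ?; rewrite lee_fin.
have hz y z : q y = 0 -> h y z = 0.
  move=> qy; apply/eqP; rewrite eq_le h0 andbT -lee_fin -qy -hq.
  by apply: (@le_term_esum _ _ (fun z => (h y z)%:E)) => ?; rewrite lee_fin.
have fg x y : \esum_(z in setT) (f x y z)%:E = (g x y)%:E.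
  transitivity (\esum_(z in setT) ((g x y / q y)%:E * (h y z)%:E))%E.
    by apply: eq_esum => z _; rewrite -EFinM /f mulrAC.
  rewrite esumZl ?divr_ge0//; last by move=> ? _; rewrite lee_fin.
  rewrite hq -EFinM; have [/gz ->|qy] := eqVneq (q y) 0; first by rewrite !mul0r.
  by rewrite divfK.
have fh y z : \esum_(x in setT) (f x y z)%:E = (h y z)%:E.
  transitivity (\esum_(x in setT) ((h y z / q y)%:E * (g x y)%:E))%E.
    by apply: eq_esum => x _; rewrite -EFinM /f; congr (_%:E); ring.
  rewrite esumZl ?divr_ge0//; last by move=> ? _; rewrite lee_fin.
  rewrite gq -EFinM; have [/hz ->|qy] := eqVneq (q y) 0; first by rewrite !mul0r.
  by rewrite divfK.
pose F x z := \esum_(y in setT) (f x y z)%:E.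
have F0 x z : (0 <= F x z)%E by exact: esum_EFin_ge0.
have Fp x : \esum_(z in setT) F x z = (p x)%:E.
  rewrite esum_exchange => [|i j]; last by rewrite lee_fin.
  by under eq_esum => y _ do rewrite fg.
have Fr z : \esum_(x in setT) F x z = (r z)%:E.
  rewrite esum_exchange => [|i j]; last by rewrite lee_fin.
  by under eq_esum => y _ do rewrite fh.
have Ffin x z : F x z \is a fin_num.
  rewrite ge0_fin_numE//; apply: le_lt_trans (ltry (p x)); rewrite -Fp.
  exact: (@le_term_esum _ _ (F x)).
exists (fun x z => fine (F x z)); split.
- by move=> x z; rewrite fine_ge0.
- by move=> x; under eq_esum => z _ do rewrite fineK//.
- by move=> z; under eq_esum => x _ do rewrite fineK//.
- move=> x z Fxz; apply: contrapT => nR; move/eqP: Fxz; apply.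
  rewrite /F esum1// => y _; rewrite /f.
  have [->|gxy] := eqVneq (g x y) 0; first by rewrite !mul0r.
  have [->|hyz] := eqVneq (h y z) 0; first by rewrite mulr0 mul0r.
  by case: nR; exists y; [exact: gR|exact: hR].
Qed.

Lemma coupled_prod (R : realType) (I : finType) (T1 T2 : pointedType)
    (p : I -> T1 -> R) (q : I -> T2 -> R) (Rel : I -> T1 -> T2 -> Prop) :
  (forall i, coupled (p i) (q i) (Rel i)) ->
  coupled (fun x : {ffun I -> T1} => \prod_i p i (x i))
          (fun y : {ffun I -> T2} => \prod_i q i (y i))
          (fun x y => forall i, Rel i (x i) (y i)).
Proof.
move=> /choice[g gP].
exists (fun (x : {ffun I -> T1}) (y : {ffun I -> T2}) =>
  \prod_i g i (x i) (y i)); split.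
- by move=> x y; apply: prodr_ge0 => i _; case: (gP i).
- move=> x; rewrite (@esum_ffun_prod _ _ _ (fun i => g i (x i)) (fun i => p i (x i)))//.
    by move=> i t; case: (gP i).
  by move=> i; case: (gP i).
- move=> y; rewrite (@esum_ffun_prod _ _ _ (fun i t => g i t (y i)) (fun i => q i (y i)))//.
    by move=> i t; case: (gP i).
  by move=> i; case: (gP i).
- move=> x y /prodf_neq0 h i; case: (gP i) => _ _ _; apply; exact: h.
Qed.

Lemma coupled_reindex (R : realType) (T1 T2 T1' T2' : choiceType)
    (p : T1 -> R) (q : T2 -> R) (Rel : T1 -> T2 -> Prop)
    (e1 : T1' -> T1) (e2 : T2' -> T2) :
  bijective e1 -> bijective e2 -> coupled p q Rel ->
  coupled (p \o e1) (q \o e2) (fun x y => Rel (e1 x) (e2 y)).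
Proof.
have bij (T T' : choiceType) (e : T -> T') : bijective e -> set_bij setT setT e.
  move=> be; split => //; first by move=> x y _ _; exact: (bij_inj be).
  by case: be => h eh he y _; exists (h y).
move=> /bij b1 /bij b2 [g [g0 gp gq gR]].
exists (fun x y => g (e1 x) (e2 y)); split => //.
- by move=> x /=; rewrite -gp [RHS](reindex_esum _ _ _ _ b2).
- by move=> y /=; rewrite -gq [RHS](reindex_esum _ _ _ _ b1).
- by move=> x y /gR.
Qed.

(** * Poisson counts *)

Lemma pois_ge0 (R : realType) (a : R) n : 0 <= a -> 0 <= pois a n.
Proof. by move=> a0; rewrite /pois !mulr_ge0 ?exprn_ge0 ?expR_ge0 ?invr_ge0. Qed.

Lemma pois0n (R : realType) n : pois (0 : R) n = (n == 0%N)%:R.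
Proof.
by rewrite /pois oppr0 expR0 mulr1; case: n => [|n]; rewrite ?expr0 ?fact0 ?divr1// expr0n mul0r.
Qed.

Lemma esum_pois (R : realType) (a : R) : 0 <= a ->
  \esum_(n in setT) (pois a n)%:E = 1%E.
Proof.
rewrite le_eqVlt => /orP[/eqP <-|a0].
  rewrite (@esum_single _ _ 0%N) ?pois0n//.
  by move=> i /negbTE i0; rewrite pois0n i0.
transitivity (poisson_prob a 0 [set: nat]); last exact: probability_setT.
by rewrite /poisson_prob a0; apply: eq_esum => n _; rewrite /poisson_pmf a0.
Qed.

Lemma poisD (R : realType) (a b : R) n :
  pois (a + b) n = \sum_(i < n.+1) pois a i * pois b (n - i).
Proof.
rewrite /pois opprD expRD exprDn mulrA !mulr_suml.
rewrite (reindex_inj rev_ord_inj)/=; apply: eq_bigr => i _.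
rewrite subSS; have /[dup] ik : (i <= n)%N by rewrite -ltnS.
move=> /bin_fact /(congr1 (fun n => n%:R : R)) => ikR.
rewrite subKn// bin_sub// -mulr_natr -{}ikR !natrM.
have H m : m`!%:R != 0 :> R by rewrite pnatr_eq0 -lt0n fact_gt0.
have := H i; have := H (n - i)%N.
have : ('C(n, i))%:R != 0 :> R by rewrite pnatr_eq0 -lt0n bin_gt0.
by move=> ? ? ?; field; apply/and3P; split.
Qed.

Lemma esum_pois_le (R : realType) (a b : R) n : 0 <= a -> 0 <= b ->
  \esum_(i in setT) (if (i <= n)%N then pois a i * pois b (n - i) else 0)%:E =
  (pois (a + b) n)%:E.
Proof.
move=> a0 b0.
have t0 i : 0 <= pois a i * pois b (n - i) by rewrite mulr_ge0 ?pois_ge0.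
rewrite -nneseries_esumT => [|i]; last by rewrite lee_fin; case: ifP.
rewrite (nneseries_split 0 n.+1)//; last by move=> i _; rewrite lee_fin; case: ifP.
rewrite add0n eseries0 ?adde0; last first.
  by move=> i /= ni _; rewrite leqNgt ni.
rewrite poisD -sumEFin big_mkord; apply: eq_bigr => i _.
by rewrite -ltnS ltn_ord.
Qed.

(* A Poisson([a]) variable can be kept when it is positive, at the expense of
   annihilating a second variable, because [pois a' n * pois b' 0] dominates
   [pois a n] for [n > 0] as soon as [a' / a] exceeds [expR (a' + b')]. *)
Lemma pois_dom (R : realType) (a a' b' : R) n :
  0 < a -> 0 <= b' -> a * expR (a' + b') <= a' -> (0 < n)%N ->
  pois a n <= pois a' n * pois b' 0.
Proof.
move=> a0 b0 h n0.
have a'0 : 0 < a' by apply: lt_le_trans h; rewrite mulr_gt0 ?expR_gt0.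
rewrite /pois expr0 fact0 divr1 mul1r.
have -> : a' ^+ n / n`!%:R * expR (- a') * expR (- b') =
    (a' ^+ n / expR (a' + b')) / n`!%:R.
  by rewrite !expRN expRD invfM; ring.
rewrite mulrAC ler_wpM2r ?invr_ge0//.
rewrite ler_pdivlMr ?expR_gt0//.
have e1 : 1 <= expR (a' + b') by rewrite -expR0 ler_expR addr_ge0// ltW.
apply: (@le_trans _ _ (a ^+ n * expR (a' + b'))).
  rewrite ler_wpM2r ?expR_ge0// ger_pMr ?exprn_gt0//.
  by rewrite -expR0 ler_expR oppr_le0 ltW.
apply: (@le_trans _ _ ((a * expR (a' + b')) ^+ n)).
  rewrite exprMn ler_wpM2l ?exprn_ge0 ?(ltW a0)//.
  by apply: ler_eXnr.
by rewrite lerXn2r// nnegrE ltW// mulr_gt0// expR_gt0.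
Qed.

(** * Coupling two pairs of Poisson counts with mutual exclusion *)

Definition excl (x y : nat * nat) : Prop :=
  [/\ (x.1 <= y.1)%N, (y.2 <= x.2)%N & ((0 < x.1)%N -> y.2 = 0%N)].

(** The coupling is explicit. Every [x] with [x.1 > 0] goes to [(x.1, 0)], every [y] with [y.2 > 0]
    comes from [(0, y.2)], and the mass left on the pairs [(0, x.2)] and [(y.1, 0)] is coupled
    independently. The first two growth hypotheses, via [pois_dom], make the leftovers nonnegative;
    the last one says the same of their common total. *)
Lemma coupled_pois_excl (R : realType) (a b a' b' : R) :
  0 < a -> 0 < b' -> a * expR (a' + b') <= a' -> b' * expR (a + b) <= b ->
  1 <= expR (- a) + expR (- b') ->
  coupled (fun x : nat * nat => pois a x.1 * pois b x.2)
          (fun y : nat * nat => pois a' y.1 * pois b' y.2) excl.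
Proof.
move=> a0 b'0 ha hb hm.
have a'0 : 0 < a' by apply: lt_le_trans ha; rewrite mulr_gt0 ?expR_gt0.
have b0 : 0 < b by apply: lt_le_trans hb; rewrite mulr_gt0 ?expR_gt0.
have A n := @pois_ge0 R a n (ltW a0).
have A' n := @pois_ge0 R a' n (ltW a'0).
have B n := @pois_ge0 R b n (ltW b0).
have B' n := @pois_ge0 R b' n (ltW b'0).
(* [u] is what remains of the mass of [(0, y)] on the source side, [v] what remains of [(x, 0)] on
   the target side; both have total [m]. *)
pose u y := pois a 0 * pois b y - (if (0 < y)%N then pois b' y else 0).
pose v x := pois a' x * pois b' 0 - (if (0 < x)%N then pois a x else 0).
pose m := pois a 0 + pois b' 0 - 1.
have m0 : 0 <= m by rewrite /m /pois !expr0 fact0 !divr1 !mul1r subr_ge0.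
have u0 y : 0 <= u y.
  rewrite /u; case: ifPn => [y0|_]; last by rewrite subr0 mulr_ge0.
  by rewrite subr_ge0 mulrC; apply: pois_dom => //; [exact: ltW|rewrite addrC].
have v0 x : 0 <= v x.
  rewrite /v; case: ifPn => [x0|_]; last by rewrite subr0 mulr_ge0.
  by rewrite subr_ge0; apply: pois_dom => //; exact: ltW.
have esum_pos (c : R) : 0 <= c ->
    \esum_(n in setT) (if (0 < n)%N then pois c n else 0)%:E = (1 - pois c 0)%:E.
  move=> c0; have C n := @pois_ge0 R c n c0.
  have : \esum_(n in setT) (pois c n)%:E =
      (\esum_(n in setT) (if (0 < n)%N then pois c n else 0)%:E +
       \esum_(n in setT) (if n == 0%N then pois c n else 0)%:E)%E.
    rewrite -esumD; first last.
    - by move=> i _; rewrite lee_fin; case: ifP.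
    - by move=> i _; rewrite lee_fin; case: ifP.
    apply: eq_esum => -[|n] _ /=; rewrite -EFinD; first by rewrite add0r.
    by rewrite addr0.
  rewrite [X in (_ + X)%E](@esum_single _ _ 0%N) ?eqxx ?lee_fin//; last first.
    by move=> i /negbTE ->.
  by rewrite esum_pois// EFinB => ->; rewrite addeK.
have esum_sub (f h : nat -> R) (F H : R) : (forall n, 0 <= h n) ->
    (forall n, 0 <= f n - h n) ->
    \esum_(n in setT) (f n)%:E = F%:E -> \esum_(n in setT) (h n)%:E = H%:E ->
    \esum_(n in setT) (f n - h n)%:E = (F - H)%:E.
  move=> h0 fh0 fF hH; rewrite EFinB -fF -hH.
  have -> : \esum_(n in setT) (f n)%:E =
     (\esum_(n in setT) (f n - h n)%:E + \esum_(n in setT) (h n)%:E)%E.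
    rewrite -esumD => [|n _|n _]; rewrite ?lee_fin//.
    by apply: eq_esum => n _; rewrite -EFinD subrK.
  by rewrite hH addeK.
have su : \esum_(n in setT) (u n)%:E = m%:E.
  have -> : m = pois a 0 - (1 - pois b' 0) by rewrite /m; ring.
  apply: esum_sub => //; last by rewrite esum_pos// ltW.
  - by move=> n; case: ifP.
  - under eq_esum => n _ do rewrite EFinM.
    by rewrite esumZl ?esum_pois ?mule1 ?(ltW b0)// => i _; rewrite lee_fin.
have sv : \esum_(n in setT) (v n)%:E = m%:E.
  have -> : m = pois b' 0 - (1 - pois a 0) by rewrite /m; ring.
  apply: esum_sub => //; last by rewrite esum_pos// ltW.
  - by move=> n; case: ifP.
  - under eq_esum => n _ do rewrite mulrC EFinM.
    by rewrite esumZl ?esum_pois ?mule1 ?(ltW a'0)// => i _; rewrite lee_fin.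
have AB x y : 0 <= pois a x * pois b y by exact: mulr_ge0.
have A'B' x y : 0 <= pois a' x * pois b' y by exact: mulr_ge0.
have um y : m = 0 -> u y = 0.
  move=> mz; apply/eqP; rewrite eq_le u0 andbT -lee_fin -mz -su.
  by apply: (@le_term_esum _ _ (fun x => (u x)%:E)) => ?; rewrite lee_fin.
have vm x : m = 0 -> v x = 0.
  move=> mz; apply/eqP; rewrite eq_le v0 andbT -lee_fin -mz -sv.
  by apply: (@le_term_esum _ _ (fun x => (v x)%:E)) => ?; rewrite lee_fin.
have uv0 x y : 0 <= u x * v y / m by rewrite !mulr_ge0 ?invr_ge0.
(* If [m = 0] then [u] and [v] vanish identically, so the division by [m] does no damage. *)
pose g (x y : nat * nat) :=
  if (0 < x.1)%N then (if y == (x.1, 0%N) then pois a x.1 * pois b x.2 else 0)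
  else if (0 < y.2)%N then (if x == (0%N, y.2) then pois a' y.1 * pois b' y.2 else 0)
  else u x.2 * v y.1 / m.
have g0 x y : 0 <= g x y.
  rewrite /g; case: ifP => _; case: ifP => _; try case: ifP => _;
    rewrite ?uv0 ?AB ?A'B' //.
exists g; split => //.
- move=> [[|x1] x2]; last first.
    rewrite (@esum_single _ _ (x1.+1, 0%N)) /g/= ?eqxx ?lee_fin ?AB ?A'B'//.
    by move=> y /negbTE ->.
  rewrite esum_pair => [|y]; last by rewrite lee_fin.
  transitivity (\esum_(i in setT) ((u x2 * v i / m)%:E +
      (if (0 < x2)%N then pois a' i * pois b' x2 else 0)%:E))%E.
    apply: eq_esum => i _; rewrite /g/=.
    transitivity (\esum_(j in setT) ((if j == 0%N then u x2 * v i / m else 0)%:E +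
      (if (0 < x2)%N && (j == x2) then pois a' i * pois b' j else 0)%:E)%E).
      apply: eq_esum => -[|j] _ /=; rewrite -EFinD.
        by case: x2 => [|x2]; rewrite addr0.
      rewrite add0r xpair_eqE/= (eq_sym j.+1).
      by case: x2 => [|x2] //=; rewrite andbT.
    rewrite esumD; first last.
    - by move=> j _; rewrite lee_fin; case: ifP; rewrite ?AB ?A'B'.
    - by move=> j _; rewrite lee_fin; case: ifP.
    congr (_ + _)%E.
      rewrite (@esum_single _ _ 0%N) ?eqxx ?lee_fin ?uv0//.
      by move=> j /negbTE ->.
    rewrite (@esum_single _ _ x2) ?eqxx ?andbT//.
      by rewrite lee_fin; case: ifP; rewrite ?AB ?A'B'.
    by move=> j /negbTE ->; rewrite andbF.
  rewrite esumD; first last.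
  - by move=> j _; rewrite lee_fin; case: ifP; rewrite ?AB ?A'B'.
  - by move=> j _; rewrite lee_fin.
  have -> : \esum_(i in setT) (u x2 * v i / m)%:E = (u x2)%:E.
    under eq_esum => n _ do rewrite mulrAC EFinM.
    rewrite esumZl ?sv; [|by rewrite mulr_ge0 ?invr_ge0|by move=> i _; rewrite lee_fin].
    rewrite -EFinM; have [/um ->|] := eqVneq m 0; first by rewrite !mul0r.
    by move=> mn; rewrite divfK.
  have -> : \esum_(i in setT) (if (0 < x2)%N then pois a' i * pois b' x2 else 0)%:E
      = (if (0 < x2)%N then pois b' x2 else 0)%:E.
    case: ifP => _; last by rewrite esum1.
    under eq_esum => n _ do rewrite mulrC EFinM.
    by rewrite esumZl ?esum_pois ?mule1 ?(ltW a'0)// => i _; rewrite lee_fin.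
  by rewrite -EFinD /u subrK.
- move=> [y1 [|y2]]; last first.
    rewrite (@esum_single _ _ (0%N, y2.+1)) /g/= ?eqxx ?lee_fin ?AB ?A'B'//.
    move=> [[|x1] x2] /=; first by move=> /negbTE ->.
    by rewrite xpair_eqE/= andbF.
  rewrite esum_pair => [|y]; last by rewrite lee_fin.
  rewrite esum_exchange => [|i j]; last by rewrite lee_fin.
  transitivity (\esum_(i in setT) ((u i * v y1 / m)%:E +
      (if (0 < y1)%N then pois a y1 * pois b i else 0)%:E))%E.
    apply: eq_esum => i _; rewrite /g/=.
    transitivity (\esum_(j in setT) ((if j == 0%N then u i * v y1 / m else 0)%:E +
      (if (0 < y1)%N && (j == y1) then pois a j * pois b i else 0)%:E)%E).
      apply: eq_esum => -[|j] _ /=; rewrite -EFinD.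
        by case: (y1) => [|y]; rewrite addr0.
      rewrite add0r xpair_eqE/= (eq_sym j.+1) andbT.
      by case: (y1) => [|y].
    rewrite esumD; first last.
    - by move=> j _; rewrite lee_fin; case: ifP; rewrite ?AB ?A'B'.
    - by move=> j _; rewrite lee_fin; case: ifP.
    congr (_ + _)%E.
      rewrite (@esum_single _ _ 0%N) ?eqxx ?lee_fin ?uv0//.
      by move=> j /negbTE ->.
    rewrite (@esum_single _ _ y1) ?eqxx ?andbT//.
      by rewrite lee_fin; case: ifP; rewrite ?AB ?A'B'.
    by move=> j /negbTE ->; rewrite andbF.
  rewrite esumD; first last.
  - by move=> j _; rewrite lee_fin; case: ifP; rewrite ?AB ?A'B'.
  - by move=> j _; rewrite lee_fin.
  have -> : \esum_(i in setT) (u i * v y1 / m)%:E = (v y1)%:E.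
    under eq_esum => n _ do rewrite -mulrA mulrC EFinM.
    rewrite esumZl ?su; [|by rewrite mulr_ge0 ?invr_ge0|by move=> i _; rewrite lee_fin].
    rewrite -EFinM; have [/vm ->|] := eqVneq m 0; first by rewrite !mul0r.
    by move=> mn; rewrite divfK.
  have -> : \esum_(i in setT) (if (0 < y1)%N then pois a y1 * pois b i else 0)%:E
      = (if (0 < y1)%N then pois a y1 else 0)%:E.
    case: ifP => _; last by rewrite esum1.
    under eq_esum => n _ do rewrite EFinM.
    by rewrite esumZl ?esum_pois ?mule1 ?(ltW b0)// => i _; rewrite lee_fin.
  by rewrite -EFinD /v subrK.
- move=> [[|x1] x2] [y1 y2]; rewrite /g/= /excl/=; last first.
    by case: ifP => [/eqP[-> ->] _|_ /eqP//]; split.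
  case: y2 => [|y2]; first by split.
  by case: ifP => [/eqP[->] _|_ /eqP//]; split.
Qed.

(** * Count configurations on a finite set of boxes *)

Definition conf (J : finType) := {ffun J -> nat * nat}.

Definition pois_conf (R : realType) (J : finType) (a b : R) (x : conf J) : R :=
  \prod_j (pois a (x j).1 * pois b (x j).2).

Lemma pois_conf_ge0 (R : realType) (J : finType) (a b : R) (x : conf J) :
  0 <= a -> 0 <= b -> 0 <= pois_conf a b x.
Proof. by move=> a0 b0; apply: prodr_ge0 => j _; rewrite mulr_ge0 ?pois_ge0. Qed.

(** Pairs the positive count of box [j] with the negative count of box [f j]. The law of independent
    counts is invariant under this, so a boxwise coupling becomes one between a box and its
    translate. *)
Definition conf_perm (J : finType) (f : J -> J) (x : conf J) : conf J :=
  [ffun j => ((x j).1, (x (f j)).2)].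

Lemma conf_perm_bij (J : finType) (f : J -> J) :
  bijective f -> bijective (@conf_perm J f).
Proof.
move=> [h fh hf]; exists (conf_perm h) => x; apply/ffunP => j; rewrite !ffunE/=.
  by rewrite hf; case: (x j).
by rewrite fh; case: (x j).
Qed.

Lemma pois_conf_perm (R : realType) (J : finType) (a b : R) (f : J -> J) x :
  bijective f -> pois_conf a b (conf_perm f x) = pois_conf a b x.
Proof.
move=> bf; rewrite /pois_conf [LHS]big_split [RHS]big_split/=; congr (_ * _).
  by apply: eq_bigr => j _; rewrite ffunE.
rewrite [RHS](reindex f)/=; last exact: onW_bij.
by apply: eq_bigr => j _; rewrite ffunE.
Qed.

Definition conf_excl (J : finType) (s : seq (J -> J)) (x y : conf J) : Prop :=
  [/\ forall j, ((x j).1 <= (y j).1)%N, forall j, ((y j).2 <= (x j).2)%N &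
      forall i j, (i < size s)%N -> (0 < (x j).1)%N -> (y (nth id s i j)).2 = 0%N].

(** One translation per induction step, composed with [coupled_trans]. Exclusions survive the
    composition: a positive count that was nonzero stays nonzero, so it triggers all later steps,
    and a negative count that has become zero stays zero. *)
Lemma coupled_conf_excl (R : realType) (J : finType) (s : seq (J -> J))
    (th mu a b : R) : (forall i, (i < size s)%N -> bijective (nth id s i)) ->
  1 < th -> 0 < a -> 0 < b -> a * th ^+ size s <= mu -> b * th ^+ size s <= mu ->
  mu <= ln th / 2 -> mu <= 1 / 2 ->
  coupled (pois_conf a (b * th ^+ size s)) (pois_conf (a * th ^+ size s) b)
    (@conf_excl J s).
Proof.
move=> bs th1; have th0 : 0 < th by apply: lt_trans th1.
elim: s a bs => [a _|f s IH a bs] a0 b0 ha hb hmu1 hmu2.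
  rewrite expr0 !mulr1; apply: coupled_sub (coupled_refl _).
    by move=> x _ <-; split.
  by move=> x; apply: pois_conf_ge0; exact: ltW.
set n := size s in IH *; rewrite /= -/n in bs ha hb *.
have bf : bijective f by have := bs 0%N; apply.
have thn : 1 <= th ^+ n by rewrite exprn_ege1// ltW.
have thn0 : 0 < th ^+ n by rewrite exprn_gt0.
have haS : a * th * th ^+ n <= mu by rewrite -mulrA -exprS.
have hbS : b * th ^+ n * th <= mu by rewrite -mulrA -exprSr.
have h1 : a * th <= mu.
  by apply: le_trans haS; rewrite ler_peMr// mulr_ge0// ltW.
have h2 : a <= mu by apply: le_trans h1; rewrite ler_peMr ?ltW.
have h3 : b * th ^+ n <= mu.
  by apply: le_trans hbS; rewrite ler_peMr ?mulr_ge0// ltW.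
(* All means stay below [mu], so a sum of two is at most [ln th]; the factor [th] gained in one step
   therefore pays for the exponential in [coupled_pois_excl]. *)
have hexp c : c <= mu + mu -> expR c <= th.
  move=> cm; rewrite -[leRHS]lnK ?posrE// ler_expR; apply: le_trans cm _.
  by lra.
have hexpN c : c <= mu -> 1 / 2 <= expR (- c).
  by move=> cm; apply: le_trans (expR_ge1Dx _); lra.
have step : coupled (@pois_conf R J a (b * th ^+ n.+1))
    (pois_conf (a * th) (b * th ^+ n))
    (fun x y => forall j, excl (conf_perm f x j) (conf_perm f y j)).
  have := @coupled_pois_excl R a (b * th ^+ n.+1) (a * th) (b * th ^+ n) a0.
  move=> /(_ (mulr_gt0 b0 thn0)) [].
  - by rewrite ler_wpM2l ?(ltW a0)//; apply: hexp; apply: lerD.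
  - rewrite exprSr mulrA ler_wpM2l ?mulr_ge0 ?(ltW b0) ?(ltW thn0)//; apply: hexp.
    by apply: lerD.
  - have := hexpN _ h2; have := hexpN _ h3; lra.
  move=> g gP.
  have /(coupled_reindex (conf_perm_bij bf) (conf_perm_bij bf)) :=
    coupled_prod (fun _ : J => ex_intro _ g gP).
  rewrite (_ : _ \o _ = pois_conf a (b * th ^+ n.+1)); last first.
    by apply/funext => x /=; rewrite -(pois_conf_perm _ _ _ bf).
  rewrite (_ : _ \o _ = pois_conf (a * th) (b * th ^+ n))//.
  by apply/funext => x /=; rewrite -(pois_conf_perm _ _ _ bf).
have := IH (a * th) _ (mulr_gt0 a0 th0) b0 haS h3 hmu1 hmu2.
rewrite -[X in pois_conf X b]mulrA -exprS => /(_ (fun i => bs i.+1)) rest.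
apply: coupled_sub (coupled_trans step rest) => x z [y xy [yz1 yz2 yz3]].
have bxy j : ((y (f j)).2 <= (x (f j)).2)%N.
  by case: (xy j) => _; rewrite !ffunE.
have xy1 j : ((x j).1 <= (y j).1)%N by case: (xy j); rewrite !ffunE.
split.
- by move=> j; exact: leq_trans (yz1 j).
- move=> j; apply: leq_trans (yz2 j) _; case: bf => h fh hf.
  by rewrite -(hf j).
- move=> [|i] j /= isz xj.
    case: (xy j) => _ _; rewrite !ffunE/= => /(_ xj) e.
    by apply/eqP; rewrite -leqn0 -e.
  by apply: yz3 => //; exact: leq_trans xj (xy1 j).
Qed.

(** * Independent points with prescribed laws *)

Lemma measure_finpartition d (T : measurableType d) (R : realType)
    (mu : {measure set T -> \bar R}) (C : finType) (E : C -> set T) :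
  (forall c, measurable (E c)) -> trivIset setT E ->
  mu (\bigcup_c E c) = (\sum_c mu (E c))%E.
Proof.
move=> mE tE; rewrite measure_fin_bigcup//; last exact: finite_finset.
rewrite -(big_enum _ _ _ (fun c => mu (E c)))/= [RHS]fsbig_seq ?enum_uniq//.
rewrite (_ : [set` enum xpredT] = setT)//.
by apply/seteqP; split => // c _ /=; rewrite mem_enum.
Qed.

Lemma measure_count_preimage d (T : measurableType d) (R : realType)
    (mu : {measure set T -> \bar R}) (V : countType) (K : T -> V) (Q : set V) :
  (forall k, measurable (K @^-1` [set k])) ->
  measurable (K @^-1` Q) /\
  mu (K @^-1` Q) = \esum_(k in Q) mu (K @^-1` [set k]).
Proof.
move=> mK.
pose F n := if @choice.pickle_inv V n is Some k then
  (if k \in Q then K @^-1` [set k] else set0) else set0.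
have mF n : measurable (F n).
  by rewrite /F; case: (@choice.pickle_inv V n) => [k|]//; case: ifP.
have QF : K @^-1` Q = \bigcup_n F n.
  apply/seteqP; split => [x /= Qx|x [n _]].
    by exists (choice.pickle (K x)) => //; rewrite /F choice.pickleK_inv mem_set.
  by rewrite /F; case: choice.pickle_inv => [k|]//; case: ifPn => // /[!inE] Qk /= ->.
split; first by rewrite QF; exact: bigcupT_measurable.
have tF : trivIset setT F.
  move=> i j _ _ [x []]; rewrite /F.
  case ei : choice.pickle_inv => [k|]//; case: ifP => // _ /= kx.
  case ej : choice.pickle_inv => [l|]//; case: ifP => // _ /= lx.
  have := @choice.pickle_invK V i; have := @choice.pickle_invK V j.
  by rewrite /ocancel ei ej/= -kx -lx => <- <-.
rewrite QF measure_semi_bigcup//; last exact: bigcupT_measurable.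
rewrite nneseries_esumT => [|n]; last exact: measure_ge0.
transitivity (\esum_(n in choice.pickle @` Q) mu (F n)).
  rewrite [RHS]esum_mkcond; apply: eq_esum => n _; case: ifPn => //.
  rewrite notin_setE => /= nQ; rewrite /F.
  case en : choice.pickle_inv => [k|]; last by rewrite measure0.
  case: ifPn => [|_]; last by rewrite measure0.
  rewrite inE => Qk; case: nQ; exists k => //.
  by have := @choice.pickle_invK V n; rewrite /ocancel en.
rewrite esum_image; last by move=> x y _ _; exact: (pcan_inj choice.pickleK).
by apply: eq_esum => k Qk; rewrite /F choice.pickleK_inv mem_set.
Qed.

(** Used to discard the null event that points coincide or leave their boxes. *)
Lemma probability_congr d (T : measurableType d) (R : realType)
    (P : probability T R) (A B G : set T) : measurable A -> measurable B ->
  measurable G -> P G = 1%E -> (forall x, G x -> A x <-> B x) -> P A = P B.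
Proof.
move=> mA mB mG PG AB.
have H (X : set T) : measurable X -> P X = P (X `&` G).
  move=> mX; have PGC : P (~` G) = 0%E.
    by rewrite probability_setC// PG subee.
  rewrite (measureDI P mX mG) [X in (X + _)%E](_ : _ = 0%E) ?add0e//.
  by apply: subset_measure0 PGC; first [exact: measurableD|exact: measurableC|move=> x []].
rewrite (H A)// (H B)//; congr (P _); apply/seteqP; split => x [? Gx]; split => //.
  exact/(AB x Gx).
exact/(AB x Gx).
Qed.

Record pspace (R : realType) := PSpace {
  ps_d : measure_display;
  ps_T : measurableType ps_d;
  ps_P : probability ps_T R;
  ps_pts : ps_T -> seq (pt3 R) }.
Arguments ps_pts {R} p _.

(** Independent points, one of law [U j] for each label [j] in [L]. The carrier is a product whose
    type depends on [L], hence the record [pspace]; the head of the list is the outermost factor. *)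
Fixpoint fib (R : realType) (J : Type) (U : J -> probability (pt3 R) R)
    (L : seq J) : pspace R :=
  if L is j :: L' then
    @PSpace R _ _ (ps_P (fib U L') \x U j)%E
      (fun w => w.2 :: ps_pts (fib U L') w.1)
  else @PSpace R _ _ (dirac tt : probability unit R) (fun=> [::]).

(** Distinctness is part of the event because the processes are sets: without it, cardinals of sets
    would differ from counts in lists. *)
Fixpoint good (R : realType) (J : Type) (U : J -> probability (pt3 R) R)
    (Q : J -> set (pt3 R)) (L : seq J) : set (ps_T (fib U L)) :=
  match L return set (ps_T (fib U L)) with
  | [::] => setT
  | j :: L' => [set w | [/\ @good R J U Q L' w.1, Q j w.2 &
                           w.2 \notin ps_pts (fib U L') w.1]]
  end.

Lemma size_fib (R : realType) (J : Type) (U : J -> probability (pt3 R) R)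
    (L : seq J) (w : ps_T (fib U L)) : size (ps_pts (fib U L) w) = size L.
Proof. by elim: L w => //= j L IH w; rewrite IH. Qed.

Lemma good_uniq (R : realType) (J : Type) (U : J -> probability (pt3 R) R)
    (Q : J -> set (pt3 R)) (L : seq J) (w : ps_T (fib U L)) :
  good Q w -> uniq (ps_pts (fib U L) w).
Proof. by elim: L w => //= j L IH w [/IH -> _ ->]. Qed.

Lemma good_label (R : realType) (J : eqType) (U : J -> probability (pt3 R) R)
    (Q : J -> set (pt3 R)) (L : seq J) n (w : ps_T (fib U L)) u :
  good Q w -> u \in drop n (ps_pts (fib U L) w) ->
  exists2 j, j \in drop n L & Q j u.
Proof.
elim: L n w => [|j L IH] [|n] //= w [gw Qw _]; last exact: IH.
rewrite inE => /orP[/eqP ->|uw]; first by exists j; rewrite ?mem_head.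
have [|i iL Qi] := IH 0%N w.1 gw; first by rewrite drop0.
by exists i => //; rewrite inE; rewrite drop0 in iL; rewrite iL orbT.
Qed.

Lemma measurable_diag3 d (Z : measurableType d) (R : realType)
    (f g : Z -> pt3 R) : measurable_fun setT f -> measurable_fun setT g ->
  measurable [set z | f z = g z].
Proof.
move=> mf mg.
have H (h : pt3 R -> R) : measurable_fun setT h ->
    measurable [set z | h (f z) = h (g z)].
  move=> mh; have := @measurable_fun_eqr _ Z R setT (h \o f) (h \o g).
  move=> /(_ (measurableT_comp mh mf) (measurableT_comp mh mg)) me.
  rewrite (_ : [set _ | _] = setT `&` (fun x => (h \o f) x == (h \o g) x) @^-1` [set true]).
    exact: me.
  by rewrite setTI; apply/seteqP; split => z /= /eqP.
rewrite (_ : [set _ | _] = [set z | (f z).1.1 = (g z).1.1] `&`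
   [set z | (f z).1.2 = (g z).1.2] `&` [set z | (f z).2 = (g z).2]).
  apply: measurableI; first apply: measurableI.
  - apply: (H (fun p => p.1.1)); apply: measurableT_comp measurable_fst.
    exact: measurable_fst.
  - apply: (H (fun p => p.1.2)); apply: measurableT_comp measurable_fst.
    exact: measurable_snd.
  - apply: (H (fun p => p.2)); exact: measurable_snd.
apply/seteqP; split => z /=; first by move=> ->.
by case: (f z) (g z) => [[? ?] ?] [[? ?] ?] [/= [-> ->] ->].
Qed.

Lemma measurable_mem_fib d (Z : measurableType d) (R : realType) (J : Type)
    (U : J -> probability (pt3 R) R) (L : seq J) (f : Z -> pt3 R)
    (h : Z -> ps_T (fib U L)) :
  measurable_fun setT f -> measurable_fun setT h ->
  measurable [set z | f z \in ps_pts (fib U L) (h z)].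
Proof.
elim: L h => [|j L IH] h mf mh /=.
  by rewrite (_ : [set _ | _] = set0)//; apply/seteqP; split.
rewrite (_ : [set _ | _] = [set z | f z = (h z).2] `|`
  [set z | f z \in ps_pts (fib U L) (h z).1]); last first.
  apply/seteqP; split => z /=; rewrite inE.
    by move=> /orP[/eqP|]; [left|right].
  by move=> [->|->]; rewrite ?eqxx ?orbT.
apply: measurableU.
  apply: measurable_diag3 => //; apply: measurableT_comp mh; exact: measurable_snd.
apply: IH => //; apply: measurableT_comp mh; exact: measurable_fst.
Qed.

(** By Fubini, a point with an atomless law almost surely avoids the finitely many points placed
    before it: the sections of the bad event [B] are finite sets. *)
Lemma prob_good (R : realType) (J : Type) (U : J -> probability (pt3 R) R)
    (Q : J -> set (pt3 R)) (L : seq J) :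
  (forall j, measurable (Q j)) -> (forall j, U j (Q j) = 1%E) ->
  (forall j u, U j [set u] = 0%E) ->
  measurable (@good R J U Q L) /\ ps_P (fib U L) (@good R J U Q L) = 1%E.
Proof.
move=> mQ UQ U0; elim: L => [|j L [mG PG]] /=.
  by split; [exact: measurableT|rewrite diracT].
set G := @good R J U Q L in mG PG.
pose B := [set w : ps_T (fib U L) * pt3 R | w.2 \in ps_pts (fib U L) w.1].
have mB : measurable B.
  exact: (@measurable_mem_fib _ _ R J U L snd fst measurable_snd measurable_fst).
have -> : [set w | [/\ G w.1, Q j w.2 & w.2 \notin ps_pts (fib U L) w.1]]
   = (G `*` Q j) `&` ~` B.
  apply/seteqP; split => w /=; rewrite /B/=; first by move=> [? ? /negP].
  by move=> [[? ?] /negP].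
have mGQ : measurable (G `*` Q j) by exact: measurableX.
split; first by apply: measurableI => //; exact: measurableC.
have PB : (ps_P (fib U L) \x U j)%E B = 0%E.
  rewrite /= /product_measure1; apply: integral0_eq => w _ /=.
  rewrite (_ : xsection B w = [set` ps_pts (fib U L) w]); last first.
    by apply/seteqP; split => u; rewrite /xsection/= inE.
  elim: (ps_pts (fib U L) w) => [|u l IH].
    by rewrite (_ : [set` _] = set0) ?measure0//; apply/seteqP; split.
  have m1 (l' : seq (pt3 R)) : measurable [set` l'].
    elim: l' => [|v l' IHl]; first by rewrite (_ : [set` _] = set0)//; apply/seteqP; split.
    rewrite (_ : [set` _] = [set v] `|` [set` l']).
      apply: measurableU => //.
      exact: (@measurable_diag3 _ _ R id (cst v) (@measurable_id _ _ setT) (measurable_cst _)).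
    apply/seteqP; split => x /=; rewrite inE.
      by move=> /orP[/eqP|]; [left|right].
    by move=> [->|->]; rewrite ?eqxx ?orbT.
  rewrite (_ : [set` _] = [set u] `|` [set` l]); last first.
    apply/seteqP; split => x /=; rewrite inE.
      by move=> /orP[/eqP|]; [left|right].
    by move=> [->|->]; rewrite ?eqxx ?orbT.
  have mu1 : measurable [set u].
    exact: (@measurable_diag3 _ _ R id (cst u) (@measurable_id _ _ setT) (measurable_cst _)).
  by rewrite measureU0//; exact: U0.
have PBC : (ps_P (fib U L) \x U j)%E (~` B) = 1%E.
  transitivity (1 - (ps_P (fib U L) \x U j)%E B)%E; first exact: probability_setC.
  by rewrite PB sube0.
rewrite -[RHS](_ : (ps_P (fib U L) \x U j)%E (G `*` Q j) = 1%E); last first.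
  transitivity (ps_P (fib U L) G * U j (Q j))%E; first exact: product_measure1E.
  by rewrite PG UQ mule1.
apply: (@probability_congr _ _ R _ _ _ (~` B)) => //.
- by apply: measurableI => //; exact: measurableC.
- exact: measurableC.
- by move=> x Bx; split => [[]|].
Qed.

(** The labels of [L'] are outer factors and integrate to 1. This gives the smaller of two nested
    point families its own law inside the space of the larger one. *)
Lemma prob_drop (R : realType) (J : Type) (U : J -> probability (pt3 R) R)
    (L' L : seq J) (Ev : set (seq (pt3 R))) :
  measurable [set w | Ev (ps_pts (fib U L) w)] ->
  measurable [set w | Ev (drop (size L') (ps_pts (fib U (L' ++ L)) w))] /\
  ps_P (fib U (L' ++ L))
     [set w | Ev (drop (size L') (ps_pts (fib U (L' ++ L)) w))] =
  ps_P (fib U L) [set w | Ev (ps_pts (fib U L) w)].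
Proof.
move=> mE; elim: L' => [|j L' [IHm IHP]] /=.
  by under eq_set do rewrite drop0.
rewrite [X in measurable X](_ : _ =
  [set w | Ev (drop (size L') (ps_pts (fib U (L' ++ L)) w))] `*` setT); last first.
  by apply/seteqP; split => w //= -[].
split; first exact: measurableX.
rewrite -IHP -[RHS]mule1 -(probability_setT (U j)).
rewrite -[RHS](@product_measure1E _ _ _ _ R (ps_P (fib U (L' ++ L))) (U j))//.
by congr (_ _); apply/seteqP; split => w //= -[].
Qed.

(** * Class counts of independent points *)

Lemma esumZle (R : realType) (T : choiceType) (c : \bar R)
    (a : T -> \bar R) : (0 <= c)%E -> (forall i, 0 <= a i)%E ->
  (\esum_(i in setT) (c * a i) = c * \esum_(i in setT) a i)%E.
Proof.
case: c => [c||//] c0 a0; first by rewrite esumZl.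
have [[i ai]|] := pselect (exists i, a i != 0%E).
  have ai0 : (0 < a i)%E by rewrite lt0e ai a0.
  rewrite [RHS]gt0_mulye; last first.
    by apply: lt_le_trans ai0 _; exact: le_term_esum.
  apply/eqP; rewrite -leye_eq -{1}(gt0_mulye ai0).
  apply: (@le_term_esum _ _ (fun i => +oo * a i)%E) => j.
  by rewrite mule_ge0.
move=> nai; have {}nai i : a i = 0%E.
  by apply/eqP; apply: contrapT => /negP ai; apply: nai; exists i.
by rewrite !esum1 ?mule0// => i _; rewrite nai mule0.
Qed.

Lemma esumM (R : realType) (T1 T2 : choiceType) (a : T1 -> \bar R)
    (b : T2 -> \bar R) : (forall i, 0 <= a i)%E -> (forall j, 0 <= b j)%E ->
  (\esum_(i in setT) \esum_(j in setT) (a i * b j) =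
   (\esum_(i in setT) a i) * \esum_(j in setT) b j)%E.
Proof.
move=> a0 b0.
transitivity (\esum_(i in setT) ((\esum_(j in setT) b j) * a i)%E).
  by apply: eq_esum => i _; rewrite esumZle// muleC.
have sb0 : (0 <= \esum_(j in setT) b j)%E by apply: esum_ge0.
by rewrite (esumZle sb0 a0) muleC.
Qed.

Definition zcount (R : realType) (J C : finType) (cl : pt3 R -> C)
    (L : seq J) (l : seq (pt3 R)) : {ffun J * C -> nat} :=
  [ffun p => count_mem p (zip L (map cl l))].

(** The multinomial probability that [n j] independent points fall into the classes [c] with
    multiplicities [k (j, c)]; it is 0 if the totals disagree. *)
Definition multi_term (R : realType) (J C : finType) (q : J -> C -> R)
    (n : J -> nat) (k : {ffun J * C -> nat}) (j : J) : R :=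
  if (\sum_c k (j, c) == n j)%N
  then (n j)`!%:R * \prod_c (q j c ^+ k (j, c) / (k (j, c))`!%:R) else 0.

Definition multi (R : realType) (J C : finType) (q : J -> C -> R)
    (n : J -> nat) (k : {ffun J * C -> nat}) : R :=
  \prod_j multi_term q n k j.

Definition dec (I : finType) (k : {ffun I -> nat}) (p : I) : {ffun I -> nat} :=
  [ffun i => (k i - (i == p))%N].

Lemma multi_step (R : realType) (J C : finType) (q : J -> C -> R)
    (n : J -> nat) (k : {ffun J * C -> nat}) (j0 : J) :
  multi q (fun j => ((j0 == j) + n j)%N) k =
  \sum_c (if (0 < k (j0, c))%N then multi q n (dec k (j0, c)) * q j0 c else 0).
Proof.
rewrite {1}/multi (bigD1 j0)//=.
have -> : \prod_(j | j != j0) multi_term q (fun j => ((j0 == j) + n j)%N) k j =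
    \prod_(j | j != j0) multi_term q n k j.
  by apply: eq_bigr => j jj0; rewrite /multi_term [j0 == j]eq_sym (negbTE jj0).
transitivity ((\sum_c (if (0 < k (j0, c))%N then
   multi_term q n (dec k (j0, c)) j0 * q j0 c else 0)) *
   \prod_(j | j != j0) multi_term q n k j); last first.
  rewrite mulr_suml; apply: eq_bigr => c _; case: ifP => _; last by rewrite mul0r.
  rewrite mulrAC; congr (_ * _); rewrite /multi [RHS](bigD1 j0)//=; congr (_ * _).
  apply: eq_bigr => j jj0; rewrite /multi_term.
  have e c' : dec k (j0, c) (j, c') = k (j, c').
    by rewrite ffunE xpair_eqE (negbTE jj0) subn0.
  have -> : (\sum_c' dec k (j0, c) (j, c') = \sum_c' k (j, c'))%N.
    by apply: eq_bigr => c' _; rewrite e.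
  by case: ifP => // _; congr (_ * _); apply: eq_bigr => c' _; rewrite e.
congr (_ * _); rewrite /multi_term eqxx add1n.
have sumdec c : (0 < k (j0, c))%N ->
    (\sum_c' dec k (j0, c) (j0, c') = (\sum_c' k (j0, c')).-1)%N.
  move=> kc; rewrite (bigD1 c)//= [in RHS](bigD1 c)//= ffunE eqxx/= subn1.
  rewrite (eq_bigr (fun c' => k (j0, c'))); last first.
    by move=> c' cc'; rewrite ffunE xpair_eqE (negbTE cc') andbF subn0.
  by case: (k (j0, c)) kc.
have [sk|sk] := eqVneq; last first.
  rewrite big1// => c _; case: ifP => // kc; rewrite sumdec//.
  rewrite ifF ?mul0r//; apply: contraNF sk => /eqP <-.
  by rewrite prednK// (bigD1 c)//= addn_gt0 kc.
(* The factor [(n j0).+1] of the factorial is the sum of the [k (j0, c)]; the summand of [c] then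
   cancels one factor of [(k (j0, c))!]. *)
transitivity (\sum_c (k (j0, c))%:R * ((n j0)`!%:R *
   \prod_c (q j0 c ^+ k (j0, c) / (k (j0, c))`!%:R))).
  by rewrite -mulr_suml -natr_sum sk factS natrM mulrA.
apply: eq_bigr => c _; case: ifP => [kc|/negbT]; last first.
  by rewrite lt0n negbK => /eqP ->; rewrite mul0r.
rewrite sumdec// sk/= eqxx mulrCA -[RHS]mulrA; congr (_ * _).
rewrite (bigD1 c)//= [in RHS](bigD1 c)//= ffunE eqxx/= subn1.
rewrite [in RHS](eq_bigr (fun c' => q j0 c' ^+ k (j0, c') / (k (j0, c'))`!%:R));
    last first.
  by move=> c' cc'; rewrite ffunE xpair_eqE (negbTE cc') andbF subn0.
case: (k (j0, c)) kc => // m _ /=; rewrite factS natrM exprS.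
have m1 : m.+1%:R != 0 :> R by rewrite pnatr_eq0.
have mf : m`!%:R != 0 :> R by rewrite pnatr_eq0 -lt0n fact_gt0.
move: m1 mf; move: (m.+1%:R) (m`!%:R) => x y x0 y0.
by field; rewrite ?x0 ?y0.
Qed.

(** Induction on the labels, the event being split by the class of the head point; [multi_step] is
    the matching recursion. *)
Lemma prob_zcount (R : realType) (J C : finType) (U : J -> probability (pt3 R) R)
    (cl : pt3 R -> C) (L : seq J) (k : {ffun J * C -> nat}) :
  (forall c, measurable (cl @^-1` [set c])) ->
  measurable [set w | zcount cl L (ps_pts (fib U L) w) = k] /\
  ps_P (fib U L) [set w | zcount cl L (ps_pts (fib U L) w) = k] =
  (multi (fun j c => fine (U j (cl @^-1` [set c]))) (fun j => count_mem j L) k)%:E.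
Proof.
move=> mcl; elim: L k => [|j L IH] k /=.
  have [k0|k0] := pselect (k = [ffun=> 0%N]).
    rewrite (_ : [set _ | _] = setT); last first.
      by apply/seteqP; split => // w _ /=; rewrite k0; apply/ffunP => p; rewrite !ffunE.
    split; first exact: measurableT.
    rewrite diracT; congr EFin; rewrite /multi big1// => j _; rewrite /multi_term.
    rewrite big1 => [|c _]; last by rewrite k0 ffunE.
    rewrite eqxx fact0 mul1r big1// => c _; rewrite k0 ffunE expr0 fact0 divr1//.
  rewrite (_ : [set _ | _] = set0); last first.
    apply/seteqP; split => // w /= kw; apply: k0; rewrite -kw.
    by apply/ffunP => p; rewrite !ffunE.
  split; first exact: measurable0.
  rewrite measure0; congr EFin; apply/esym.
  have [p kp] : exists p, k p != 0%N.
    apply: contrapT => h; apply: k0; apply/ffunP => p; rewrite ffunE.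
    by apply/eqP; apply: contrapT => /negP kp; apply: h; exists p.
  rewrite /multi (bigD1 p.1)//= /multi_term ifF ?mul0r//.
  apply: negbTE; rewrite -lt0n (bigD1 p.2)//= addn_gt0.
  by rewrite -surjective_pairing lt0n kp.
pose A c : set (ps_T (fib U L)) := if (0 < k (j, c))%N then
  [set w | zcount cl L (ps_pts (fib U L) w) = dec k (j, c)] else set0.
have mA c : measurable (A c).
  by rewrite /A; case: ifP => // _; case: (IH (dec k (j, c))).
have -> : [set w | zcount cl (j :: L) (w.2 :: ps_pts (fib U L) w.1) = k] =
    \bigcup_c (A c `*` (cl @^-1` [set c])).
  apply/seteqP; split => [[w u] /= kw|[w u] [c _ [/=]]]; last first.
    rewrite /A; case: ifP => // kc /= /ffunP zw clu; apply/ffunP => p.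
    have := zw p; rewrite !ffunE/= clu [(j, c) == p]eq_sym => ->.
    by case: eqP => [->|_]; rewrite ?subn0// subn1 add1n prednK.
  exists (cl u) => //; split => //=; rewrite /A -kw ffunE/= eqxx add1n ltnS leq0n /=.
  by apply/ffunP => p; rewrite !ffunE/= eq_sym addKn.
have mAB c : measurable (A c `*` (cl @^-1` [set c])) by exact: measurableX.
have tAB : trivIset setT (fun c => A c `*` (cl @^-1` [set c])).
  by move=> c c' _ _ [[w u] [[_ /= <-] [_ /= <-]]].
split; first by apply: fin_bigcup_measurable => //; exact: finite_finset.
transitivity (\sum_c (ps_P (fib U L) \x U j)%E (A c `*` (cl @^-1` [set c])))%E.
  exact: measure_finpartition.
rewrite multi_step -sumEFin; apply: eq_bigr => c _.
transitivity (ps_P (fib U L) (A c) * U j (cl @^-1` [set c]))%E.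
  exact: product_measure1E.
rewrite /A; case: ifP => _; last by rewrite measure0 mul0e.
by case: (IH (dec k (j, c))) => _ ->; rewrite EFinM fineK// fin_num_measure.
Qed.

(** Poisson splitting: a Poisson number of points, classified independently, yields independent
    Poisson numbers in the classes. *)
Lemma prod_pois_multi (R : realType) (J C : finType) (q : J -> C -> R) (a : R)
    (n : J -> nat) (k : {ffun J * C -> nat}) :
  (forall j, \sum_c q j c = 1) ->
  (\prod_j pois a (n j)) * multi q n k =
  if [forall j, \sum_c k (j, c) == n j]%N
  then \prod_p pois (a * q p.1 p.2) (k p) else 0.
Proof.
move=> q1; rewrite -big_split/=; case: ifPn => [/forallP nk|]; last first.
  rewrite negb_forall => /existsP[j /negbTE nkj].
  by rewrite (bigD1 j)//= /multi_term nkj mulr0 mul0r.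
rewrite (eq_bigr (fun p => (fun j c => pois (a * q j c) (k (j, c))) p.1 p.2));
  last by move=> [].
rewrite -(pair_bigA _ (fun j c => pois (a * q j c) (k (j, c))))/=.
apply: eq_bigr => j _; rewrite /multi_term nk.
rewrite [RHS](eq_bigr (fun c => a ^+ k (j, c) *
  (q j c ^+ k (j, c) / (k (j, c))`!%:R) * expR (- (a * q j c)))); last first.
  by move=> c _; rewrite /pois exprMn mulrA.
rewrite [RHS]big_split/= [X in _ = X * _]big_split/= -expr_sum (eqP (nk j)) -expR_sum sumrN -mulr_sumr.
rewrite q1 mulr1 /pois.
have nf : (n j)`!%:R != 0 :> R by rewrite pnatr_eq0 -lt0n fact_gt0.
by field.
Qed.

(** Poisson superposition for several disjoint groups at once. Indices sent to [None] belong to no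
    group and sum out to 1; an index of group [i0] is absorbed by the convolution [esum_pois_le]. *)
Lemma pois_merge (R : realType) (I : finType) n (cl : I -> option 'I_n)
    (nu : I -> R) (m : 'I_n -> nat) : (forall i, 0 <= nu i) ->
  \esum_(k in [set k : {ffun I -> nat} | forall i,
      (\sum_(p | cl p == Some i) k p)%N = m i]) (\prod_p pois (nu p) (k p))%:E =
  (\prod_i pois (\sum_(p | cl p == Some i) nu p) (m i))%:E.
Proof.
move=> nu0.
have P0 (s : seq I) (k : {ffun I -> nat}) : 0 <= \prod_(p <- s) pois (nu p) (k p).
  by apply: prodr_ge0 => p _; exact: pois_ge0.
have S0 (s : seq I) i : 0 <= \sum_(p <- s | cl p == Some i) nu p.
  by apply: sumr_ge0.
suff H s : uniq s -> forall m : 'I_n -> nat, \esum_(k in supported 0%N s)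
    (if [forall i, \sum_(p <- s | cl p == Some i) k p == m i]%N
     then \prod_(p <- s) pois (nu p) (k p) else 0)%:E =
    (\prod_i pois (\sum_(p <- s | cl p == Some i) nu p) (m i))%:E.
  have := H (enum I) (enum_uniq _) m; rewrite supported_enum.
  under [in RHS]eq_bigr => i _ do rewrite big_enum_cond/=.
  rewrite /= => <-; rewrite esum_mkcond; apply: eq_esum => k _.
  rewrite big_enum/=; case: ifPn => km.
    rewrite ifT//; apply/forallP => i; rewrite big_enum_cond/=.
    by move: km; rewrite inE => ->.
  rewrite ifF//; apply: contraNF km => /forallP km; rewrite inE => i.
  by have /eqP := km i; rewrite big_enum_cond.
elim: s => [_ m'|p s IH /= /andP[ps us] m'].
  rewrite supported_nil esum_set1; last by rewrite lee_fin; case: ifP; rewrite ?big_nil.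
  congr EFin; case: ifPn => [/forallP h|].
    rewrite big_nil big1// => i _; have /eqP := h i; rewrite !big_nil => <-.
    by rewrite pois0n eqxx.
  rewrite negb_forall => /existsP[i]; rewrite big_nil eq_sym => /negbTE mi.
  by rewrite (bigD1 i)//= big_nil pois0n mi mul0r.
rewrite esum_supported_cons//; last first.
  by move=> k; rewrite lee_fin; case: ifP.
have updp (k : {ffun I -> nat}) t : ffun_upd k p t p = t by rewrite ffunE eqxx.
have upds (k : {ffun I -> nat}) t j : j \in s -> ffun_upd k p t j = k j.
  by rewrite ffunE; case: eqP => // ->; rewrite (negbTE ps).
have prods k t : \prod_(j <- s) pois (nu j) (ffun_upd k p t j) =
    \prod_(j <- s) pois (nu j) (k j).
  by apply: eq_big_seq => j js; rewrite upds.
have sums k t i : (\sum_(j <- s | cl j == Some i) ffun_upd k p t j =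
    \sum_(j <- s | cl j == Some i) k j)%N.
  by rewrite big_seq_cond [RHS]big_seq_cond; apply: eq_bigr => j /andP[/upds].
case clp : (cl p) => [i0|]; last first.
  have eqN (i : 'I_n) : (None == Some i) = false by [].
  have -> : \prod_i pois (\sum_(p0 <- p :: s | cl p0 == Some i) nu p0) (m' i) =
      \prod_i pois (\sum_(p0 <- s | cl p0 == Some i) nu p0) (m' i).
    by apply: eq_bigr => i _; rewrite big_cons clp eqN.
  transitivity (\esum_(t in setT) ((\prod_i pois
      (\sum_(p0 <- s | cl p0 == Some i) nu p0) (m' i))%:E * (pois (nu p) t)%:E))%E.
    apply: eq_esum => t _; rewrite -IH// muleC -esumZl ?pois_ge0//; last first.
      by move=> k _; rewrite lee_fin; case: ifP.
    apply: eq_esum => k _; rewrite -EFinM; congr EFin.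
    rewrite big_cons updp prods.
    have -> : [forall i, (\sum_(p0 <- p :: s | cl p0 == Some i) ffun_upd k p t p0 == m' i)%N]
       = [forall i, (\sum_(p0 <- s | cl p0 == Some i) k p0 == m' i)%N].
      by apply: eq_forallb => i; rewrite big_cons clp eqN sums.
    by case: ifP; rewrite ?mulr0.
  rewrite esumZl ?esum_pois ?mule1//; last by move=> t _; rewrite lee_fin pois_ge0.
  by apply: prodr_ge0 => i _; apply: pois_ge0; exact: S0.
pose N i := \sum_(p0 <- s | cl p0 == Some i) nu p0.
pose rest := \prod_(i | i != i0) pois (N i) (m' i).
have rest0 : 0 <= rest by apply: prodr_ge0 => i _; apply: pois_ge0; exact: S0.
transitivity (\esum_(t in setT) (rest%:E * (if (t <= m' i0)%N then
    pois (nu p) t * pois (N i0) (m' i0 - t) else 0)%:E))%E.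
  apply: eq_esum => t _; case: ifPn => [tm|]; last first.
    rewrite -ltnNge => tm; rewrite mule0 esum1// => k _; congr EFin.
    rewrite ifF//; apply: negbTE; rewrite negb_forall; apply/existsP; exists i0.
    rewrite big_cons clp eqxx updp; apply: contraL tm => /eqP <-.
    by rewrite -leqNgt leq_addr.
  pose m'' i := if i == i0 then (m' i0 - t)%N else m' i.
  transitivity ((pois (nu p) t)%:E * (\prod_i pois (N i) (m'' i))%:E)%E; last first.
    rewrite -!EFinM; congr EFin; rewrite (bigD1 i0)//= /m'' eqxx.
    rewrite mulrA mulrC; congr (_ * _); apply: eq_bigr => i /negbTE ii0.
    by rewrite ii0.
  rewrite -IH// -esumZl ?pois_ge0//; last first.
    by move=> k _; rewrite lee_fin; case: ifP.
  apply: eq_esum => k _; rewrite -EFinM; congr EFin.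
  rewrite big_cons updp prods.
  have -> : [forall i, (\sum_(p0 <- p :: s | cl p0 == Some i) ffun_upd k p t p0 == m' i)%N]
     = [forall i, (\sum_(p0 <- s | cl p0 == Some i) k p0 == m'' i)%N]; last first.
    by case: ifP; rewrite ?mulr0.
  apply: eq_forallb => i; rewrite big_cons clp updp sums /m'' (inj_eq Some_inj) [i0 == i]eq_sym.
  have [->|//] := eqVneq i i0; apply/eqP/eqP => [<-|->]; first by rewrite addKn.
  by rewrite subnKC.
rewrite esumZl//; last first.
  by move=> t _; rewrite lee_fin; case: ifP => // _; rewrite mulr_ge0 ?pois_ge0 ?S0.
rewrite esum_pois_le ?S0// -EFinM; congr EFin.
rewrite [RHS](bigD1 i0)//= big_cons clp eqxx mulrC; congr (_ * _).
apply: eq_bigr => i ii0; rewrite big_cons clp (inj_eq Some_inj).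
by rewrite eq_sym (negbTE ii0).
Qed.

(** After exchanging sums, class counts [k] and [l] determine the configuration: only their totals
    [x0] contribute. The Poisson weights of the two signs then factor, which is the source of the
    independence of the two processes. *)
Lemma mixture_pois_multi (R : realType) (J C1 C2 : finType) (a b : R)
    (q1 : J -> C1 -> R) (q2 : J -> C2 -> R)
    (K1 : set {ffun J * C1 -> nat}) (K2 : set {ffun J * C2 -> nat}) :
  0 <= a -> 0 <= b -> (forall j c, 0 <= q1 j c) -> (forall j c, 0 <= q2 j c) ->
  (forall j, \sum_c q1 j c = 1) -> (forall j, \sum_c q2 j c = 1) ->
  (\esum_(x in [set: conf J]) ((pois_conf a b x)%:E *
      ((\esum_(k in K1) (multi q1 (fun j => (x j).1) k)%:E) *
       \esum_(l in K2) (multi q2 (fun j => (x j).2) l)%:E)) =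
   (\esum_(k in K1) (\prod_p pois (a * q1 p.1 p.2) (k p))%:E) *
   \esum_(l in K2) (\prod_p pois (b * q2 p.1 p.2) (l p))%:E)%E.
Proof.
move=> a0 b0 q10 q20 s1 s2.
have multi0 (C : finType) (q : J -> C -> R) n k : (forall j c, 0 <= q j c) ->
    0 <= multi q n k.
  move=> q0; apply: prodr_ge0 => j _; rewrite /multi_term; case: ifP => // _.
  by rewrite mulr_ge0//; apply: prodr_ge0 => c _; rewrite divr_ge0 ?exprn_ge0.
pose M1 (x : conf J) k : R := if k \in K1 then multi q1 (fun j => (x j).1) k else 0.
pose M2 (x : conf J) l : R := if l \in K2 then multi q2 (fun j => (x j).2) l else 0.
have M10 (x : conf J) k : 0 <= M1 x k by rewrite /M1; case: ifP => // _; exact: multi0.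
have M20 (x : conf J) k : 0 <= M2 x k by rewrite /M2; case: ifP => // _; exact: multi0.
have mk (C : finType) (K : set {ffun J * C -> nat}) (f : {ffun J * C -> nat} -> R) :
    \esum_(k in K) (f k)%:E = \esum_(k in setT) (if k \in K then f k else 0)%:E.
  by rewrite esum_mkcond; apply: eq_esum => k _; case: ifP.
pose p1 k : R := if k \in K1 then \prod_p pois (a * q1 p.1 p.2) (k p) else 0.
pose p2 l : R := if l \in K2 then \prod_p pois (b * q2 p.1 p.2) (l p) else 0.
have p10 k : 0 <= p1 k.
  rewrite /p1; case: ifP => // _; apply: prodr_ge0 => p _.
  by rewrite pois_ge0// mulr_ge0.
have p20 k : 0 <= p2 k.
  rewrite /p2; case: ifP => // _; apply: prodr_ge0 => p _.
  by rewrite pois_ge0// mulr_ge0.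
have pc0 (x : conf J) : 0 <= pois_conf a b x by exact: pois_conf_ge0.
transitivity (\esum_(x in [set: conf J]) \esum_(k in setT) \esum_(l in setT)
    (pois_conf a b x * (M1 x k * M2 x l))%:E).
  apply: eq_esum => x _; rewrite (mk _ K1) (mk _ K2) -esumM; first last.
  - by move=> j; rewrite lee_fin; exact: M20.
  - by move=> j; rewrite lee_fin; exact: M10.
  rewrite -esumZle ?lee_fin//; last first.
    move=> k; apply: esum_ge0 => l _; rewrite -EFinM lee_fin.
    by apply: mulr_ge0; [exact: M10|exact: M20].
  apply: eq_esum => k _; rewrite -esumZle ?lee_fin//.
  by move=> l; rewrite -EFinM lee_fin; apply: mulr_ge0; [exact: M10|exact: M20].
have t0 x k l : (0 <= (pois_conf a b x * (M1 x k * M2 x l))%:E)%E.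
  by rewrite lee_fin; apply: mulr_ge0 => //; apply: mulr_ge0.
rewrite esum_exchange; last by move=> x k; apply: esum_ge0.
rewrite (mk _ K1) (mk _ K2) -/p1 -/p2.
transitivity (\esum_(k in setT) \esum_(l in setT) ((p1 k)%:E * (p2 l)%:E)%E); last first.
  by rewrite esumM// => ?; rewrite lee_fin.
apply: eq_esum => k _; rewrite esum_exchange//; apply: eq_esum => l _.
pose x0 : conf J := [ffun j => ((\sum_c k (j, c))%N, (\sum_c l (j, c))%N)].
have E x : pois_conf a b x * (M1 x k * M2 x l) =
  (if k \in K1 then if [forall j, \sum_c k (j, c) == (x j).1]%N
     then \prod_p pois (a * q1 p.1 p.2) (k p) else 0 else 0) *
  (if l \in K2 then if [forall j, \sum_c l (j, c) == (x j).2]%N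
     then \prod_p pois (b * q2 p.1 p.2) (l p) else 0 else 0).
  rewrite -prod_pois_multi// -[X in _ = _ * (if _ then X else _)]prod_pois_multi//.
  rewrite /pois_conf big_split /M1 /M2/=; case: ifP => _; last by rewrite !(mul0r, mulr0).
  by case: ifP => _; [rewrite mulrACA|rewrite !(mul0r, mulr0)].
rewrite (@esum_single _ _ x0)//.
  rewrite E -EFinM; congr (_ * _)%:E; [rewrite /p1|rewrite /p2]; case: ifP => // _.
    by rewrite ifT//; apply/forallP => j; rewrite ffunE.
  by rewrite ifT//; apply/forallP => j; rewrite ffunE.
move=> x xx0; congr EFin; rewrite E.
case: ifP => _; last by rewrite mul0r.
case: ifP => [/forallP h1|_]; last by rewrite mul0r.
case: ifP => _; last by rewrite mulr0.
case: ifP => [/forallP h2|_]; last by rewrite mulr0.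
case/eqP: xx0; apply/ffunP => j; rewrite ffunE (eqP (h1 j)) (eqP (h2 j)).
by case: (x j).
Qed.

(** * Mixtures of probability spaces *)

Record mspace (R : realType) := MSpace {
  ms_d : measure_display;
  ms_T : measurableType ms_d;
  ms_P : probability ms_T R }.

(** A disjoint union, since the fibre type varies with the index; a set is measurable when all its
    fibres are. The index [d0] fixes the default point. *)
Definition mix (R : realType) (D : choiceType) (d0 : D) (F : D -> mspace R)
  : Type := {d : D & ms_T (F d)}.

Definition fiber (R : realType) (D : choiceType) (d0 : D) (F : D -> mspace R)
    (A : set (mix d0 F)) (d : D) : set (ms_T (F d)) :=
  [set u | A (existT (fun d => ms_T (F d)) d u)].
Arguments fiber [R D d0 F] A d _.

Section mix_measurable.
Context (R : realType) (D : choiceType) (d0 : D) (F : D -> mspace R).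

Definition mix_measurable : set (set (mix d0 F)) :=
  [set A | forall d, measurable (fiber A d)].

HB.instance Definition _ := gen_eqMixin (mix d0 F).
HB.instance Definition _ := gen_choiceMixin (mix d0 F).
HB.instance Definition _ := isPointed.Build (mix d0 F)
  (existT (fun d => ms_T (F d)) d0 point).

Let mix0 : mix_measurable set0.
Proof. by move=> d; exact: measurable0. Qed.

Let mixC A : mix_measurable A -> mix_measurable (~` A).
Proof. by move=> mA d; exact: (measurableC (mA d)). Qed.

Let mix_bigcup (G : (set (mix d0 F))^nat) :
  (forall i, mix_measurable (G i)) -> mix_measurable (\bigcup_i G i).
Proof.
move=> mG d; rewrite (_ : fiber _ _ = \bigcup_i (fiber (G i) d)); last first.
  by apply/seteqP; split => u [i _ Gi]; exists i.
by apply: bigcupT_measurable => i; exact: mG.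
Qed.

HB.instance Definition _ := @isMeasurable.Build default_measure_display
  (mix d0 F) mix_measurable mix0 mixC mix_bigcup.

End mix_measurable.

(** The proofs [w0] and [w1] are arguments so that the measure and probability structures can be
    attached to the term [mix_prob w0 w1]. *)
Definition mix_prob (R : realType) (D : choiceType) (d0 : D)
    (F : D -> mspace R) (w : D -> R) (w0 : forall d, 0 <= w d)
    (w1 : \esum_(d in setT) (w d)%:E = 1%E) (A : set (mix d0 F)) : \bar R :=
  \esum_(d in setT) ((w d)%:E * ms_P (F d) (fiber A d))%E.

Section mix_probability.
Context (R : realType) (D : choiceType) (d0 : D) (F : D -> mspace R)
  (w : D -> R) (w0 : forall d, 0 <= w d)
  (w1 : \esum_(d in setT) (w d)%:E = 1%E).

Let mu : set (mix d0 F) -> \bar R := mix_prob w0 w1.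

Let term_ge0 (A : set (mix d0 F)) d :
  (0 <= (w d)%:E * ms_P (F d) (fiber A d))%E.
Proof. by rewrite mule_ge0// lee_fin. Qed.

Let mu0 : mu set0 = 0%E.
Proof.
rewrite /mu /mix_prob esum1// => d _.
by rewrite (_ : fiber _ _ = set0) ?measure0 ?mule0.
Qed.

Let mu_ge0 A : (0 <= mu A)%E.
Proof. by apply: esum_ge0. Qed.

Let mu_sigma : semi_sigma_additive mu.
Proof.
move=> G mG tG mUG; apply: cvg_toP.
  apply: ereal_nondecreasing_is_cvgn => a b ab.
  by apply: lee_sum_nneg_natr => // n _ _; exact: mu_ge0.
rewrite nneseries_esumT// /mu /mix_prob esum_exchange//.
apply: eq_esum => d _.
rewrite esumZle ?lee_fin//; congr (_ * _)%E.
rewrite -nneseries_esumT// -measure_semi_bigcup.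
- by congr (ms_P _ _); apply/seteqP; split => u [i _ Gi]; exists i.
- by move=> i; exact: mG.
- by move=> i j _ _ [u [Gi Gj]]; apply: tG => //; exists (existT _ d u).
- by apply: bigcupT_measurable => i; exact: mG.
Qed.

HB.instance Definition _ := isMeasure.Build _ _ _ (mix_prob w0 w1)
  mu0 mu_ge0 mu_sigma.

Let mu1 : mu setT = 1%E.
Proof.
rewrite /mu /mix_prob -w1; apply: eq_esum => d _.
by rewrite (_ : fiber _ _ = setT) ?probability_setT ?mule1.
Qed.

HB.instance Definition _ := Measure_isProbability.Build _ _ _ (mix_prob w0 w1) mu1.

End mix_probability.

(** * Coupled point processes from coupled counts *)

Definition lab (J : finType) (n : J -> nat) : seq J :=
  flatten [seq nseq (n j) j | j <- enum J].

Lemma count_lab (J : finType) (n : J -> nat) (j : J) : count_mem j (lab n) = n j.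
Proof.
rewrite /lab count_flatten -map_comp sumnE big_map big_enum/=.
rewrite (bigD1 j)//= count_nseq/= eqxx mul1n big1 ?addn0// => i /negbTE ij.
by rewrite count_nseq/= ij.
Qed.

Lemma mem_lab (J : finType) (n : J -> nat) (j : J) :
  j \in lab n -> (0 < n j)%N.
Proof. by rewrite -has_pred1 has_count count_lab. Qed.

Lemma sum_count_mem (T : finType) (P : pred T) (s : seq T) :
  (\sum_(p | P p) count_mem p s)%N = count P s.
Proof.
elim: s => [|x s IH] /=; first by rewrite big1.
rewrite big_split/= IH; congr (_ + _)%N.
case Px : (P x); last by rewrite big1// => p Pp; case: eqP => // xp; rewrite -xp Px in Pp.
by rewrite (bigD1 x)//= eqxx big1 ?addn0// => p /andP[_ /negbTE]; rewrite eq_sym => ->.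
Qed.

Lemma card_seq_set (T : choiceType) (l : seq T) (A : set T) n : uniq l ->
  card_eq ([set u | u \in l] `&` A) `I_n <-> count (fun u => u \in A) l = n.
Proof.
move=> ul; rewrite (_ : _ `&` _ = [set` [fset u in [seq v <- l | v \in A]]%fset]).
  have cd : #|` ([fset u in [seq v <- l | v \in A]])%fset| =
      count (fun u => u \in A) l.
    by rewrite card_fseq undup_id ?filter_uniq// size_filter.
  by split => [/card_eq_fsetP|ln]; [rewrite cd|apply/card_eq_fsetP; rewrite cd].
apply/seteqP; split => u /=; rewrite !inE/= mem_filter.
  by move=> [-> Au]; rewrite andbT inE.
by move=> /andP[/[!inE] Au ul']; split.
Qed.

Lemma card_set0_II (T : Type) n : card_eq (@set0 T) `I_n <-> n = 0%N.
Proof.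
split => [|->]; last by rewrite II0 card_eq00.
by rewrite card_eq_sym card_eq0 => /eqP /IIn_eq0.
Qed.

Definition agg_set (J C : finType) n (mem : C -> 'I_n -> bool)
    (m : 'I_n -> nat) : set {ffun J * C -> nat} :=
  [set k | forall i, (\sum_(p | mem p.2 i) k p)%N = m i].

(** The probability that a Poisson process with mean measure [a] times the sum of the [U j] has
    [m i] points in the union of the classes [c] with [mem c i], for all [i] at once. *)
Definition Phi (R : realType) (J C : finType) (U : J -> probability (pt3 R) R)
    (a : R) n (cl : pt3 R -> C) (mem : C -> 'I_n -> bool) (m : 'I_n -> nat)
    : \bar R :=
  \esum_(k in @agg_set J C n mem m)
    (\prod_p pois (a * fine (U p.1 (cl @^-1` [set p.2]))) (k p))%:E.

(** Counts of overlapping sets are dependent, yet independence of processes is tested on such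
    families. The counts of a finite partition into classes are independent, and every count needed
    is a sum of these. *)
Definition classifies (R : realType) n (A : 'I_n -> set (pt3 R)) (C : finType)
    (cl : pt3 R -> C) (mem : C -> 'I_n -> bool) : Prop :=
  (forall c, measurable (cl @^-1` [set c])) /\
  (forall i u, A i u <-> mem (cl u) i).

Definition counts_are (R : realType) n (A : 'I_n -> set (pt3 R))
    (m : 'I_n -> nat) : set (seq (pt3 R)) :=
  [set l | forall i, count (fun u => u \in A i) l = m i].

Lemma prob_counts_are (R : realType) (J C : finType)
    (U : J -> probability (pt3 R) R) (L : seq J) n (A : 'I_n -> set (pt3 R))
    (m : 'I_n -> nat) (cl : pt3 R -> C) (mem : C -> 'I_n -> bool) :
  classifies A cl mem ->
  measurable [set w | counts_are A m (ps_pts (fib U L) w)] /\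
  ps_P (fib U L) [set w | counts_are A m (ps_pts (fib U L) w)] =
  \esum_(k in @agg_set J C n mem m)
    (multi (fun j c => fine (U j (cl @^-1` [set c]))) (fun j => count_mem j L) k)%:E.
Proof.
move=> [mcl clA].
have -> : [set w | counts_are A m (ps_pts (fib U L) w)] =
    (fun w => zcount cl L (ps_pts (fib U L) w)) @^-1` agg_set mem m.
  have E w i : (\sum_(p | mem p.2 i) zcount cl L (ps_pts (fib U L) w) p)%N =
      count (fun u => u \in A i) (ps_pts (fib U L) w).
    under eq_bigr => p _ do rewrite ffunE.
    rewrite sum_count_mem; have := size_fib w.
    move: (ps_pts _ w) => l; elim: L l {w} => [|j L IH] [|u l]//= [/IH ->].
    congr (_ + _)%N; congr nat_of_bool; apply/idP/idP; rewrite inE.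
      by move=> ?; apply/clA.
    by move/clA.
  by apply/seteqP; split => w /= h i; have := h i; rewrite E.
have mz k : measurable ((fun w => zcount cl L (ps_pts (fib U L) w)) @^-1` [set k]).
  by case: (@prob_zcount R J C U cl L k mcl).
have [h ->] := measure_count_preimage (ps_P (fib U L)) (agg_set mem m) mz.
split => //; apply: eq_esum => k _.
by case: (@prob_zcount R J C U cl L k mcl).
Qed.

(** One formula that carries everything: an empty second family gives the law of a single process,
    and comparison with these marginals gives independence. *)
Definition joint_law d (T : measurableType d) (R : realType)
    (P : probability T R) (J : finType) (U : J -> probability (pt3 R) R)
    (a b : R) (X Y : T -> set (pt3 R)) : Prop :=
  forall n1 (A : 'I_n1 -> set (pt3 R)) (m1 : 'I_n1 -> nat) (C1 : finType)
    (cl1 : pt3 R -> C1) (mem1 : C1 -> 'I_n1 -> bool)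
    n2 (B : 'I_n2 -> set (pt3 R)) (m2 : 'I_n2 -> nat) (C2 : finType)
    (cl2 : pt3 R -> C2) (mem2 : C2 -> 'I_n2 -> bool),
  classifies A cl1 mem1 -> classifies B cl2 mem2 ->
  P ((\bigcap_(i in [set: 'I_n1]) count_eq X (A i) (m1 i)) `&`
     (\bigcap_(j in [set: 'I_n2]) count_eq Y (B j) (m2 j))) =
  (Phi U a cl1 mem1 m1 * Phi U b cl2 mem2 m2)%E.

Section coupled_processes.
Context (R : realType) (J : finType) (U : J -> probability (pt3 R) R)
  (Q : J -> set (pt3 R)).
Hypothesis mQ : forall j, measurable (Q j).
Hypothesis UQ : forall j, U j (Q j) = 1%E.
Hypothesis U0 : forall j u, U j [set u] = 0%E.

Let D : Type := (conf J * conf J)%type.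

(** Points present in only one of the two configurations are listed first, so the smaller family of
    each sign is a suffix of the larger: positive points are added in the second configuration,
    negative points are removed. *)
Let plus_new (d : D) := lab (fun j => ((d.2 j).1 - (d.1 j).1)%N).
Let minus_new (d : D) := lab (fun j => ((d.1 j).2 - (d.2 j).2)%N).
Let Lp (d : D) : seq J := plus_new d ++ lab (fun j => (d.1 j).1).
Let Lm (d : D) : seq J := minus_new d ++ lab (fun j => (d.2 j).2).

Let Fd (d : D) : mspace R :=
  @MSpace R _ _ (ps_P (fib U (Lp d)) \x ps_P (fib U (Lm d)))%E.

Let x00 : conf J := [ffun=> (0%N, 0%N)].
Let Om := mix ((x00, x00) : (conf J * conf J)%type) Fd.

Let fib_at (A : set Om) d : set (ms_T (Fd d)) :=
  @fiber R _ (x00, x00) Fd A d.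
Arguments fib_at : clear implicits.

Context (Rel : conf J -> conf J -> Prop).
Hypothesis Rel_mono : forall x y, Rel x y ->
  (forall j, ((x j).1 <= (y j).1)%N) /\ (forall j, ((y j).2 <= (x j).2)%N).

(** Off [ok] all four processes are set to be empty. Inclusions and exclusions then hold at every
    sample point and not only almost surely. [Rel] is included because the index runs over all
    pairs, also those of weight 0. *)
Let ok (d : D) (w : ms_T (Fd d)) : Prop :=
  Rel d.1 d.2 /\ good Q w.1 /\ good Q w.2.

Let mgood d : measurable [set w : ms_T (Fd d) | good Q w.1 /\ good Q w.2].
Proof.
rewrite (_ : [set _ | _] = @good R J U Q (Lp d) `*` @good R J U Q (Lm d))//.
by apply: measurableX; [case: (prob_good (Lp d) mQ UQ U0)|case: (prob_good (Lm d) mQ UQ U0)].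
Qed.

Let Pgood d : ms_P (Fd d) [set w : ms_T (Fd d) | good Q w.1 /\ good Q w.2] = 1%E.
Proof.
rewrite (_ : [set _ | _] = @good R J U Q (Lp d) `*` @good R J U Q (Lm d))//.
have [mp Pp] := prob_good (Lp d) mQ UQ U0.
have [mm Pm] := prob_good (Lm d) mQ UQ U0.
transitivity (ps_P (fib U (Lp d)) (@good R J U Q (Lp d)) *
  ps_P (fib U (Lm d)) (@good R J U Q (Lm d)))%E; first exact: product_measure1E.
by rewrite Pp Pm mule1.
Qed.

Let proc (f : forall d, ms_T (Fd d) -> seq (pt3 R)) (w : Om) : set (pt3 R) :=
  [set u | ok (projT2 w) /\ u \in f _ (projT2 w)].

Let count_eq_proc (f : forall d, ms_T (Fd d) -> seq (pt3 R)) A n d (w : ms_T (Fd d)) :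
  (forall d (w : ms_T (Fd d)), ok w -> uniq (f d w)) ->
  ok w -> fib_at (count_eq (proc f) A n) d w <->
  count (fun u => u \in A) (f _ w) = n.
Proof.
move=> uf okw; rewrite /fib_at /fiber /count_eq/=.
rewrite (_ : proc f _ = [set u | u \in f _ w]).
  by apply: card_seq_set; exact: uf.
by apply/seteqP; split => u /=; [case|].
Qed.

(* The points of one sign read off the fibre: [fl] is a sublist of all points of
   that sign and [nn] its numbers of points per label. *)
Let law_on (L : D -> seq J) (fl : forall d, ps_T (fib U (L d)) -> seq (pt3 R))
    (nn : D -> J -> nat) : Prop :=
  (forall d (w : ps_T (fib U (L d))), good Q w -> uniq (fl d w)) /\
  forall d n (A : 'I_n -> set (pt3 R)) m (C : finType) (cl : pt3 R -> C) mem,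
    classifies A cl mem ->
    measurable [set w | counts_are A m (fl d w)] /\ (Rel d.1 d.2 ->
    ps_P (fib U (L d)) [set w | counts_are A m (fl d w)] =
    \esum_(k in @agg_set J C n mem m)
      (multi (fun j c => fine (U j (cl @^-1` [set c]))) (nn d) k)%:E).

Let small_p d (w : ps_T (fib U (Lp d))) := drop (size (plus_new d)) (ps_pts _ w).
Let big_p d (w : ps_T (fib U (Lp d))) := ps_pts _ w.
Let small_m d (w : ps_T (fib U (Lm d))) := drop (size (minus_new d)) (ps_pts _ w).
Let big_m d (w : ps_T (fib U (Lm d))) := ps_pts _ w.

Let law_small_p : law_on small_p (fun d j => (d.1 j).1).
Proof.
split; first by move=> d w /good_uniq; exact: drop_uniq.
move=> d n A m C cl mem clA.
have [mA PA] := prob_counts_are U (lab (fun j => (d.1 j).1)) m clA.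
have [mA' PA'] := prob_drop (plus_new d) mA.
split => // _; rewrite PA' PA; apply: eq_esum => k _.
by congr (multi _ _ _)%:E; apply/funext => j; rewrite count_lab.
Qed.

Let law_small_m : law_on small_m (fun d j => (d.2 j).2).
Proof.
split; first by move=> d w /good_uniq; exact: drop_uniq.
move=> d n A m C cl mem clA.
have [mA PA] := prob_counts_are U (lab (fun j => (d.2 j).2)) m clA.
have [mA' PA'] := prob_drop (minus_new d) mA.
split => // _; rewrite PA' PA; apply: eq_esum => k _.
by congr (multi _ _ _)%:E; apply/funext => j; rewrite count_lab.
Qed.

(** Only here and for [big_m] is [Rel] needed: the truncated subtraction in [plus_new] is exact
    because the counts are monotone. *)
Let law_big_p : law_on big_p (fun d j => (d.2 j).1).
Proof.
split; first by move=> d w /good_uniq.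
move=> d n A m C cl mem clA.
have [mA PA] := prob_counts_are U (Lp d) m clA.
split => // /Rel_mono[le1 _]; rewrite PA; apply: eq_esum => k _.
congr (multi _ _ _)%:E; apply/funext => j.
by rewrite count_cat !count_lab subnK.
Qed.

Let law_big_m : law_on big_m (fun d j => (d.1 j).2).
Proof.
split; first by move=> d w /good_uniq.
move=> d n A m C cl mem clA.
have [mA PA] := prob_counts_are U (Lm d) m clA.
split => // /Rel_mono[_ le2]; rewrite PA; apply: eq_esum => k _.
congr (multi _ _ _)%:E; apply/funext => j.
by rewrite count_cat !count_lab subnK.
Qed.

Let proc_p (fl : forall d, ps_T (fib U (Lp d)) -> seq (pt3 R)) :=
  proc (fun d w => fl d w.1).
Let proc_m (fl : forall d, ps_T (fib U (Lm d)) -> seq (pt3 R)) :=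
  proc (fun d w => fl d w.2).

Let measurable_proc (f : forall d, ms_T (Fd d) -> seq (pt3 R)) :
  (forall d w, ok w -> uniq (f d w)) ->
  (forall d A n, measurable A ->
     measurable [set w | count (fun u => u \in A) (f d w) = n]) ->
  forall A n, measurable A -> measurable (count_eq (proc f) A n).
Proof.
move=> uf mf A n mA.
suff : forall d, measurable (fib_at (count_eq (proc f) A n) d) by [].
move=> d.
(* Where [ok] fails the process is empty, so the event holds exactly when [n = 0]. *)
have [Rd|Rd] := pselect (Rel d.1 d.2); last first.
  have -> : fib_at (count_eq (proc f) A n) d = [set w | n = 0%N].
    apply/seteqP; split => w; rewrite /fib_at /fiber /count_eq/=.
      rewrite (_ : proc f _ = set0).
        by rewrite set0I => /card_set0_II.
      by apply/seteqP; split => u //= -[[/Rd]].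
    move=> n0; rewrite (_ : proc f _ = set0) ?set0I; first exact/card_set0_II.
    by apply/seteqP; split => u //= -[[/Rd]].
  have [n0|n0] := pselect (n = 0%N).
    by rewrite (_ : [set _ | _] = setT)//; apply/seteqP; split.
  by rewrite (_ : [set _ | _] = set0)//; apply/seteqP; split.
have -> : fib_at (count_eq (proc f) A n) d =
    ([set w | good Q w.1 /\ good Q w.2] `&`
      [set w | count (fun u => u \in A) (f d w) = n]) `|`
    (~` [set w | good Q w.1 /\ good Q w.2] `&` [set w | n = 0%N]).
  apply/seteqP; split => w.
    have [gw|gw] := pselect (good Q w.1 /\ good Q w.2).
      have okw : ok w by split.
      by move=> /(count_eq_proc _ _ uf okw); left.
    rewrite /fib_at /fiber /count_eq/= (_ : proc f _ = set0).
      by rewrite set0I => /card_set0_II; right.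
    by apply/seteqP; split => u //= -[[_ /gw]].
  case=> [[gw cw]|[gw n0]].
    have okw : ok w by split.
    exact/(count_eq_proc _ _ uf okw).
  rewrite /fib_at /fiber /count_eq/= (_ : proc f _ = set0) ?set0I.
    exact/card_set0_II.
  by apply/seteqP; split => u //= -[[_ /gw]].
apply: measurableU; apply: measurableI => //; first exact: mf.
  exact: measurableC.
have [n0|n0] := pselect (n = 0%N).
  by rewrite (_ : [set _ | _] = setT)//; apply/seteqP; split.
by rewrite (_ : [set _ | _] = set0)//; apply/seteqP; split.
Qed.

Let single_classifies (A : set (pt3 R)) : measurable A ->
  classifies (fun _ : 'I_1 => A) (fun u => u \in A) (fun c _ => c).
Proof.
move=> mA; split; last by move=> i u; split; rewrite inE.
case.
  rewrite (_ : _ @^-1` _ = A)//.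
  by apply/seteqP; split => u /= h; [exact: set_mem|exact: mem_set].
rewrite (_ : _ @^-1` _ = ~` A); first exact: measurableC.
apply/seteqP; split => u /=; first by move/negbT; rewrite notin_setE.
by move=> nA; apply/negbTE; rewrite notin_setE.
Qed.

Let measurable_proc_p fl nn : law_on fl nn ->
  forall A n, measurable A -> measurable (count_eq (proc_p fl) A n).
Proof.
move=> [ufl lfl]; apply: measurable_proc; first by move=> d w [_ [gw _]]; exact: ufl.
move=> d A n mA.
have [mw _] := lfl d _ _ (fun=> n) _ _ _ (single_classifies mA).
rewrite (_ : [set _ | _] = [set w | counts_are (fun _ : 'I_1 => A) (fun=> n) (fl d w)] `*` setT).
  exact: measurableX.
by apply/seteqP; split => w /=; [move=> h; split|move=> [h _]; exact: (h ord0)].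
Qed.

Let measurable_proc_m fl nn : law_on fl nn ->
  forall A n, measurable A -> measurable (count_eq (proc_m fl) A n).
Proof.
move=> [ufl lfl]; apply: measurable_proc; first by move=> d w [_ [_ gw]]; exact: ufl.
move=> d A n mA.
have [mw _] := lfl d _ _ (fun=> n) _ _ _ (single_classifies mA).
rewrite (_ : [set _ | _] = setT `*` [set w | counts_are (fun _ : 'I_1 => A) (fun=> n) (fl d w)]).
  exact: measurableX.
by apply/seteqP; split => w /=; [move=> h; split|move=> [_ h]; exact: (h ord0)].
Qed.

Let classifies_measurable n (A : 'I_n -> set (pt3 R)) (C : finType) cl mem :
  @classifies R n A C cl mem -> forall i, measurable (A i).
Proof.
move=> [mcl clA] i.
rewrite (_ : A i = \bigcup_(c in [set c | mem c i]) cl @^-1` [set c]).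
  by apply: fin_bigcup_measurable => //; exact: finite_finset.
apply/seteqP; split => u; first by move/clA => h; exists (cl u).
by move=> [c /= h uc]; apply/clA; rewrite uc.
Qed.

(** Within a fibre the signs occupy different factors of a product, and up to the null event outside
    [good] the event is a rectangle. *)
Let fiber_prob fp np fm nm d n1 (A : 'I_n1 -> set (pt3 R)) m1 (C1 : finType) cl1 mem1
    n2 (B : 'I_n2 -> set (pt3 R)) m2 (C2 : finType) cl2 mem2 :
  law_on fp np -> law_on fm nm -> Rel d.1 d.2 ->
  @classifies R n1 A C1 cl1 mem1 -> @classifies R n2 B C2 cl2 mem2 ->
  ms_P (Fd d) (fib_at ((\bigcap_(i in [set: 'I_n1]) count_eq (proc_p fp) (A i) (m1 i)) `&`
     (\bigcap_(j in [set: 'I_n2]) count_eq (proc_m fm) (B j) (m2 j))) d) =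
  ((\esum_(k in @agg_set J C1 n1 mem1 m1)
      (multi (fun j c => fine (U j (cl1 @^-1` [set c]))) (np d) k)%:E) *
   \esum_(k in @agg_set J C2 n2 mem2 m2)
      (multi (fun j c => fine (U j (cl2 @^-1` [set c]))) (nm d) k)%:E)%E.
Proof.
move=> lp lm Rd clA clB.
have [mA PA] := lp.2 d _ _ m1 _ _ _ clA.
have [mB PB] := lm.2 d _ _ m2 _ _ _ clB.
rewrite -(PA Rd) -(PB Rd).
transitivity (ms_P (Fd d) ([set w | counts_are A m1 (fp d w)] `*`
  [set w | counts_are B m2 (fm d w)])); last exact: product_measure1E.
apply: (@probability_congr _ (ms_T (Fd d)) R (ms_P (Fd d)) _ _
  [set w : ms_T (Fd d) | good Q w.1 /\ good Q w.2]);
  [| |exact: mgood|exact: Pgood|].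
- rewrite (_ : fib_at _ d = (\bigcap_(i in [set: 'I_n1]) fib_at (count_eq (proc_p fp) (A i) (m1 i)) d) `&`
     (\bigcap_(j in [set: 'I_n2]) fib_at (count_eq (proc_m fm) (B j) (m2 j)) d))//.
  apply: measurableI; apply: fin_bigcap_measurable; try exact: finite_finset.
    by move=> i _; apply: (measurable_proc_p lp); exact: (classifies_measurable clA).
  by move=> i _; apply: (measurable_proc_m lm); exact: (classifies_measurable clB).
- exact: measurableX.
move=> w gw; have okw : ok w by split.
have up e (v : ms_T (Fd e)) : ok v -> uniq (fp e v.1) by move=> [_ [? _]]; exact: lp.1.
have um e (v : ms_T (Fd e)) : ok v -> uniq (fm e v.2) by move=> [_ [_ ?]]; exact: lm.1.
split.
  move=> [hA hB]; split => i.
    exact: (count_eq_proc (A i) (m1 i) up okw).1 (hA i I).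
  exact: (count_eq_proc (B i) (m2 i) um okw).1 (hB i I).
move=> [hA hB]; split => i _.
  exact: (count_eq_proc (A i) (m1 i) up okw).2 (hA i).
exact: (count_eq_proc (B i) (m2 i) um okw).2 (hB i).
Qed.

Let class_prob_sum (C : finType) (cl : pt3 R -> C) j :
  (forall c, measurable (cl @^-1` [set c])) ->
  \sum_c fine (U j (cl @^-1` [set c])) = 1.
Proof.
move=> mcl; apply: EFin_inj; rewrite -sumEFin.
under eq_bigr => c _ do rewrite fineK ?fin_num_measure//.
rewrite -measure_finpartition//; last by move=> c c' _ _ [u [/= <- <-]].
rewrite -(probability_setT (U j)); congr (U j _).
by apply/seteqP; split => // u _; exists (cl u).
Qed.

(** The mixture is taken with the coupling mass [g] as weights. For the last claim, a label
    occurring in the list of a point witnesses that the count of its box is nonzero. *)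
Lemma exists_coupled_processes (a b a' b' : R) :
  0 <= a -> 0 <= b -> 0 <= a' -> 0 <= b' ->
  coupled (@pois_conf R J a b) (@pois_conf R J a' b') Rel ->
  exists C : coupling R,
  [/\ joint_law (c_P C) U a b (c_P1p C) (c_P1m C),
      joint_law (c_P C) U a' b' (c_P2p C) (c_P2m C),
      forall X A n, (X = c_P1p C \/ X = c_P1m C) \/ (X = c_P2p C \/ X = c_P2m C) ->
        measurable A -> measurable (count_eq X A n),
      forall w, [/\ c_P1p C w `<=` c_P2p C w, c_P2m C w `<=` c_P1m C w,
        c_P2p C w `<=` \bigcup_j Q j & c_P1m C w `<=` \bigcup_j Q j] &
      forall w u v, c_P1p C w u -> c_P2m C w v -> exists x y i j,
        [/\ Rel x y, Q i u, Q j v, (0 < (x i).1)%N & (0 < (y j).2)%N] ].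
Proof.
move=> a0 b0 a'0 b'0 [g [g0 gp gq gR]].
have w1 : \esum_(d in [set: conf J * conf J]) (g d.1 d.2)%:E = 1%E.
  rewrite esum_pair => [|d]; last by rewrite lee_fin.
  under eq_esum => x _ do rewrite gp.
  rewrite /pois_conf (@esum_ffun_prod _ _ _
    (fun _ t => pois a t.1 * pois b t.2) (fun=> 1)) ?big1//.
    by move=> _ t; rewrite mulr_ge0 ?pois_ge0.
  move=> _; rewrite esum_pair => [|t]; last by rewrite lee_fin mulr_ge0 ?pois_ge0.
  transitivity (\esum_(i in setT) \esum_(j in setT) ((pois a i)%:E * (pois b j)%:E)%E).
    by [].
  by rewrite esumM ?esum_pois ?mule1// => i; rewrite lee_fin pois_ge0.
have w0 (d : conf J * conf J) : 0 <= g d.1 d.2 by [].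
pose P : probability (mix (x00, x00) Fd) R := mix_prob w0 w1.
have esum0 (C : finType) n (cl : pt3 R -> C) (mem : C -> 'I_n -> bool) m nn :
  (0 <= \esum_(k in @agg_set J C n mem m)
    (multi (fun j c => fine (U j (cl @^-1` [set c]))) nn k)%:E)%E.
  apply: esum_EFin_ge0 => k; apply: prodr_ge0 => j _.
  rewrite /multi_term; case: ifP => // _; rewrite mulr_ge0//.
  by apply: prodr_ge0 => c _; rewrite divr_ge0 ?exprn_ge0 ?fine_ge0.
exists (@Coupling R _ (mix (x00, x00) Fd) P (proc_p small_p) (proc_m big_m)
  (proc_p big_p) (proc_m small_m)); split => /=.
- move=> n1 A m1 C1 cl1 mem1 n2 B m2 C2 cl2 mem2 clA clB.
  rewrite /P/= /mix_prob /Phi -[RHS](@mixture_pois_multi R J C1 C2 a b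
    (fun j c => fine (U j (cl1 @^-1` [set c])))
    (fun j c => fine (U j (cl2 @^-1` [set c]))))//; first last.
  + by move=> j; apply: class_prob_sum; exact: clB.1.
  + by move=> j; apply: class_prob_sum; exact: clA.1.
  + by move=> j c; rewrite fine_ge0.
  + by move=> j c; rewrite fine_ge0.
  rewrite esum_pair; last by move=> d; rewrite mule_ge0// lee_fin.
  (* In the fibre over [(x, y)] the law of the first configuration depends on [x] alone, so summing
     the weights over [y] leaves the marginal mass of [x]. *)
  apply: eq_esum => x _; rewrite muleC -gp -esumZle; first last.
  + by move=> y; rewrite lee_fin.
  + by rewrite mule_ge0.
  apply: eq_esum => y _; have [->|gxy] := eqVneq (g x y) 0.
    by rewrite mul0e mule0.
  rewrite [RHS]muleC; congr (_ * _)%E.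
  exact: (fiber_prob (d := (x, y)) m1 m2 law_small_p law_big_m (gR _ _ gxy) clA clB).
- move=> n1 A m1 C1 cl1 mem1 n2 B m2 C2 cl2 mem2 clA clB.
  rewrite /P/= /mix_prob /Phi -[RHS](@mixture_pois_multi R J C1 C2 a' b'
    (fun j c => fine (U j (cl1 @^-1` [set c])))
    (fun j c => fine (U j (cl2 @^-1` [set c]))))//; first last.
  + by move=> j; apply: class_prob_sum; exact: clB.1.
  + by move=> j; apply: class_prob_sum; exact: clA.1.
  + by move=> j c; rewrite fine_ge0.
  + by move=> j c; rewrite fine_ge0.
  rewrite esum_pair; last by move=> d; rewrite mule_ge0// lee_fin.
  rewrite esum_exchange; last by move=> x y; rewrite mule_ge0// lee_fin.
  apply: eq_esum => y _; rewrite muleC -gq -esumZle; first last.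
  + by move=> x; rewrite lee_fin.
  + by rewrite mule_ge0.
  apply: eq_esum => x _; have [->|gxy] := eqVneq (g x y) 0.
    by rewrite mul0e mule0.
  rewrite [RHS]muleC; congr (_ * _)%E.
  exact: (fiber_prob (d := (x, y)) m1 m2 law_big_p law_small_m (gR _ _ gxy) clA clB).
- move=> X A n [[->|->]|[->|->]] mA.
  + exact: (measurable_proc_p law_small_p).
  + exact: (measurable_proc_m law_big_m).
  + exact: (measurable_proc_p law_big_p).
  + exact: (measurable_proc_m law_small_m).
- move=> w; split.
  + by move=> u [okw /mem_drop].
  + by move=> u [okw /mem_drop].
  + move=> u [[_ [gw _]]]; rewrite -[big_p _]drop0 => /(good_label gw)[j _ Qj].
    by exists j.
  + move=> u [[_ [_ gw]]]; rewrite -[big_m _]drop0 => /(good_label gw)[j _ Qj].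
    by exists j.
- move=> w u v [[Rw [gp' gm]] uw] [_ vw].
  have [i + Qi] := good_label gp' uw.
  rewrite drop_size_cat// => /mem_lab xi.
  have [j + Qj] := good_label gm vw.
  rewrite drop_size_cat// => /mem_lab yj.
  by exists (projT1 w).1, (projT1 w).2, i, j; split.
Qed.

End coupled_processes.

(** * Poisson law and independence from the joint formula *)

Lemma Phi_ord0 (R : realType) (J C : finType) (U : J -> probability (pt3 R) R)
    (a : R) (cl : pt3 R -> C) (mem : C -> 'I_0 -> bool) m : 0 <= a ->
  Phi U a cl mem m = 1%E.
Proof.
move=> a0; rewrite /Phi.
have := @pois_merge R (J * C)%type 0 (fun=> None)
  (fun p => a * fine (U p.1 (cl @^-1` [set p.2]))) m.
rewrite big_ord0 => <-; last by move=> p; rewrite mulr_ge0 ?fine_ge0.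
congr esum.
by apply/seteqP; split => k _ -[].
Qed.

Lemma joint_law_sym d (T : measurableType d) (R : realType)
    (P : probability T R) (J : finType) (U : J -> probability (pt3 R) R)
    (a b : R) (X Y : T -> set (pt3 R)) :
  joint_law P U a b X Y -> joint_law P U b a Y X.
Proof.
move=> h n1 A m1 C1 cl1 mem1 n2 B m2 C2 cl2 mem2 clA clB.
by rewrite setIC muleC; exact: h.
Qed.

Lemma joint_law_marginal d (T : measurableType d) (R : realType)
    (P : probability T R) (J : finType) (U : J -> probability (pt3 R) R)
    (a b : R) (X Y : T -> set (pt3 R)) n (A : 'I_n -> set (pt3 R))
    (m : 'I_n -> nat) (C : finType) (cl : pt3 R -> C) (mem : C -> 'I_n -> bool) :
  0 <= b -> joint_law P U a b X Y -> classifies A cl mem ->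
  P (\bigcap_(i in [set: 'I_n]) count_eq X (A i) (m i)) = Phi U a cl mem m.
Proof.
move=> b0 h clA.
(* The empty family, with a single class, imposes no condition on the second process. *)
have c0 : @classifies R 0 (fun=> set0) unit (fun=> tt) (fun _ _ => false).
  split; last by case.
  by case; rewrite (_ : _ @^-1` _ = setT)//; apply/seteqP; split.
have := h _ _ m _ _ _ _ _ (fun=> 0%N) _ _ _ clA c0.
rewrite Phi_ord0// mule1 => <-; congr (P _).
by apply/seteqP; split => w; [move=> hw; split => // -[]|case].
Qed.

(** The classes are the membership patterns of a point, that is, the atoms of the algebra generated
    by the given sets. *)
Lemma joint_law_indep d (T : measurableType d) (R : realType)
    (P : probability T R) (J : finType) (U : J -> probability (pt3 R) R)
    (a b : R) (X Y : T -> set (pt3 R)) :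
  0 <= a -> 0 <= b -> joint_law P U a b X Y -> indep_pp P X Y.
Proof.
move=> a0 b0 h n1 A m1 n2 B m2 mA mB EA EB.
have clsf n (F : 'I_n -> set (pt3 R)) : (forall i, measurable (F i)) ->
    classifies F (fun u => [ffun i => u \in F i]) (fun c i => c i).
  move=> mF; split; last by move=> i u; rewrite ffunE; split; rewrite inE.
  move=> c; rewrite (_ : _ @^-1` _ =
      \bigcap_(i in [set: 'I_n]) (if c i then F i else ~` F i)).
    apply: fin_bigcap_measurable; first exact: finite_finset.
    by move=> i _; case: ifP => // _; exact: measurableC.
  apply/seteqP; split => u /=.
    move=> <- i _; rewrite ffunE; case: ifPn; rewrite ?inE//.
    by rewrite notin_setE.
  move=> hu; apply/ffunP => i; rewrite ffunE; have := hu i I.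
  case: (c i) => [Fu|nFu]; first exact: mem_set.
  by apply/negbTE; rewrite notin_setE.
rewrite /EA /EB (h _ _ _ _ _ _ _ _ _ _ _ _ (clsf _ _ mA) (clsf _ _ mB)).
rewrite (joint_law_marginal _ b0 h (clsf _ _ mA)).
by rewrite (joint_law_marginal _ a0 (joint_law_sym h) (clsf _ _ mB)).
Qed.

(** For disjoint sets the classes are the sets themselves, and [None] for the complement of their
    union; [pois_merge] then adds up the boxes. *)
Lemma joint_law_pois d (T : measurableType d) (R : realType)
    (P : probability T R) (J : finType) (U : J -> probability (pt3 R) R)
    (a b : R) (X Y : T -> set (pt3 R)) n (A : 'I_n -> set (pt3 R))
    (m : 'I_n -> nat) :
  0 <= a -> 0 <= b -> joint_law P U a b X Y ->
  (forall i, measurable (A i)) -> (forall i j, i != j -> A i `&` A j = set0) ->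
  P (\bigcap_(i in [set: 'I_n]) count_eq X (A i) (m i)) =
  (\prod_i pois (a * \sum_j fine (U j (A i))) (m i))%:E.
Proof.
move=> a0 b0 h mA dA.
pose cl u : option 'I_n := [pick i | u \in A i].
have clE i u : A i u <-> cl u = Some i.
  rewrite /cl; case: pickP => [j uj|nu]; last first.
    by split => // Au; have := nu i; rewrite mem_set.
  split => [Au|[<-]]; last by rewrite inE in uj.
  have [->//|/dA ji] := eqVneq j i.
  have : (A j `&` A i) u by split => //; rewrite inE in uj.
  by rewrite ji.
have preS i : cl @^-1` [set Some i] = A i.
  by apply/seteqP; split => u /= /clE.
have clA : classifies A cl (fun c i => c == Some i).
  split; last by move=> i u; rewrite clE; split => /eqP.
  case=> [i|]; first by rewrite preS.
  rewrite (_ : _ @^-1` _ = ~` (\bigcup_(i in [set: 'I_n]) A i)).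
    by apply: measurableC; apply: fin_bigcup_measurable => //; exact: finite_finset.
  apply/seteqP; split => u /=; first by move=> uN [i _ /clE]; rewrite uN.
  move=> uN; case clu : (cl u) => [i|//].
  by case: uN; exists i => //; apply/clE.
rewrite (joint_law_marginal _ b0 h clA) /Phi.
rewrite (@pois_merge R (J * option 'I_n)%type n (fun p => p.2)
  (fun p => a * fine (U p.1 (cl @^-1` [set p.2]))) m); last first.
  by move=> p; rewrite mulr_ge0 ?fine_ge0.
congr EFin; apply: eq_bigr => i _; congr (pois _ _).
rewrite -mulr_sumr; congr (_ * _).
rewrite -(pair_big_dep xpredT (fun _ c => c == Some i)
  (fun j c => fine (U j (cl @^-1` [set c]))))/=.
by apply: eq_bigr => j _; rewrite big_pred1_eq preS.
Qed.

(** * Lebesgue measure on boxes *)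

(* [leb3] lives on a product of copies of [R] carrying another measure display;
   the two sigma-algebras are convertible. *)
Definition L3 (R : realType) : set (pt3 R) -> \bar R := leb3.

Section L3_measure.
Context (R : realType).
Let M := ((@lebesgue_measure R \x @lebesgue_measure R) \x @lebesgue_measure R)%E.

Let L3_0 : @L3 R set0 = 0%E. Proof. exact: (measure0 M). Qed.

Let L3_ge0 A : (0 <= @L3 R A)%E. Proof. exact: (measure_ge0 M). Qed.

Let L3_sigma : semi_sigma_additive (@L3 R).
Proof. exact: (@measure_semi_sigma_additive _ _ _ M). Qed.

HB.instance Definition _ := isMeasure.Build _ (pt3 R) R (@L3 R) L3_0 L3_ge0 L3_sigma.
End L3_measure.

Definition box (R : realType) (x1 x2 y1 y2 t1 t2 : R) : set (pt3 R) :=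
  [set v | [/\ x1 <= v.1.1 < x2, y1 <= v.1.2 < y2 & t1 <= v.2 < t2]].

Lemma boxE (R : realType) (x1 x2 y1 y2 t1 t2 : R) :
  box x1 x2 y1 y2 t1 t2 = (`[x1, x2[%classic `*` `[y1, y2[%classic) `*` `[t1, t2[%classic.
Proof.
by apply/seteqP; split => -[[x y] t] /=; rewrite !in_itv/=; [case|case => -[]].
Qed.

Lemma measurable_box (R : realType) (x1 x2 y1 y2 t1 t2 : R) :
  measurable (box x1 x2 y1 y2 t1 t2).
Proof. by rewrite boxE; apply: measurableX => //; apply: measurableX. Qed.

Lemma L3_box (R : realType) (x1 x2 y1 y2 t1 t2 : R) :
  x1 < x2 -> y1 < y2 -> t1 < t2 ->
  L3 (box x1 x2 y1 y2 t1 t2) = ((x2 - x1) * (y2 - y1) * (t2 - t1))%:E.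
Proof.
move=> hx hy ht; rewrite boxE.
have li (u v : R) : u < v -> lebesgue_measure (`[u, v[ : set R) = (v - u)%:E.
  by move=> uv; rewrite lebesgue_measure_itv/= lte_fin uv EFinB.
transitivity ((@lebesgue_measure R \x @lebesgue_measure R)%E
   (`[x1, x2[%classic `*` `[y1, y2[%classic) * lebesgue_measure (`[t1, t2[ : set R))%E.
  by apply: product_measure1E => //; apply: measurableX.
rewrite (li _ _ ht) EFinM; congr (_ * _)%E.
transitivity (lebesgue_measure (`[x1, x2[ : set R) * lebesgue_measure (`[y1, y2[ : set R))%E.
  by apply: product_measure1E.
by rewrite (li _ _ hx) (li _ _ hy).
Qed.

Lemma lebesgue_measure_scale (R : realType) (c : R) (A : set R) : 0 < c ->
  measurable A ->
  lebesgue_measure ((fun t => t / c) @^-1` A) = (c%:E * lebesgue_measure A)%E.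
Proof.
move=> c0 mA.
have mf : measurable_fun setT (fun t : R => t / c).
  by apply: measurable_funM => //; exact: measurable_cst.
have ci0 : 0 <= c^-1 by rewrite invr_ge0 ltW.
have mf' : @measurable_fun _ _ (measurableTypeR R) (measurableTypeR R) setT
  (fun t : R => t / c) by exact: mf.
pose f : measurableTypeR R -> measurableTypeR R := fun t : R => t / c.
(* The image of Lebesgue measure under division by [c], multiplied by [c^-1], has the right values
   on half-open intervals; uniqueness does the rest. *)
pose nu_of : {measure set (measurableTypeR R) -> \bar R} :=
  mscale (NngNum ci0) (pushforward (@lebesgue_measure R) f).
pose nu := nu_of mf'.
have nuE (X : set R) : nu X = (c^-1%:E * lebesgue_measure ((fun t => t / c)%R @^-1` X))%E by [].
have H : lebesgue_measure A = nu A.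
  apply: lebesgue_measure_unique => // X [[u v] _ <-]; rewrite nuE.
  rewrite (_ : _ @^-1` _ = `]u * c, v * c]%classic); last first.
    by apply/seteqP; split => t /=; rewrite !in_itv/= ltr_pdivlMr// ler_pdivrMr.
  rewrite !lebesgue_measure_itv/= !lte_fin ltr_pM2r//; case: ifP => _; last first.
    by rewrite mule0.
  by rewrite -!EFinB -EFinM -mulrBl mulrC mulfK// gt_eqF.
by rewrite H nuE muleA -EFinM divff ?gt_eqF// mul1e.
Qed.

Definition tscale (R : realType) (c : R) (v : pt3 R) : pt3 R := (v.1, v.2 / c).

Lemma measurable_tscale (R : realType) (c : R) :
  measurable_fun setT (@tscale R c).
Proof.
apply: measurable_fun_pair; first exact: measurable_fst.
by apply: measurable_funM; [exact: measurable_snd|exact: measurable_cst].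
Qed.

Lemma L3_tscale (R : realType) (c : R) (A : set (pt3 R)) : 0 < c ->
  measurable A -> L3 (tscale c @^-1` A) = (c%:E * L3 A)%E.
Proof.
move=> c0 mA.
have E (B : set (pt3 R)) : L3 B =
  (\int[(@lebesgue_measure R \x @lebesgue_measure R)]_z
     ((@lebesgue_measure R \o xsection (B : set (measurableTypeR R *
        measurableTypeR R * measurableTypeR R))) z))%E by [].
rewrite !E -ge0_integralZl//; first last.
- by rewrite lee_fin ltW.
- exact: measurable_fun_xsection.
apply: eq_integral => z _.
by rewrite [RHS]/= -lebesgue_measure_scale//; exact: measurable_xsection.
Qed.

Lemma L3_set1 (R : realType) (u : pt3 R) : L3 [set u] = 0%E.
Proof.
rewrite (_ : [set u] = [set u.1] `*` [set u.2]); last first.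
  by apply/seteqP; split => -[a b] /=; case: u => c d /= [-> ->].
have m1 : measurable [set u.1].
  rewrite (_ : [set u.1] = [set u.1.1] `*` [set u.1.2]); last first.
    by apply/seteqP; split => -[a b] /=; case: u => [[c d] e] /= [-> ->].
  by apply: measurableX.
transitivity ((@lebesgue_measure R \x @lebesgue_measure R)%E [set u.1] *
  lebesgue_measure ([set u.2] : set R))%E; first exact: product_measure1E.
by rewrite lebesgue_measure_set1 mule0.
Qed.

(** * The coupled Poisson processes *)

Lemma mnormalize_fin d (T : measurableType d) (R : realType)
    (mu : {measure set T -> \bar R}) (P : probability T R) (v : R) (A : set T) :
  0 < v -> mu setT = v%:E -> mnormalize mu P A = (mu A * (v^-1)%:E)%E.
Proof. by move=> v0 E; rewrite /mnormalize E eqe gt_eqF. Qed.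

(** The Dirac mass is the default value [mnormalize] asks for when the total mass is 0 or
    infinite. *)
Definition unif (R : realType) (Q : set (pt3 R)) (mQ : measurable Q)
  : probability (pt3 R) R :=
  mnormalize (mrestr (@L3 R) mQ) (dirac point : probability (pt3 R) R).

Lemma unifE (R : realType) (Q : set (pt3 R)) (mQ : measurable Q) (v : R) A :
  0 < v -> L3 Q = v%:E -> unif mQ A = (L3 (A `&` Q) * (v^-1)%:E)%E.
Proof.
move=> v0 Qv.
have E : mrestr (@L3 R) mQ setT = v%:E by rewrite /mrestr setTI.
exact: mnormalize_fin v0 E.
Qed.

(** * Boxes, their uniform laws and their neighbours on the torus *)

Definition cell (R : realType) (M K : nat) (rho tau : R) (j : 'I_M * 'I_M * 'I_K)
  : set (pt3 R) :=
  box (j.1.1%:R * rho) (j.1.1.+1%:R * rho) (j.1.2%:R * rho) (j.1.2.+1%:R * rho)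
      (j.2%:R * tau) (j.2.+1%:R * tau).

Lemma floor_cell (R : realType) (M : nat) (rho x : R) : 0 < rho ->
  0 <= x < M%:R * rho -> exists i : 'I_M, i%:R * rho <= x < i.+1%:R * rho.
Proof.
move=> r0 /andP[x0 xM].
have q0 : 0 <= x / rho by rewrite divr_ge0// ltW.
have /andP[h1 h2] := truncn_itv q0.
have iM : (Num.trunc (x / rho) < M)%N.
  rewrite -(ltr_nat R); apply: le_lt_trans h1 _.
  by rewrite ltr_pdivrMr.
exists (Ordinal iM) => /=.
by rewrite -ler_pdivlMr// h1/= -ltr_pdivrMr.
Qed.

Lemma cell_index_uniq (R : realType) (rho x : R) (i j : nat) : 0 < rho ->
  i%:R * rho <= x < i.+1%:R * rho -> j%:R * rho <= x < j.+1%:R * rho -> i = j.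
Proof.
move=> r0 /andP[i1 i2] /andP[j1 j2].
have := le_lt_trans i1 j2; rewrite ltr_pM2r// ltr_nat ltnS => ij.
have := le_lt_trans j1 i2; rewrite ltr_pM2r// ltr_nat ltnS => ji.
by apply/eqP; rewrite eqn_leq ij ji.
Qed.

Lemma bigcup_cell (R : realType) (M K : nat) (rho tau : R) :
  0 < rho -> 0 < tau ->
  \bigcup_j @cell R M K rho tau j =
  box 0 (M%:R * rho) 0 (M%:R * rho) 0 (K%:R * tau).
Proof.
move=> r0 t0; apply/seteqP; split => u.
  have le0 (i : nat) (c x : R) : 0 < c -> i%:R * c <= x -> 0 <= x.
    by move=> c0; apply: le_trans; rewrite mulr_ge0// ltW.
  have lt0 n (i : 'I_n) (c x : R) : 0 < c -> x < i.+1%:R * c -> x < n%:R * c.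
    by move=> c0 xi; apply: lt_le_trans xi _; rewrite ler_pM2r// ler_nat ltn_ord.
  move=> [[[i1 i2] k] _ [/= /andP[a1 a2] /andP[b1 b2] /andP[c1 c2]]].
  by split; apply/andP; split; (exact: le0 a1 || exact: lt0 a2 || exact: le0 b1
    || exact: lt0 b2 || exact: le0 c1 || exact: lt0 c2).
move=> [hx hy ht].
have [i1 h1] := floor_cell r0 hx.
have [i2 h2] := floor_cell r0 hy.
have [k h3] := floor_cell t0 ht.
by exists (i1, i2, k).
Qed.

Lemma trivIset_cell (R : realType) (M K : nat) (rho tau : R) :
  0 < rho -> 0 < tau -> trivIset setT (@cell R M K rho tau).
Proof.
move=> r0 t0 [[i1 i2] k] [[j1 j2] l] _ _ [u [[/= a b c] [/= a' b' c']]].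
by congr (_, _, _); apply: val_inj; [exact: (cell_index_uniq r0 a a')
  |exact: (cell_index_uniq r0 b b')|exact: (cell_index_uniq t0 c c')].
Qed.

Lemma L3_cell (R : realType) (M K : nat) (rho tau : R) j :
  0 < rho -> 0 < tau -> L3 (@cell R M K rho tau j) = (rho * rho * tau)%:E.
Proof.
move=> r0 t0; have S (n : nat) (c : R) : n.+1%:R * c - n%:R * c = c.
  by rewrite -mulrBl -natrB// subSnn mul1r.
by rewrite L3_box ?S// ltr_pM2r// ltr_nat.
Qed.

(** Cyclic horizontal translations only: exclusion is wanted just for the bottom layer, so the
    height index is kept. *)
Definition shifts (M K : nat) :
    seq ('I_M * 'I_M * 'I_K -> 'I_M * 'I_M * 'I_K) :=
  [seq (fun j => (f.1 j.1.1, f.2 j.1.2, j.2)) |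
     f <- [:: (id, id); (id, @ordS M); (id, @ord_pred M);
              (@ordS M, id); (@ordS M, @ordS M); (@ordS M, @ord_pred M);
              (@ord_pred M, id); (@ord_pred M, @ordS M); (@ord_pred M, @ord_pred M)]].

Lemma shifts_bij (M K : nat) i : (i < size (shifts M K))%N ->
  bijective (nth id (shifts M K) i).
Proof.
have bS : bijective (@ordS M) by exists (@ord_pred M); [exact: ordSK|exact: ord_predK].
have bP : bijective (@ord_pred M) by exists (@ordS M); [exact: ord_predK|exact: ordSK].
have bI : bijective (@id 'I_M) by exists id.
have B (f g : 'I_M -> 'I_M) : bijective f -> bijective g ->
    bijective (fun j : 'I_M * 'I_M * 'I_K => (f j.1.1, g j.1.2, j.2)).
  move=> [f' f1 f2] [g' g1 g2].
  exists (fun j : 'I_M * 'I_M * 'I_K => (f' j.1.1, g' j.1.2, j.2)).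
    by move=> [[a b] c] /=; rewrite f1 g1.
  by move=> [[a b] c] /=; rewrite f2 g2.
case: i => [_|i]; first exact: (B _ _ bI bI).
case: i => [_|i]; first exact: (B _ _ bI bS).
case: i => [_|i]; first exact: (B _ _ bI bP).
case: i => [_|i]; first exact: (B _ _ bS bI).
case: i => [_|i]; first exact: (B _ _ bS bS).
case: i => [_|i]; first exact: (B _ _ bS bP).
case: i => [_|i]; first exact: (B _ _ bP bI).
case: i => [_|i]; first exact: (B _ _ bP bS).
case: i => [_|i]; first exact: (B _ _ bP bP).
by [].
Qed.

(** The box indices satisfy [|a - b + k * M| <= 1], which forces [k] to be -1, 0 or 1; the values 1
    and -1 are the two ways of crossing the seam of the torus. *)
Lemma neighbour_index (R : realType) (M : nat) (rho x y : R) (a b : 'I_M)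
    (k : int) : 0 < rho ->
  a%:R * rho <= x < a.+1%:R * rho -> b%:R * rho <= y < b.+1%:R * rho ->
  `|x - y + k%:~R * (M%:R * rho)| < rho ->
  [\/ b = a, b = ordS a | b = ord_pred a].
Proof.
move=> r0 /andP[a1 a2] /andP[b1 b2]; rewrite ltr_norml => /andP[k1 k2].
have h1 : (a%:Z - b%:Z + k * M%:Z < 2)%R.
  rewrite -(ltr_int R) -(ltr_pM2r r0) !intrD intrN intrM /=.
  rewrite -!pmulrn; rewrite -[b.+1]addn1 natrD in b2.
  by nra.
have h2 : (- 2 < a%:Z - b%:Z + k * M%:Z)%R.
  rewrite -(ltr_int R) -(ltr_pM2r r0) !intrD intrN intrM /=.
  rewrite -!pmulrn; rewrite -[a.+1]addn1 natrD in a2.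
  by nra.
have aM := ltn_ord a; have bM := ltn_ord b.
have k3 : (- 2 < k < 2)%R by nia.
have [k0|[k1'|k1']] : (k = 0 \/ (k = 1 \/ k = -1))%R by lia.
- have [e|[e|e]] : ((b : nat) = a \/ ((b : nat) = a.+1 \/ (a : nat) = b.+1)) by nia.
  + by apply: Or31; apply: val_inj.
  + by apply: Or32; apply: val_inj; rewrite /= -e modn_small.
  + apply: Or33; apply: val_inj; rewrite /= e addSn/= modnDr modn_small//.
- have [e1 e2] : (a = 0 :> nat)%N /\ (b.+1 = M)%N by nia.
  by apply: Or33; apply: val_inj; rewrite /= e1 add0n modn_small; lia.
- have [e1 e2] : (b = 0 :> nat)%N /\ (a.+1 = M)%N by nia.
  by apply: Or32; apply: val_inj; rewrite /= e2 modnn e1.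
Qed.

(** * Changing the intensity by rescaling heights *)

Definition rescale (T : Type) (R : realType) (s c : R) (S : T -> set (pt3 R))
  (w : T) : set (pt3 R) := [set u | window s u /\ S w (u.1, u.2 * c)].

Lemma count_eq_rescale (T : Type) (R : realType) (s c : R)
    (S : T -> set (pt3 R)) A n : 0 < c ->
  count_eq (rescale s c S) A n = count_eq S (tscale c @^-1` (A `&` window s)) n.
Proof.
move=> c0; have cN : c != 0 by rewrite gt_eqF.
have E w : rescale s c S w `&` A =
    tscale c @` (S w `&` tscale c @^-1` (A `&` window s)).
  apply/seteqP; split => [u [[Wu Su] Au]|_ [v [Sv [Av Wv]] <-]].
    have cu : tscale c (u.1, u.2 * c) = u.
      by rewrite /tscale/= mulfK// -surjective_pairing.
    by exists (u.1, u.2 * c) => //; split => //=; rewrite cu.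
  by split => //; split => //=; rewrite divfK// -surjective_pairing.
have inj w : {in S w `&` tscale c @^-1` (A `&` window s) &, injective (tscale c)}.
  by move=> [a b] [a' b'] _ _ [-> /(mulIf (invr_neq0 cN)) ->].
by apply/seteqP; split => w; rewrite /count_eq/= E (card_eql (inj_card_eq (inj w))).
Qed.

Lemma measurable_window (R : realType) (s : R) : measurable (@window R s).
Proof.
rewrite (_ : window s = (`[0, s[%classic `*` `[0, s[%classic) `*` `[0, s]%classic).
  by apply: measurableX => //; apply: measurableX.
by apply/seteqP; split => -[[x y] t] /=; rewrite !in_itv/=; [case|case => -[]].
Qed.

Lemma measurable_rescale_pre (R : realType) (s c : R) (A : set (pt3 R)) :
  measurable A -> measurable (tscale c @^-1` (A `&` window s)).
Proof.
move=> mA; rewrite -[X in measurable X]setTI.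
apply: measurable_tscale => //.
exact: measurableI (measurable_window s).
Qed.

(** Dividing heights by [c] multiplies the intensity by [c]. The window is closed at height [s] and
    the box half-open, hence the strict inequality [c * s < h]. *)
Lemma rescale_poisson d (T : measurableType d) (R : realType)
    (P : probability T R) (s h c lam : R) (S : T -> set (pt3 R)) :
  0 < c -> c * s < h ->
  (forall A n, measurable A -> measurable (count_eq S A n)) ->
  (forall n (A : 'I_n -> set (pt3 R)) (m : 'I_n -> nat),
    (forall i, measurable (A i)) -> (forall i j, i != j -> A i `&` A j = set0) ->
    P (\bigcap_(i in [set: 'I_n]) count_eq S (A i) (m i)) =
    (\prod_i pois (lam * fine (L3 (A i `&` box 0 s 0 s 0 h))) (m i))%:E) ->
  poisson_process P s (lam * c) (rescale s c S).
Proof.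
move=> c0 csh mS PS; split.
- by move=> w u [].
- move=> A n mA; rewrite count_eq_rescale//; apply: mS.
  exact: measurable_rescale_pre.
move=> n A m mA dA.
under eq_bigcapr => i _ do rewrite count_eq_rescale//.
rewrite PS; first last.
- move=> i j ij; rewrite -preimage_setI setIACA dA// set0I.
  exact: preimage_set0.
- by move=> i; exact: measurable_rescale_pre.
suff key i : lam * fine (L3 (tscale c @^-1` (A i `&` window s) `&` box 0 s 0 s 0 h)) =
    lam * c * fine (leb3 (A i `&` window s)).
  by apply: (congr1 EFin); apply: eq_bigr => i _; rewrite key.
have -> : tscale c @^-1` (A i `&` window s) `&` box 0 s 0 s 0 h =
    tscale c @^-1` (A i `&` window s).
  apply/setIidPl => u [_ [/= hx hy /andP[t1 t2]]]; split => //.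
  rewrite ler_pdivlMr ?mul0r// in t1; rewrite ler_pdivrMr// in t2.
  by rewrite t1/= (le_lt_trans t2)// mulrC.
have mAW : measurable (A i `&` window s) by exact: measurableI (measurable_window s).
rewrite (L3_tscale c0 mAW) -mulrA; apply: (congr1 (fun x => lam * x)).
apply: (@fineM _ c%:E) => //.
rewrite ge0_fin_numE; last exact: (measure_ge0 (@L3 R)).
have [s0|s0] := ltP 0 s; last first.
  have -> : A i `&` window s = set0.
    apply/seteqP; split => // u [_ [/= /andP[x1 x2] _ _]].
    by have := le_lt_trans x1 x2; rewrite ltNge s0.
  by rewrite (measure0 (@L3 R)).
apply: (@le_lt_trans _ _ (L3 (box 0 s 0 s 0 (s + 1)))).
  apply: (le_measure (@L3 R)); rewrite ?inE//.
  - exact: measurable_box.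
  - move=> u [_ [/= hx hy /andP[t1 t2]]]; split => //.
    by rewrite t1 (le_lt_trans t2)// ltrDl.
by rewrite L3_box// ?ltry// (lt_trans s0)// ltrDl.
Qed.

Lemma rescale_indep d (T : measurableType d) (R : realType)
    (P : probability T R) (s c c' : R) (X Y : T -> set (pt3 R)) :
  0 < c -> 0 < c' -> indep_pp P X Y ->
  indep_pp P (rescale s c X) (rescale s c' Y).
Proof.
move=> c0 c0' h n1 A m1 n2 B m2 mA mB /=.
under eq_bigcapr => i _ do rewrite count_eq_rescale//.
under [X in _ `&` X]eq_bigcapr => i _ do rewrite count_eq_rescale//.
under [X in (_ * P X)%E]eq_bigcapr => i _ do rewrite count_eq_rescale//.
by apply: h => i; exact: measurable_rescale_pre.
Qed.

Lemma joint_law_box d (T : measurableType d) (R : realType)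
    (P : probability T R) (M K : nat) (rho tau a b : R)
    (X Y : T -> set (pt3 R)) (mQ : forall j, measurable (@cell R M K rho tau j)) :
  0 < rho -> 0 < tau -> 0 <= a -> 0 <= b ->
  joint_law P (fun j => unif (mQ j)) (a * (rho * rho * tau))
    (b * (rho * rho * tau)) X Y ->
  forall n (A : 'I_n -> set (pt3 R)) (m : 'I_n -> nat),
    (forall i, measurable (A i)) -> (forall i j, i != j -> A i `&` A j = set0) ->
    P (\bigcap_(i in [set: 'I_n]) count_eq X (A i) (m i)) =
    (\prod_i pois (a * fine (L3 (A i `&`
       box 0 (M%:R * rho) 0 (M%:R * rho) 0 (K%:R * tau)))) (m i))%:E.
Proof.
move=> r0 t0 a0 b0 h n A m mA dA.
have v0 : 0 < rho * rho * tau by rewrite !mulr_gt0.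
have av0 := mulr_ge0 a0 (ltW v0); have bv0 := mulr_ge0 b0 (ltW v0).
rewrite (joint_law_pois _ av0 bv0 h)//.
apply: (congr1 EFin); apply: eq_bigr => i _.
apply: (congr1 (fun x => pois x (m i))).
rewrite -[LHS]mulrA; apply: (congr1 (fun x => a * x)).
have fin j : L3 (A i `&` @cell R M K rho tau j) \is a fin_num.
  rewrite ge0_fin_numE; last exact: (measure_ge0 (@L3 R)).
  apply: (@le_lt_trans _ _ (L3 (@cell R M K rho tau j))).
    apply: (le_measure (@L3 R)); rewrite ?inE//.
    exact: measurableI.
  by rewrite L3_cell// ltry.
rewrite -bigcup_cell// setI_bigcupr.
rewrite (measure_finpartition (@L3 R)); last 2 first.
- by move=> j; exact: measurableI.
- by apply: trivIset_setIl; exact: trivIset_cell.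
rewrite -sum_fine => [|j _]; last exact: fin.
rewrite mulr_sumr; apply: eq_bigr => j _.
rewrite (unifE _ _ v0)//; last exact: L3_cell.
by rewrite fineM//= mulrCA mulfV ?mulr1// gt_eqF.
Qed.

(** Built backwards: coupled base processes are made on a box of height [2 * cm * s], the second
    configuration is cut out with factor 1 and the first with [cp < 1] and [cm > 1], which turns
    [p2 / th ^+ 9] into [p1] and [(1 - p2) * th ^+ 9] into [1 - p1]. The factor 2 leaves room for
    the strict inequality of [rescale_poisson]. *)
Lemma exists_rescaled_coupling (R : realType) (p1 p2 th s : R) (M K : nat) :
  0 < p1 -> p1 < p2 -> p2 < 1 -> 1 < th ->
  p1 * th ^+ 9 < p2 -> (1 - p2) * th ^+ 9 < 1 - p1 -> 0 < s ->
  (0 < M)%N -> (0 < K)%N ->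
  let cp := p1 * th ^+ 9 / p2 in
  let cm := (1 - p1) / ((1 - p2) * th ^+ 9) in
  let rho := s / M%:R in
  let tau := 2 * cm * s / K%:R in
  rho * rho * tau <= ln th / 2 -> rho * rho * tau <= 1 / 2 ->
  exists C : coupling R, valid_coupling s p1 p2 C /\ forall w,
    [/\ forall u, c_P1p C w u -> c_P2p C w (u.1, u.2 * cp),
        forall v, c_P2m C w v -> c_P1m C w (v.1, v.2 / cm) &
        forall u v (k l : int), c_P1p C w u -> c_P2m C w v ->
          u.2 * cp < tau -> v.2 < tau ->
          `|u.1.1 - v.1.1 + k%:~R * s| < rho ->
          `|u.1.2 - v.1.2 + l%:~R * s| < rho -> False].
Proof.
move=> p10 p12 p21 th1 h1 h2 s0 M0 K0 cp cm rho tau hv1 hv2.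
have p20 : 0 < p2 by apply: lt_trans p12.
have q20 : 0 < 1 - p2 by rewrite subr_gt0.
have t90 : 0 < th ^+ 9 by rewrite exprn_gt0// (lt_trans _ th1).
have cp0 : 0 < cp by rewrite divr_gt0// mulr_gt0.
have cp1 : cp < 1 by rewrite ltr_pdivrMr ?mul1r.
have qt0 : 0 < (1 - p2) * th ^+ 9 by rewrite mulr_gt0.
have cm1 : 1 < cm by rewrite ltr_pdivlMr ?mul1r.
have cm0 : 0 < cm by apply: lt_trans cm1.
have MR : 0 < M%:R :> R by rewrite ltr0n.
have KR : 0 < K%:R :> R by rewrite ltr0n.
have rho0 : 0 < rho by rewrite divr_gt0.
have tau0 : 0 < tau by rewrite divr_gt0// mulr_gt0// mulr_gt0.
have Mrho : M%:R * rho = s by rewrite mulrC divfK// gt_eqF.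
have Ktau : K%:R * tau = 2 * cm * s by rewrite mulrC divfK// gt_eqF.
set v := rho * rho * tau in hv1 hv2.
have v0 : 0 < v by rewrite /v mulr_gt0// mulr_gt0.
pose mQ j : measurable (@cell R M K rho tau j) := measurable_box _ _ _ _ _ _.
pose U j := unif (mQ j).
have UE j A : U j A = (L3 (A `&` cell rho tau j) * (v^-1)%:E)%E.
  by apply: unifE => //; exact: L3_cell.
have UQ j : U j (cell rho tau j) = 1%E.
  by rewrite UE setIid L3_cell// -EFinM mulfV// gt_eqF.
have U0 j u : U j [set u] = 0%E.
  rewrite UE (_ : L3 _ = 0%E) ?mul0e//.
  apply: (subset_measure0 (mu := @L3 R)) (L3_set1 u) => //.
  - apply: measurableI => //.
    exact: (@measurable_diag3 _ _ R id (cst u) (@measurable_id _ _ setT) (measurable_cst _)).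
  - exact: (@measurable_diag3 _ _ R id (cst u) (@measurable_id _ _ setT) (measurable_cst _)).
have Rel_mono x y : @conf_excl _ (shifts M K) x y ->
    (forall j, ((x j).1 <= (y j).1)%N) /\ (forall j, ((y j).2 <= (x j).2)%N).
  by case.
pose a := p2 / th ^+ 9 * v; pose b := (1 - p2) * v.
have a0 : 0 < a by rewrite /a mulr_gt0// divr_gt0.
have b0 : 0 < b by rewrite /b mulr_gt0.
have ath : a * th ^+ 9 = p2 * v by rewrite /a mulrAC divfK// gt_eqF.
have bth : b * th ^+ 9 = (1 - p2) * th ^+ 9 * v by rewrite /b mulrAC.
have cpl := @coupled_conf_excl R _ (shifts M K) th v a b
  (@shifts_bij M K) th1 a0 b0.
have {cpl} cpl : coupled (pois_conf a ((1 - p2) * th ^+ 9 * v))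
    (pois_conf (p2 * v) b) (@conf_excl _ (shifts M K)).
  rewrite -ath -bth; apply: cpl => //=.
    by rewrite ath ger_pMl// ltW.
  rewrite bth ger_pMl// ltW//; apply: lt_trans h2 _.
  by rewrite ltrBlDr ltrDl.
have := @exists_coupled_processes R _ U _ mQ UQ U0 _ Rel_mono
  a ((1 - p2) * th ^+ 9 * v) (p2 * v) b.
move=> /(_ (ltW a0) (ltW (mulr_gt0 qt0 v0)) (ltW (mulr_gt0 p20 v0)) (ltW b0)).
move=> /(_ cpl)[C [J1 J2 mC inclC exclC]].
have b10 : 0 <= (1 - p2) * th ^+ 9 by rewrite mulr_ge0 ?ltW.
have a10 : 0 <= p2 / th ^+ 9 by rewrite divr_ge0 ?ltW.
have PS1p := joint_law_box rho0 tau0 a10 b10 J1.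
have PS1m := joint_law_box rho0 tau0 b10 a10 (joint_law_sym J1).
have PS2p := joint_law_box rho0 tau0 (ltW p20) (ltW q20) J2.
have PS2m := joint_law_box rho0 tau0 (ltW q20) (ltW p20) (joint_law_sym J2).
rewrite Mrho Ktau in PS1p PS1m PS2p PS2m.
have I1 := joint_law_indep (ltW a0) (mulr_ge0 b10 (ltW v0)) J1.
have I2 := joint_law_indep (mulr_ge0 (ltW p20) (ltW v0)) (ltW b0) J2.
exists (@Coupling R _ _ (c_P C) (rescale s cp (c_P1p C)) (rescale s cm (c_P1m C))
  (rescale s 1 (c_P2p C)) (rescale s 1 (c_P2m C))).
split; first split=> /=.
- have cmh : cm * s < 2 * cm * s.
    by rewrite -mulrA; have := mulr_gt0 cm0 s0; move: (cm * s) => x; lra.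
  have cph : cp * s < 2 * cm * s.
    by apply: lt_trans cmh; rewrite ltr_pM2r// (lt_trans cp1).
  have h1s : 1 * s < 2 * cm * s by apply: lt_trans cmh; rewrite ltr_pM2r.
  split.
  + rewrite [X in poisson_process _ _ X](_ : p1 = p2 / th ^+ 9 * cp); last first.
      have T0 : th ^+ 9 != 0 by rewrite gt_eqF.
      have p2N : p2 != 0 by rewrite gt_eqF.
      by rewrite /cp; move: (th ^+ 9) T0 => T T0; field; rewrite ?T0 ?p2N.
    apply: rescale_poisson cph _ PS1p => // A n mA.
    by apply: mC => //; left; left.
  + rewrite [X in poisson_process _ _ X](_ : _ = (1 - p2) * th ^+ 9 * cm); last first.
      by rewrite /cm mulrC divfK// gt_eqF// mulr_gt0.
    apply: rescale_poisson cmh _ PS1m => // A n mA.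
    by apply: mC => //; left; right.
  + rewrite -[X in poisson_process _ _ X]mulr1.
    apply: rescale_poisson h1s _ PS2p => // A n mA.
    by apply: mC => //; right; left.
  + rewrite -[X in poisson_process _ _ X]mulr1.
    apply: rescale_poisson h1s _ PS2m => // A n mA.
    by apply: mC => //; right; right.
- by split; apply: rescale_indep.
move=> w; have [i1 i2 i3 i4] := inclC w; split => /=.
- move=> u [[hx hy /andP[t1 t2]] Su]; split => /=.
    split => //=; apply/andP; split; first by apply: mulr_ge0 => //; exact: ltW.
    by apply: le_trans t2; apply: ler_piMr => //; exact: ltW.
  by rewrite mulr1; exact: i1.
- move=> u [[hx hy /andP[t1 t2]]]; rewrite mulr1 => /i2.
  rewrite -surjective_pairing => Su; split => /=.
    split => //=; apply/andP; split; first by apply: divr_ge0 => //; exact: ltW.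
    by apply: le_trans t2; rewrite ler_pdivrMr//; apply: ler_peMr => //; exact: ltW.
  by rewrite divfK ?gt_eqF// -surjective_pairing.
- move=> u u' k l [Wu Su] [Wu' Su'] ht ht' hk hl.
  have [x [y [i [j [[_ _ ex] [Qi1 Qi2 Qi3] [Qj1 Qj2 Qj3] xi yj]]]]] := exclC w _ _ Su Su'.
  move: Qi1 Qi2 Qi3 Qj1 Qj2 Qj3; rewrite /= => Qi1 Qi2 Qi3 Qj1 Qj2 Qj3.
  rewrite mulr1 in Qj3.
  rewrite -Mrho in hk hl.
  have n1 := neighbour_index rho0 Qi1 Qj1 hk.
  have n2 := neighbour_index rho0 Qi2 Qj2 hl.
  (* Both base points lie below [tau], hence in the bottom layer, so their height indices agree as
     [shifts] demands. *)
  have idx0 (t : R) (e : 'I_K) : e%:R * tau <= t < e.+1%:R * tau -> t < tau -> e = 0%N :> nat.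
    move=> /andP[e1 _] tt; have := le_lt_trans e1 tt.
    by rewrite -[ltRHS]mul1r ltr_pM2r// -[1]/(1%:R) ltr_nat ltnS leqn0 => /eqP.
  have eij : i.2 = j.2.
    by apply: val_inj; rewrite /= (idx0 _ _ Qi3 ht) (idx0 _ _ Qj3 ht').
  have {}ex n : (n < 9)%N -> j = nth id (shifts M K) n i -> False.
    move=> n9 jn; have := ex n i n9 xi; rewrite -jn => y0.
    by rewrite y0 in yj.
  case: i j n1 n2 eij ex {Qi1 Qi2 Qi3 Qj1 Qj2 Qj3 xi yj} => [[i1' i2'] i3'] [[j1 j2] j3] /=.
  move=> n1 n2 <- ex.
  case: n1 => n1; case: n2 => n2.
  + by apply: (ex 0%N) => //=; rewrite n1 n2.
  + by apply: (ex 1%N) => //=; rewrite n1 n2.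
  + by apply: (ex 2%N) => //=; rewrite n1 n2.
  + by apply: (ex 3%N) => //=; rewrite n1 n2.
  + by apply: (ex 4%N) => //=; rewrite n1 n2.
  + by apply: (ex 5%N) => //=; rewrite n1 n2.
  + by apply: (ex 6%N) => //=; rewrite n1 n2.
  + by apply: (ex 7%N) => //=; rewrite n1 n2.
  + by apply: (ex 8%N) => //=; rewrite n1 n2.
Qed.

(** * Geometry of the torus *)

Lemma norm3_ge0 (R : realType) k (v : pt3 R) : 0 <= norm3 k v.
Proof. by case: k; rewrite /norm3 ?addr_ge0 ?sqrtr_ge0. Qed.

Lemma norm3_ge_coord (R : realType) k (v : pt3 R) :
  `|v.1.1| <= norm3 k v /\ `|v.1.2| <= norm3 k v.
Proof.
have S (a b : R) : 0 <= b -> `|a| <= Num.sqrt (a ^+ 2 + b).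
  by move=> b0; rewrite -sqrtr_sqr ler_wsqrtr// lerDl.
case: k; rewrite /norm3.
  split; (apply: (@le_trans _ _ (Num.sqrt (v.1.1 ^+ 2 + v.1.2 ^+ 2))); last by rewrite lerDl).
    by apply: S; rewrite sqr_ge0.
  by rewrite addrC; apply: S; rewrite sqr_ge0.
split; first by rewrite -addrA; apply: S; rewrite addr_ge0 ?sqr_ge0.
by rewrite addrAC addrC; apply: S; rewrite addr_ge0 ?sqr_ge0.
Qed.

Lemma norm3_le_sum (R : realType) k (v : pt3 R) :
  norm3 k v <= `|v.1.1| + `|v.1.2| + `|v.2|.
Proof.
have S (a b : R) : 0 <= b -> Num.sqrt (a ^+ 2 + b ^+ 2) <= `|a| + b.
  move=> b0; rewrite -[leRHS]ger0_norm ?addr_ge0// -sqrtr_sqr ler_wsqrtr//.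
  by rewrite sqrrD real_normK ?num_real// lerD2r lerDl mulrn_wge0// mulr_ge0.
have S2 : Num.sqrt (v.1.1 ^+ 2 + v.1.2 ^+ 2) <= `|v.1.1| + `|v.1.2|.
  by rewrite -(real_normK (num_real v.1.2)); exact: S.
case: k; rewrite /norm3; first by rewrite lerD2r.
rewrite addrC -(sqr_sqrtr (addr_ge0 (sqr_ge0 v.1.1) (sqr_ge0 v.1.2))).
by apply: le_trans (S _ _ (sqrtr_ge0 _)) _; rewrite addrC lerD2r.
Qed.

(** For [JM] the gain is [(1 - c) * t]. For the Euclidean norm it is [(a ^+ 2 - b ^+ 2) / (a + b)],
    with numerator [(1 - c ^+ 2) * t ^+ 2] and denominator at most [2 * r]. The bound is the weaker
    one, valid for both. *)
Lemma norm3_gain (R : realType) k (z : R * R) (t c tau r : R) :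
  0 <= c -> c < 1 -> 0 < tau -> tau <= 1 -> 1 <= r -> tau <= t ->
  norm3 k (z, - t) <= r ->
  norm3 k (z, - (t * c)) + (1 - c) * tau ^+ 2 / (2 * r) <= norm3 k (z, - t).
Proof.
move=> c0 c1 tau0 tau1 r1 ht.
have t0 : 0 < t by apply: lt_le_trans ht.
have d0 : 0 < 2 * r by rewrite mulr_gt0// (lt_le_trans _ r1).
case: k; rewrite /norm3/= => hr.
  rewrite !normrN normrM (gtr0_norm t0) (ger0_norm c0) -addrA lerD2l.
  suff : (1 - c) * tau ^+ 2 / (2 * r) <= (1 - c) * t by lra.
  rewrite ler_pdivrMr// -mulrA ler_wpM2l ?subr_ge0 ?(ltW c1)//.
  by nra.
set q := z.1 ^+ 2 + z.2 ^+ 2 in hr *.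
have q0 : 0 <= q by rewrite addr_ge0 ?sqr_ge0.
rewrite !sqrrN in hr *.
have a2 := sqr_sqrtr (addr_ge0 q0 (sqr_ge0 t)).
have b2 := sqr_sqrtr (addr_ge0 q0 (sqr_ge0 (t * c))).
have := sqrtr_ge0 (q + t ^+ 2); have := sqrtr_ge0 (q + (t * c) ^+ 2).
move: (Num.sqrt (q + t ^+ 2)) (Num.sqrt (q + (t * c) ^+ 2)) a2 b2 hr => a b.
move=> a2 b2 ar b0 a0.
have ba : b <= a.
  rewrite -(@ler_pXn2r _ 2)// ?nnegrE// a2 b2 lerD2l exprMn ger_pMr ?exprn_gt0//.
  by rewrite exprn_ile1// ltW.
have diff : (1 - c) * tau ^+ 2 <= (a - b) * (a + b).
  have -> : (a - b) * (a + b) = (1 - c ^+ 2) * t ^+ 2.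
    have -> : (a - b) * (a + b) = a ^+ 2 - b ^+ 2 by ring.
    by rewrite a2 b2; ring.
  have tt : tau ^+ 2 <= t ^+ 2 by rewrite lerXn2r// nnegrE ltW.
  have cc : 1 - c <= 1 - c ^+ 2 by rewrite lerD2l lerN2 expr2 ler_piMl// ltW.
  by apply: ler_pM => //; rewrite ?subr_ge0 ?(ltW c1) ?exprn_ge0// ltW.
suff : (1 - c) * tau ^+ 2 / (2 * r) <= a - b by lra.
rewrite ler_pdivrMr//; apply: le_trans diff _.
by rewrite ler_wpM2l ?subr_ge0//; lra.
Qed.

Lemma norm3_mono (R : realType) k (z : R * R) (t c : R) : 0 <= c -> c <= 1 ->
  norm3 k (z, - (t * c)) <= norm3 k (z, - t).
Proof.
move=> c0 c1; case: k; rewrite /norm3/=.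
  by rewrite !normrN normrM (ger0_norm c0) lerD2l ler_piMr.
rewrite !sqrrN ler_wsqrtr// lerD2l exprMn ler_piMr ?sqr_ge0//.
by rewrite exprn_ile1.
Qed.

Section torus_distance.
Context (R : realType) (k : norm_kind) (s : R).

Let shifted (x y : pt3 R) (k1 k2 : int) : R :=
  norm3 k (x.1.1 - y.1.1 + k1%:~R * s, x.1.2 - y.1.2 + k2%:~R * s, x.2 - y.2).

Lemma tdist_le (x y : pt3 R) (k1 k2 : int) :
  tdist k s x y <= norm3 k (x.1.1 - y.1.1 + k1%:~R * s,
                            x.1.2 - y.1.2 + k2%:~R * s, x.2 - y.2).
Proof.
apply: ge_inf; last by exists k1, k2.
by exists 0 => _ [l1 [l2 ->]]; exact: norm3_ge0.
Qed.

Lemma tdist_ge (x y : pt3 R) (b : R) :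
  (forall k1 k2, b <= shifted x y k1 k2) -> b <= tdist k s x y.
Proof.
move=> h; apply: lb_le_inf; first by exists (shifted x y 0 0), 0, 0.
by move=> _ [l1 [l2 ->]]; exact: h.
Qed.

Lemma tdist_lt (x y : pt3 R) (b : R) : tdist k s x y < b ->
  exists k1 k2, shifted x y k1 k2 < b.
Proof.
move=> h; apply: contrapT => nh; move: h; apply/negP; rewrite -leNgt.
apply: tdist_ge => k1 k2; rewrite leNgt; apply/negP => hb.
by apply: nh; exists k1, k2.
Qed.

Lemma tdist_xx (z : R * R) : tdist k s (Defs.lift0 z) (Defs.lift0 z) <= 0.
Proof.
apply: le_trans (tdist_le _ _ 0 0) _; rewrite /Defs.lift0/= !subrr !mul0r addr0.
by apply: le_trans (norm3_le_sum _ _) _; rewrite /= normr0 !addr0.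
Qed.

Lemma tdist_mono (z p : R * R) (t c : R) : 0 <= c -> c <= 1 ->
  tdist k s (Defs.lift0 z) (p, t * c) <= tdist k s (Defs.lift0 z) (p, t).
Proof.
move=> c0 c1; apply: tdist_ge => k1 k2.
apply: le_trans (tdist_le _ _ k1 k2) _; rewrite /shifted/= !sub0r.
exact: norm3_mono.
Qed.

Lemma tdist_gain (z p : R * R) (t c tau r : R) :
  0 <= c -> c < 1 -> 0 < tau -> tau <= 1 -> 1 <= r -> tau <= t ->
  tdist k s (Defs.lift0 z) (p, t) < r ->
  tdist k s (Defs.lift0 z) (p, t * c) + (1 - c) * tau ^+ 2 / (2 * r) <=
  tdist k s (Defs.lift0 z) (p, t).
Proof.
move=> c0 c1 tau0 tau1 r1 ht hr; apply/ler_addgt0Pr => e e0.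
(* A lift within [e] of the infimum for the original point; the same translation serves for the
   lowered point. *)
have [|k1 [k2]] := @tdist_lt (Defs.lift0 z) (p, t)
    (Num.min r (tdist k s (Defs.lift0 z) (p, t) + e)).
  by rewrite lt_min hr ltrDl.
rewrite lt_min => /andP[/ltW hr' /ltW he].
apply: le_trans he; rewrite /shifted/= sub0r in hr' *.
apply: le_trans (norm3_gain c0 c1 tau0 tau1 r1 ht hr').
by rewrite lerD2r; apply: le_trans (tdist_le _ _ k1 k2) _; rewrite /= sub0r.
Qed.

(** If [v] too were close to [z], the difference of the two translations would bring [u] and [v]
    within [rho] of each other in both horizontal coordinates. *)
Lemma tdist_sep (z : R * R) (u v : pt3 R) (a b rho : R) :
  (forall k1 k2 : int, `|u.1.1 - v.1.1 + k1%:~R * s| < rho ->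
     `|u.1.2 - v.1.2 + k2%:~R * s| < rho -> False) ->
  a + b <= rho -> tdist k s (Defs.lift0 z) u < a -> b <= tdist k s (Defs.lift0 z) v.
Proof.
move=> h ab ua; rewrite leNgt; apply/negP => vb.
have [k1 [k2 hu]] := tdist_lt ua; have [l1 [l2 hv]] := tdist_lt vb.
have [u1 u2] := norm3_ge_coord k ((Defs.lift0 z).1.1 - u.1.1 + k1%:~R * s,
  (Defs.lift0 z).1.2 - u.1.2 + k2%:~R * s, (Defs.lift0 z).2 - u.2).
have [v1 v2] := norm3_ge_coord k ((Defs.lift0 z).1.1 - v.1.1 + l1%:~R * s,
  (Defs.lift0 z).1.2 - v.1.2 + l2%:~R * s, (Defs.lift0 z).2 - v.2).
move: u1 u2 v1 v2; rewrite /= => u1 u2 v1 v2.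
have T (x y w : R) (m n : int) : `|w - x + m%:~R * s| < a ->
    `|w - y + n%:~R * s| < b -> `|x - y + (n - m)%:~R * s| < rho.
  move=> hx hy.
  have -> : x - y + (n - m)%:~R * s =
      (w - y + n%:~R * s) - (w - x + m%:~R * s) by rewrite intrB; ring.
  apply: le_lt_trans (ler_normB _ _) _; apply: lt_le_trans ab.
  by rewrite addrC ltrD.
by apply: (h (l1 - k1) (l2 - k2)); [apply: (T _ _ z.1)|apply: (T _ _ z.2)];
  apply: le_lt_trans; eassumption.
Qed.

End torus_distance.

(** Let u' be [u] lowered by [cp] and v' be [v] lowered by [cm^-1]. Blackness gives d(u') <= d(u) <=
    d(v') + e <= d(v) + e, and a gain in the first or in the last inequality is enough. If both
    points are low, [tdist_sep] gives d(v) >= r + 2 whereas d(u) < r + 1, and the unit between them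
    pays for [eta]. *)
Lemma robust_of_black (R : realType) (k : norm_kind)
    (s cp cm tau rho r eta : R) (P1p P1m P2p P2m : set (pt3 R)) :
  0 < cp -> cp < 1 -> 1 < cm -> 0 < tau -> tau <= 1 -> 1 <= r ->
  2 * r + 4 <= rho -> eta <= 1 ->
  eta <= (1 - cp) * tau ^+ 2 / (2 * (r + 2)) ->
  eta <= (1 - cm^-1) * tau ^+ 2 / (2 * (r + 2)) ->
  (forall u, P1p u -> 0 <= u.2) ->
  (forall u, P1p u -> P2p (u.1, u.2 * cp)) ->
  (forall v, P2m v -> P1m (v.1, v.2 / cm)) ->
  (forall u v (k l : int), P1p u -> P2m v -> u.2 * cp < tau -> v.2 < tau ->
     `|u.1.1 - v.1.1 + k%:~R * s| < rho ->
     `|u.1.2 - v.1.2 + l%:~R * s| < rho -> False) ->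
  forall z, (exists2 u, P1p u & tdist k s (Defs.lift0 z) u <= r) ->
  black k s P1p P1m z -> robustly_black k s eta P2p P2m z.
Proof.
move=> cp0 cp1 cm1 tau0 tau1 r1 hrho eta1 hp hm pos12 h12 h21 hex z [u0 Pu0 du0].
rewrite /black /robustly_black /dist_set => hb.
have cm0 : 0 < cm by apply: lt_trans cm1.
have ci0 : 0 <= cm^-1 by rewrite invr_ge0 ltW.
have ci1 : cm^-1 < 1 by rewrite invf_lt1.
rewrite leeBrDr//; apply: le_ereal_inf_tmp => _ [v Pv <-].
apply/lee_addgt0Pr => e0 e00.
(* The infimum is only approached, up to [e]; the cap at 1 keeps [(r + e) + (r + 2)] below [rho]. *)
pose e := Num.min e0 1; have e_gt0 : 0 < e by rewrite lt_min e00 ltr01.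
have e1 : e <= 1 by rewrite ge_min lexx orbT.
have ee0 : e <= e0 by rewrite ge_min lexx.
set D1 := ereal_inf [set (tdist k s (Defs.lift0 z) y)%:E | y in P1p] in hb.
have D1r : (D1 <= r%:E)%E.
  by apply: (@le_trans _ _ (tdist k s (Defs.lift0 z) u0)%:E);
    [apply: ereal_inf_lbound; exists u0|rewrite lee_fin].
have D10 : (0 <= D1)%E.
  apply: le_ereal_inf_tmp => _ [y _ <-]; rewrite lee_fin.
  by apply: tdist_ge => *; exact: norm3_ge0.
have D1fin : D1 \is a fin_num.
  by rewrite ge0_fin_numE// (le_lt_trans D1r)// ltry.
have [_ [u Pu <-] hu] := lb_ereal_inf_adherent e_gt0 D1fin.
rewrite -/D1 in hu.
have dur : tdist k s (Defs.lift0 z) u < r + e.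
  by rewrite -lte_fin; apply: lt_le_trans hu _; rewrite EFinD leeD2r.
have duv : tdist k s (Defs.lift0 z) u < tdist k s (Defs.lift0 z) (v.1, v.2 / cm) + e.
  rewrite -lte_fin; apply: lt_le_trans hu _; rewrite EFinD leeD2r//.
  apply: le_trans hb _; apply: ereal_inf_lbound.
  by exists (v.1, v.2 / cm) => //; exact: h21.
have ue : u = (u.1, u.2) by case: (u).
have ve : v = (v.1, v.2) by case: (v).
suff key : tdist k s (Defs.lift0 z) (u.1, u.2 * cp) + eta <= tdist k s (Defs.lift0 z) v + e.
  apply: (@le_trans _ _ ((tdist k s (Defs.lift0 z) (u.1, u.2 * cp))%:E + eta%:E)%E).
    rewrite leeD2r//; apply: ereal_inf_lbound.
    by exists (u.1, u.2 * cp) => //; exact: h12.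
  by rewrite -!EFinD lee_fin; apply: le_trans key _; rewrite lerD2l.
have m1 : tdist k s (Defs.lift0 z) (u.1, u.2 * cp) <= tdist k s (Defs.lift0 z) u.
  by rewrite [in leRHS]ue; apply: tdist_mono; exact: ltW.
have m2 : tdist k s (Defs.lift0 z) (v.1, v.2 / cm) <= tdist k s (Defs.lift0 z) v.
  by rewrite [in leRHS]ve; apply: tdist_mono => //; exact: ltW.
have far : r + 2 <= tdist k s (Defs.lift0 z) v ->
    tdist k s (Defs.lift0 z) (u.1, u.2 * cp) + eta <= tdist k s (Defs.lift0 z) v + e.
  by move=> hv; lra.
have r2 : 1 <= r + 2 by lra.
have [hl|hl] := leP tau (u.2 * cp).
  have htu : tau <= u.2.
    by apply: le_trans hl _; rewrite ler_piMr ?(ltW cp1)//; exact: pos12.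
  have := @tdist_gain R k s z u.1 u.2 cp tau (r + 2) (ltW cp0) cp1 tau0 tau1 r2 htu.
  rewrite -ue => /(_ _)/=; have dr2 : tdist k s (Defs.lift0 z) u < r + 2 by lra.
  by move=> /(_ dr2); lra.
have [hv|hv] := leP tau v.2.
  have [|dv] := leP (r + 2) (tdist k s (Defs.lift0 z) v); first exact: far.
  have := @tdist_gain R k s z v.1 v.2 cm^-1 tau (r + 2) ci0 ci1 tau0 tau1 r2 hv.
  by rewrite -ve => /(_ dv); lra.
apply: far; apply: (@tdist_sep R k s z u v (r + e) (r + 2) rho) => //; last by lra.
by move=> k1 k2; exact: hex.
Qed.

(** * Density of the points and choice of the parameters *)

Lemma measure_seqU_le d (T : measurableType d) (R : realType)
    (mu : {measure set T -> \bar R}) (I : eqType) (l : seq I) (F : I -> set T) :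
  (forall i, measurable (F i)) ->
  (mu (\big[setU/set0]_(i <- l) F i) <= \sum_(i <- l) mu (F i))%E.
Proof.
move=> mF; elim: l => [|i l IH]; first by rewrite !big_nil measure0.
rewrite !big_cons; apply: le_trans (measureU2 _ _ _) _ => //.
  exact: bigsetU_measurable.
by rewrite leeD2l.
Qed.

(** With a single layer the cells are cubes of side [s / N] standing on the plane; the event says
    that none of them misses the positive points. *)
Definition dense_event (R : realType) (C : coupling R) (s : R) (N : nat)
  : set (c_Omega C) :=
  ~` \bigcup_(j in [set: 'I_N * 'I_N]) count_eq (c_P1p C)
     (@cell R N 1 (s / N%:R) (s / N%:R) (j, ord0)) 0.

(** Union bound over the [N ^ 2] cubes, each empty with the probability that a Poisson variable of
    mean [lam * (s / N) ^+ 3] vanishes. *)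
Lemma dense_event_prob (R : realType) (C : coupling R) (s lam : R) (N : nat) :
  0 < s -> (0 < N)%N -> poisson_process (c_P C) s lam (c_P1p C) ->
  measurable (@dense_event R C s N) /\
  ((1 - (N ^ 2)%:R * expR (- (lam * (s / N%:R) ^+ 3)))%:E <=
    c_P C (@dense_event R C s N))%E.
Proof.
move=> s0 N0 [_ mX PX].
have N0R : 0 < N%:R :> R by rewrite ltr0n.
set sg := s / N%:R; have sg0 : 0 < sg by rewrite divr_gt0.
have Nsg : N%:R * sg = s by rewrite mulrC divfK// gt_eqF.
have mc (j : 'I_N * 'I_N * 'I_1) : measurable (@cell R N 1 sg sg j).
  exact: measurable_box.
pose F (j : 'I_N * 'I_N) := count_eq (c_P1p C) (@cell R N 1 sg sg (j, ord0)) 0.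
have mF j : measurable (F j) by exact: mX.
have PF j : c_P C (F j) = (expR (- (lam * sg ^+ 3)))%:E.
  have := PX 1%N (fun=> @cell R N 1 sg sg (j, ord0)) (fun=> 0%N) (fun=> mc _).
  have -> : \bigcap_(i in [set: 'I_1]) F j = F j.
    by apply/seteqP; split => w; [apply; exact: (I : setT ord0)|move=> h i].
  rewrite big_ord1; have -> : @cell R N 1 sg sg (j, ord0) `&` window s =
      @cell R N 1 sg sg (j, ord0).
    apply/setIidPl => u hu; have : (\bigcup_j @cell R N 1 sg sg j) u by exists (j, ord0).
    rewrite bigcup_cell// Nsg mul1r => -[hx hy /andP[t1 t2]]; split => //.
    rewrite t1 (le_trans (ltW t2))// -Nsg ler_peMl ?(ltW sg0)//.
    by rewrite ler1n.
  have -> : leb3 (@cell R N 1 sg sg (j, ord0)) = (sg * sg * sg)%:E.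
    exact: L3_cell.
  move=> ->; last by move=> i i'; rewrite !ord1 eqxx.
  rewrite /pois expr0 fact0 divr1 mul1r/=.
  by have -> : sg * sg * sg = sg ^+ 3 by ring.
have mU : measurable (\bigcup_(j in [set: 'I_N * 'I_N]) F j).
  by apply: fin_bigcup_measurable => //; exact: finite_finset.
split; first exact: measurableC.
rewrite /dense_event -/sg probability_setC//.
rewrite EFinB leeD2l// leeN2.
rewrite (_ : [set: 'I_N * 'I_N] = [set` enum {: 'I_N * 'I_N}]); last first.
  by apply/seteqP; split => // j _ /=; rewrite mem_enum.
rewrite bigcup_seq; apply: le_trans (measure_seqU_le _ _ mF) _.
rewrite (eq_bigr (fun=> (expR (- (lam * sg ^+ 3)))%:E)) => [|j _]; last exact: PF.
rewrite sumEFin big_const_seq count_predT iter_addr addr0.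
by rewrite mulr_natl -cardT card_prod !card_ord mulnn lexx.
Qed.

Lemma dense_event_near (R : realType) (C : coupling R) (k : norm_kind) (s : R)
    (N : nat) (w : c_Omega C) (z : R * R) :
  0 < s -> (0 < N)%N -> @dense_event R C s N w ->
  exists2 u, c_P1p C w u & tdist k s (Defs.lift0 z) u <= 3 * (s / N%:R).
Proof.
move=> s0 N0 hw; have N0R : 0 < N%:R :> R by rewrite ltr0n.
set sg := s / N%:R in hw *; have sg0 : 0 < sg by rewrite divr_gt0.
have Nsg : N%:R * sg = s by rewrite mulrC divfK// gt_eqF.
(* Each coordinate of [z] is moved into the fundamental domain by a multiple of [s]; the same
   multiples witness the bound on the torus distance. *)
have red (x : R) : exists m : int, exists i : 'I_N,
    i%:R * sg <= x + m%:~R * s < i.+1%:R * sg.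
  exists (- Num.floor (x / s)); apply: floor_cell => //; rewrite Nsg.
  have := floor_itv (x / s); move: (Num.floor _) => f.
  rewrite intrD intrN => /andP[f1 f2].
  rewrite ler_pdivlMr// in f1; rewrite ltr_pdivrMr// in f2.
  by apply/andP; split; lra.
have [m1 [i1 h1]] := red z.1; have [m2 [i2 h2]] := red z.2.
have [u [Pu [/= hx hy ht]]] :
    c_P1p C w `&` @cell R N 1 sg sg ((i1, i2), ord0) !=set0.
  apply/set0P/negP => /eqP e0; apply: hw; exists (i1, i2) => //.
  by rewrite /count_eq/= e0; exact/card_set0_II.
exists u => //; apply: le_trans (tdist_le _ _ _ _ m1 m2) _.
apply: le_trans (norm3_le_sum _ _) _ => /=.
have S (i : nat) : i.+1%:R * sg = sg + i%:R * sg by rewrite -natr1 mulrDl mul1r addrC.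
rewrite !S in hx hy h1 h2; rewrite S mul0r addr0 in ht.
have close (x y b : R) : b <= x < sg + b -> b <= y < sg + b -> `|x - y| <= sg.
  by move=> ? ?; rewrite ler_norml; lra.
have n1 : `|z.1 - u.1.1 + m1%:~R * s| <= sg by rewrite addrAC; exact: close h1 hx.
have n2 : `|z.2 - u.1.2 + m2%:~R * s| <= sg by rewrite addrAC; exact: close h2 hy.
have n3 : `|0 - u.2| <= sg by rewrite ler_norml; lra.
by lra.
Qed.

Lemma C_d_le3 (R : realType) (k : norm_kind) : @C_d R k <= 3.
Proof.
apply: ge_sup.
  exists (norm3 k ((0 - 0, 0 - 0), 0 - 0)), ((0, 0), 0), ((0, 0), 0).
  by split => //; split; rewrite /= lexx ler01.
move=> _ [x [y [[x1 x2 x3] [y1 y2 y3] ->]]].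
apply: le_trans (norm3_le_sum _ _) _ => /=.
have H (a b : R) : 0 <= a <= 1 -> 0 <= b <= 1 -> `|a - b| <= 1.
  by move=> ? ?; rewrite ler_norml; lra.
by have := H _ _ x1 y1; have := H _ _ x2 y2; have := H _ _ x3 y3; lra.
Qed.

(** * Elementary estimates for the choice of parameters *)

Lemma exists_root_lt (R : realType) (q : R) n : 1 < q ->
  exists2 t, 1 < t & t ^+ n < q.
Proof.
move=> q1; have q0 : 0 < q by apply: lt_trans q1.
have lq : 0 < ln q by rewrite ln_gt0.
exists (expR (ln q / n.+1%:R)).
  by rewrite -[ltLHS]expR0 ltr_expR divr_gt0.
rewrite -expRM_natl -[ltRHS]lnK ?posrE// ltr_expR mulrA ltr_pdivrMr//.
by rewrite mulrC ltr_pM2l// ltr_nat.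
Qed.

(** Raise [expR u >= u], for [u = c * x / n.+1], to the power [n.+1]: one power more than [x ^+ n]
    has to be beaten. *)
Lemma expR_pow_bound (R : realType) (c x : R) n : 0 < c -> 0 < x ->
  x ^+ n * expR (- (c * x)) <= (n.+1%:R / c) ^+ n.+1 / x.
Proof.
move=> c0 x0; have n0 : 0 < n.+1%:R :> R by [].
have cx0 : 0 < c * x by rewrite mulr_gt0.
have y0 : 0 < c * x / n.+1%:R by rewrite divr_gt0.
have : (c * x / n.+1%:R) ^+ n.+1 <= expR (c * x).
  rewrite -{2}[c * x](divfK (lt0r_neq0 n0)) [X in expR X]mulrC expRM_natl.
  rewrite lerXn2r ?nnegrE ?expR_ge0 ?(ltW y0)//.
  by apply: le_trans (expR_ge1Dx _); rewrite lerDr.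
rewrite expRN => h; have yn0 : 0 < (c * x / n.+1%:R) ^+ n.+1 by rewrite exprn_gt0.
apply: (@le_trans _ _ (x ^+ n / (c * x / n.+1%:R) ^+ n.+1)).
  rewrite ler_pM2l ?exprn_gt0// lef_pV2// posrE ?expR_gt0//.
rewrite le_eqVlt; apply/orP; left; apply/eqP.
rewrite !exprMn !exprVn (exprS x n).
have cN : c ^+ n.+1 != 0 by rewrite expf_neq0// gt_eqF.
have nN : n.+1%:R ^+ n.+1 != 0 :> R by rewrite expf_neq0// gt_eqF.
have xN : x != 0 by rewrite gt_eqF.
have xnN : x ^+ n != 0 by rewrite expf_neq0.
move: (c ^+ n.+1) (n.+1%:R ^+ n.+1) (x ^+ n) cN nN xnN => A B D A0 B0 D0.
by field; rewrite ?A0 ?B0 ?D0 ?xN.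
Qed.

(** Cuts a length [a] into equal pieces of length between [b] and [2 * b]; the upper bound is
    [m + 1 <= 2 * m]. *)
Lemma trunc_ratio (R : realType) (a b : R) : 0 < b -> b <= a ->
  let m := Num.trunc (a / b) in
  [/\ (0 < m)%N, m%:R * b <= a, b <= a / m%:R & a / m%:R <= 2 * b].
Proof.
move=> b0 ba m; have a0 : 0 < a by apply: lt_le_trans ba.
have /truncn_itv/andP[m1 m2] : 0 <= a / b by rewrite divr_ge0// ltW.
rewrite -/m in m1 m2.
have m0 : (0 < m)%N.
  rewrite lt0n; apply/negP => /eqP e; move: m2; rewrite e.
  by rewrite ltr_pdivrMr// mul1r ltNge ba.
have mR : 0 < m%:R :> R by rewrite ltr0n.
have mb : m%:R * b <= a by rewrite -ler_pdivlMr.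
split => //; first by rewrite ler_pdivlMr// mulrC.
rewrite ler_pdivrMr//; rewrite ltr_pdivrMr// in m2; apply: le_trans (ltW m2) _.
rewrite [leRHS]mulrAC ler_pM2r// -natrM ler_nat; lia.
Qed.

(** Bookkeeping of powers of [y = x^-1]: clearing the denominator turns the left side into at most
    [12 * y ^+ 23], and the right side is at least [12 * y * y ^+ 16]. *)
Lemma gain_bound (R : realType) (x y tau r c : R) :
  0 < y -> y <= 1 -> x * y = 1 -> y ^+ 8 <= tau -> 0 < r + 2 -> r + 2 <= x ->
  12 * y <= 1 - c -> 6 * y ^+ 24 <= (1 - c) * tau ^+ 2 / (2 * (r + 2)).
Proof.
move=> y0 y1 xy ht r0 rx hc.
have yn m : 0 <= y ^+ m by rewrite exprn_ge0// ltW.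
rewrite ler_pdivlMr ?mulr_gt0//.
have h1 : 6 * y ^+ 24 * (2 * (r + 2)) <= 12 * y ^+ 23.
  have -> : 12 * y ^+ 23 = 6 * y ^+ 24 * (2 * x).
    have -> : 6 * y ^+ 24 * (2 * x) = 12 * y ^+ 23 * (x * y) by ring.
    by rewrite xy mulr1.
  by apply: ler_wpM2l; [apply: mulr_ge0|lra].
apply: le_trans h1 _.
have h2 : 12 * y ^+ 23 <= 12 * y * y ^+ 16.
  rewrite -mulrA -exprS ler_wpM2l//.
  by rewrite -[leLHS]/(y ^+ (17 + 6)) exprD ler_piMr// exprn_ile1// ltW.
apply: le_trans h2 _; apply: ler_pM => //.
  by rewrite mulr_ge0// ltW.
by rewrite -[leLHS]/(y ^+ (8 * 2)) exprM lerXn2r ?nnegrE// (le_trans _ ht).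
Qed.

(** A valid coupling is required for every [s > 0], also where the prescribed boxes are not small
    enough for the exclusion; there some other valid coupling is chosen. *)
Lemma exists_coupling_family (R : realType) (p1 p2 th : R) (M K : R -> nat) :
  0 < p1 -> p1 < p2 -> p2 < 1 -> 1 < th ->
  p1 * th ^+ 9 < p2 -> (1 - p2) * th ^+ 9 < 1 - p1 ->
  let cp := p1 * th ^+ 9 / p2 in
  let cm := (1 - p1) / ((1 - p2) * th ^+ 9) in
  let rho s := s / (M s)%:R in
  let tau s := 2 * cm * s / (K s)%:R in
  exists C : R -> coupling R, forall s, 0 < s -> valid_coupling s p1 p2 (C s) /\
    ((0 < M s)%N -> (0 < K s)%N -> rho s * rho s * tau s <= ln th / 2 ->
      rho s * rho s * tau s <= 1 / 2 -> forall w,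
    [/\ forall u, c_P1p (C s) w u -> c_P2p (C s) w (u.1, u.2 * cp),
        forall v, c_P2m (C s) w v -> c_P1m (C s) w (v.1, v.2 / cm) &
        forall u v (k l : int), c_P1p (C s) w u -> c_P2m (C s) w v ->
          u.2 * cp < tau s -> v.2 < tau s ->
          `|u.1.1 - v.1.1 + k%:~R * s| < rho s ->
          `|u.1.2 - v.1.2 + l%:~R * s| < rho s -> False]).
Proof.
move=> p10 p12 p21 th1 h1 h2 cp cm rho tau.
have lth : 0 < ln th by rewrite ln_gt0.
have t90 : 0 < th ^+ 9 by rewrite exprn_gt0// (lt_trans _ th1).
have qt0 : 0 < (1 - p2) * th ^+ 9 by rewrite mulr_gt0// subr_gt0.
have cm1 : 1 < cm by rewrite ltr_pdivlMr ?mul1r.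
have cm0 : 0 < cm by apply: lt_trans cm1.
(* A single column of flat boxes: [M = 1], with [K0] large enough to make the volume at most
   [mm]. *)
have fallback s : 0 < s -> exists C : coupling R, valid_coupling s p1 p2 C.
  move=> s0; pose mm := Num.min (ln th / 2) (1 / 2).
  have mm0 : 0 < mm by rewrite lt_min !divr_gt0.
  have A0 : 0 < 2 * cm * s ^+ 3 by apply: mulr_gt0; [exact: mulr_gt0|exact: exprn_gt0].
  pose K0 := (Num.trunc (2 * cm * s ^+ 3 / mm)).+1.
  have K00 : 0 < K0%:R :> R by [].
  have hK : s / 1%:R * (s / 1%:R) * (2 * cm * s / K0%:R) <= mm.
    have /truncn_itv/andP[_ hlt] : 0 <= 2 * cm * s ^+ 3 / mm by rewrite divr_ge0// ltW.
    rewrite ltr_pdivrMr// in hlt.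
    rewrite divr1 mulrA ler_pdivrMr// [leRHS]mulrC.
    have -> : s * s * (2 * cm * s) = 2 * cm * s ^+ 3 by ring.
    exact: ltW.
  have [||C [vC _]] := exists_rescaled_coupling p10 p12 p21 th1 h1 h2 s0
    (isT : (0 < 1)%N) (isT : (0 < K0)%N); last by exists C.
  - by apply: le_trans hK _; rewrite ge_min lexx.
  - by apply: le_trans hK _; rewrite ge_min lexx orbT.
suff /choice[C hC] : forall s, exists C : coupling R, 0 < s ->
    valid_coupling s p1 p2 C /\
    ((0 < M s)%N -> (0 < K s)%N -> rho s * rho s * tau s <= ln th / 2 ->
      rho s * rho s * tau s <= 1 / 2 -> forall w,
    [/\ forall u, c_P1p C w u -> c_P2p C w (u.1, u.2 * cp),
        forall v, c_P2m C w v -> c_P1m C w (v.1, v.2 / cm) &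
        forall u v (k l : int), c_P1p C w u -> c_P2m C w v ->
          u.2 * cp < tau s -> v.2 < tau s ->
          `|u.1.1 - v.1.1 + k%:~R * s| < rho s ->
          `|u.1.2 - v.1.2 + l%:~R * s| < rho s -> False]) by exists C.
move=> s; have [s0|s0] := ltP 0 s; last first.
  by have [C _] := fallback 1 ltr01; exists C.
have [[M0 K0 hv1 hv2]|nh] := pselect [/\ (0 < M s)%N, (0 < K s)%N,
    rho s * rho s * tau s <= ln th / 2 & rho s * rho s * tau s <= 1 / 2].
  have [C [vC hC]] := exists_rescaled_coupling p10 p12 p21 th1 h1 h2 s0 M0 K0 hv1 hv2.
  by exists C => _; split.
have [C vC] := fallback s s0; exists C => _; split => // M0 K0 hv1 hv2.
by case: nh.
Qed.

Theorem theorem3p5 (R : realType) (k : norm_kind) (p1 p2 eps : R)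
  (delta : R -> R) :
  0 < p1 -> p1 < p2 -> p2 < 1 -> 0 < eps ->
  (forall s, 0 < s -> 0 < delta s /\ delta s <= powR s (- eps)) ->
  exists C : R -> coupling R,
    (forall s, 0 < s -> valid_coupling s p1 p2 (C s)) /\
    (forall eta, 0 < eta -> exists S : R, forall s, S <= s ->
       exists E : set (c_Omega (C s)), [/\ measurable E,
         E `<=` E_gl k s (delta s) (C s) &
         ((1 - eta)%:E <= c_P (C s) E)%E]).
Proof.
move=> p10 p12 p21 eps0 hdelta.
have p20 : 0 < p2 by apply: lt_trans p12.
have q20 : 0 < 1 - p2 by rewrite subr_gt0.
(* Nine steps with factor [th] have to fit strictly into both gaps of intensity, so that room is
   left for [cp < 1 < cm]. *)
have [th th1 thq] : exists2 th : R, 1 < th &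
    th ^+ 9 < Num.min (p2 / p1) ((1 - p1) / (1 - p2)).
  apply: exists_root_lt; rewrite lt_min !ltr_pdivlMr// !mul1r p12/=.
  by rewrite ltrD2l ltrN2.
have /andP[thq1 thq2] : (th ^+ 9 < p2 / p1) && (th ^+ 9 < (1 - p1) / (1 - p2)).
  by rewrite -lt_min.
have h1 : p1 * th ^+ 9 < p2 by rewrite mulrC -ltr_pdivlMr.
have h2 : (1 - p2) * th ^+ 9 < 1 - p1 by rewrite mulrC -ltr_pdivlMr.
have t90 : 0 < th ^+ 9 by rewrite exprn_gt0// (lt_trans _ th1).
have qt0 : 0 < (1 - p2) * th ^+ 9 by rewrite mulr_gt0.
pose cp := p1 * th ^+ 9 / p2; pose cm := (1 - p1) / ((1 - p2) * th ^+ 9).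
have cp0 : 0 < cp by rewrite divr_gt0// mulr_gt0.
have cp1 : cp < 1 by rewrite ltr_pdivrMr ?mul1r.
have cm1 : 1 < cm by rewrite ltr_pdivlMr ?mul1r.
have cm0 : 0 < cm by apply: lt_trans cm1.
have ci1 : cm^-1 < 1 by rewrite invf_lt1.
have lth : 0 < ln th by rewrite ln_gt0.
(* Capped at 1 so that [kap <= 1], hence [x <= s]; with [kap = e1 / 24] one has [x ^+ 24 = s] to the
   power [e1]. *)
pose e1 := Num.min eps 1.
have e10 : 0 < e1 by rewrite lt_min eps0 ltr01.
have e11 : e1 <= 1 by rewrite ge_min lexx orbT.
have e1e : e1 <= eps by rewrite ge_min lexx.
pose kap := e1 / 24.
have kap0 : 0 < kap by rewrite divr_gt0.
have kap1 : kap <= 1 by rewrite ler_pdivrMr// mul1r (le_trans e11)// ler1n.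
(* With x = s^kap every scale is a power of x: the boxes have side about x and
   height about x^-8, and delta <= x^-24. *)
pose X s : R := s `^ kap.
pose M s := Num.trunc (s / X s).
pose K s := Num.trunc (2 * cm * s / (X s)^-1 ^+ 8).
have [C hC] := exists_coupling_family M K p10 p12 p21 th1 h1 h2.
exists C; split=> [s s0|eta eta0]; first by case: (hC s s0).
pose mm := Num.min (ln th / 2) (1 / 2).
have mm0 : 0 < mm by rewrite lt_min !divr_gt0.
(* An exponent with [s ^+ 2 <= x ^+ n0]; it absorbs the number of cubes in the union bound. *)
pose n0 := (Num.trunc (2 / kap)).+1.
have n0k : 2 <= kap * n0%:R.
  have /truncn_itv/andP[_ hlt] : 0 <= 2 / kap by rewrite divr_ge0// ltW.
  by rewrite mulrC -ler_pdivrMr// ltW.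
(* The cubes of [dense_event] have side [rho / 8], so their mean number of points is
   [c0 * rho ^+ 3], at least [c0 * x]. *)
pose c0 := p1 / 8 ^+ 3; have c00 : 0 < c0 by rewrite divr_gt0// exprn_gt0.
pose B := (n0.+1%:R / c0) ^+ n0.+1.
have B0 : 0 < B by rewrite exprn_gt0// divr_gt0.
have a1 : 0 < 8 / mm by rewrite divr_gt0.
have a2 : 0 < 12 / (1 - cp) by rewrite divr_gt0// subr_gt0.
have a3 : 0 < 12 / (1 - cm^-1) by rewrite divr_gt0// subr_gt0.
have a4 : 0 < 64 * B / eta by rewrite divr_gt0// mulr_gt0.
(* One summand per requirement on [x]: 16 for the comparisons of lengths, [8 / mm] for the box
   volume, the two terms with 12 for [gain_bound], the last for the failure probability. *)
pose X0 := 16 + 8 / mm + 12 / (1 - cp) + 12 / (1 - cm^-1) + 64 * B / eta.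
have X016 : 16 <= X0 by rewrite /X0; lra.
have X00 : 0 < X0 by apply: lt_le_trans X016.
exists (X0 `^ kap^-1) => s hs.
have s1 : 1 <= s.
  apply: le_trans hs; have e : 1 `^ kap^-1 = 1 :> R by rewrite powR1.
  rewrite -[leLHS]e; apply: ge0_ler_powR.
  - by rewrite invr_ge0 ltW.
  - by rewrite nnegrE.
  - by rewrite nnegrE ltW.
  - by apply: le_trans X016; rewrite ler1n.
have s0 : 0 < s by apply: lt_le_trans s1.
pose x := X s; pose y := x^-1.
have xX : X0 <= x.
  rewrite /x /X -[leLHS](_ : (X0 `^ kap^-1) `^ kap = X0); last first.
    by rewrite -powRrM mulVf ?gt_eqF// powRr1// ltW.
  by apply: ge0_ler_powR; rewrite ?nnegrE ?powR_ge0 ?(ltW kap0) ?(ltW s0).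
have x16 : 16 <= x by apply: le_trans xX.
have x0 : 0 < x by apply: lt_le_trans x16.
have x1 : 1 <= x by apply: le_trans x16; rewrite ler1n.
have xs : x <= s.
  by rewrite /x /X -[leRHS]powRr1 ?(ltW s0)//; apply: ler_powR.
have y0 : 0 < y by rewrite invr_gt0.
have y1 : y <= 1 by rewrite invf_le1.
have xy : x * y = 1 by rewrite mulfV// gt_eqF.
have hy (a b : R) : 0 < b -> a / b <= x -> a * y <= b.
  move=> b0; rewrite ler_pdivrMr// => /(ler_wpM2r (ltW y0)).
  by rewrite mulrAC xy mul1r.
have [M0 Mx rho1 rho2] := trunc_ratio x0 xs.
rewrite -/(M s) in M0 Mx rho1 rho2.
have yn m : 0 < y ^+ m by rewrite exprn_gt0.
have y8 : y ^+ 8 <= 2 * cm * s.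
  apply: (@le_trans _ _ 1); first by rewrite exprn_ile1// ltW.
  by apply: mulr_ege1 => //; apply: mulr_ege1; rewrite ?ler1n// ltW.
have [K0 _ tau1 tau2] := trunc_ratio (yn 8%N) y8.
rewrite -/(K s) in K0 tau1 tau2.
set rho := s / (M s)%:R in rho1 rho2.
set tau := 2 * cm * s / (K s)%:R in tau1 tau2.
have tau0 : 0 < tau by apply: lt_le_trans tau1.
have y16 : 16 * y <= 1 by apply: hy => //; rewrite divr1.
(* From [rho <= 2 * x] and [tau <= 2 * y ^+ 8] the volume is at most [8 * y ^+ 6], hence at most
   [8 * y]. *)
have v1 : rho * rho * tau <= mm.
  apply: (@le_trans _ _ (2 * x * (2 * x) * (2 * y ^+ 8))).
    have rho0 : 0 <= rho by apply: le_trans rho1; exact: ltW.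
    apply: ler_pM; [exact: mulr_ge0|exact: ltW|exact: ler_pM|exact: tau2].
  have -> : 2 * x * (2 * x) * (2 * y ^+ 8) = 8 * (x * y) ^+ 2 * (y * y ^+ 5) by ring.
  rewrite xy expr1n mulr1; apply: (@le_trans _ _ (8 * y)).
    by rewrite ler_wpM2l// ler_piMr ?(ltW y0)// exprn_ile1// ltW.
  by apply: hy => //; apply: le_trans xX; rewrite /X0; lra.
have v2 : rho * rho * tau <= ln th / 2 by apply: le_trans v1 _; rewrite ge_min lexx.
have v3 : rho * rho * tau <= 1 / 2 by apply: le_trans v1 _; rewrite ge_min lexx orbT.
have [vC hw] := hC s s0; have {}hw := hw M0 K0 v2 v3.
have [[PP1 _ _ _] _] := vC.
have MR : 0 < (M s)%:R :> R by rewrite ltr0n.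
(* The factor 8 gives [r = 3 * rho / 8], so that [2 * r + 4 <= rho] as soon as [rho >= 16]. *)
pose N := (8 * M s)%N.
have N0 : (0 < N)%N by rewrite muln_gt0 M0.
have sN : s / N%:R = rho / 8.
  by rewrite /N /rho natrM; field; rewrite gt_eqF.
(* The only random requirement: everything else about the coupling holds at every sample point. *)
have [mE PE] := dense_event_prob s0 N0 PP1.
exists (@dense_event R (C s) s N); split => //; last first.
  apply: le_trans PE; rewrite lee_fin lerD2l lerN2 sN.
  apply: (@le_trans _ _ (64 * (x ^+ n0 * expR (- (c0 * x))))).
    rewrite mulrA; apply: ler_pM; [by []|exact: expR_ge0| |].
      have -> : (N ^ 2)%:R = 64 * (M s)%:R ^+ 2 :> R by rewrite natrX /N natrM; ring.
      apply: ler_wpM2l => //.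
      have Ms : (M s)%:R <= s.
        by apply: le_trans Mx; rewrite ler_peMr// ltW.
      apply: (@le_trans _ _ (s ^+ 2)); first by rewrite lerXn2r// nnegrE ltW.
      have -> : s ^+ 2 = s `^ 2%:R by rewrite powR_mulrn// ltW.
      have -> : x ^+ n0 = s `^ (kap * n0%:R) by rewrite powRrM powR_mulrn// ltW.
      exact: ler_powR.
    rewrite ler_expR lerN2 /c0.
    have r3 : x <= rho ^+ 3.
      apply: (@le_trans _ _ (x ^+ 3)); first by apply: ler_eXnr.
      by rewrite lerXn2r ?nnegrE ?(ltW x0)// (le_trans _ rho1)// ltW.
    have -> : p1 * (rho / 8) ^+ 3 = p1 / 8 ^+ 3 * rho ^+ 3.
      by rewrite expr_div_n mulrA mulrAC.
    by rewrite ler_wpM2l// ltW.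
  apply: (@le_trans _ _ (64 * (B / x))); first by rewrite ler_wpM2l// expR_pow_bound.
  rewrite mulrA; apply: hy => //.
  by apply: le_trans xX; rewrite /X0; lra.
move=> w Ew u0 us hbl.
have ln0 : 0 <= ln s by rewrite ln_ge0.
have selfd z : tdist k s (Defs.lift0 z) (Defs.lift0 z) <= ln s.
  exact: le_trans (tdist_xx k s z) ln0.
exists u0, us; split; [|by move=> z hz; exists z|by move=> z hz; exists z].
move=> z hz; have [w1 w2 w3] := hw w.
pose r := 3 * (s / N%:R).
have rE : r = 3 * (rho / 8) by rewrite /r sN.
have hd : 2 * C_d k * delta s <= 6 * y ^+ 24.
  have [d0 dle] := hdelta s s0.
  have dy : delta s <= y ^+ 24.
    apply: le_trans dle _.
    have -> : y ^+ 24 = s `^ (- e1).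
      have ke : kap * 24%:R = e1 by rewrite /kap divfK.
      rewrite powRN /y exprVn; congr _^-1.
      by rewrite -ke powRrM powR_mulrn// ltW.
    by apply: ler_powR => //; rewrite lerN2.
  apply: (@le_trans _ _ (6 * delta s)); last by rewrite ler_wpM2l.
  rewrite ler_wpM2r ?(ltW d0)//; have := C_d_le3 R k; lra.
have yle : y ^+ 24 <= y by rewrite exprS ler_piMr ?(ltW y0)// exprn_ile1// ltW.
have bp : 2 * C_d k * delta s <= (1 - cp) * tau ^+ 2 / (2 * (r + 2)).
  apply: le_trans hd _; apply: (@gain_bound R x y); rewrite ?rE//; try lra.
  by apply: hy; [rewrite subr_gt0|apply: le_trans xX; rewrite /X0; lra].
have bm : 2 * C_d k * delta s <= (1 - cm^-1) * tau ^+ 2 / (2 * (r + 2)).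
  apply: le_trans hd _; apply: (@gain_bound R x y); rewrite ?rE//; try lra.
  by apply: hy; [rewrite subr_gt0|apply: le_trans xX; rewrite /X0; lra].
have t1 : tau <= 1.
  have : y ^+ 8 <= y by rewrite exprS ler_piMr ?(ltW y0)// exprn_ile1// ltW.
  by lra.
apply: (@robust_of_black R k s cp cm tau rho r _ (c_P1p (C s) w) (c_P1m (C s) w)
  _ _ cp0 cp1 cm1 tau0 t1 _ _ _ bp bm _ w1 w2 w3).
- by rewrite rE; lra.
- by rewrite rE; lra.
- by lra.
- move=> u Pu; have [sub _ _] := PP1; have [_ _ /andP[]] := sub w u Pu; by [].
- exact: dense_event_near.
- exact: hbl.
Qed.
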